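(* Let $J\in\mathbb N$ and consider the $J$-dimensional process $\boldsymbol M(t)=(M^{(1)}(t),\dots,M^{(J)}(t))$ whose components, all modulated by the same background chain $X$, satisfy $$\mathrm dM^{(j)}(t)=\left(\alpha^{(j)}_{X(t)}-\gamma^{(j)}_{X(t)}M^{(j)}(t)\right)\mathrm dt+\sigma^{(j)}_{X(t)}\,\mathrm dB_j(t),\qquad j=1,\dots,J.$$ Let $(\boldsymbol M,X)=(M^{(1)},\dots,M^{(J)},X)$ have the stationary distribution of the Markov process $(\boldsymbol M(t),X(t))_{t\ge0}$, and for $\boldsymbol k\in\{0,1,2,\dots\}^J$ let $\boldsymbol h_{\boldsymbol k}=(h_{1,\boldsymbol k},\dots,h_{d,\boldsymbol k})^{\rm T}$ with $$h_{i,\boldsymbol k}:=\mathbb E\left[(-1)^{\sum_{j=1}^Jk_j}(M^{(1)})^{k_1}\cdots(M^{(J)})^{k_J}\mathbf 1\{X=i\}\right].$$ Then $\boldsymbol h_{\boldsymbol 0}=\boldsymbol\pi$ and, for every $\boldsymbol k\neq\boldsymbol 0$, $$\boldsymbol h_{\boldsymbol k}=\left(Q^{\rm T}-\sum_{j=1}^Jk_j\,\mathrm{diag}\{\boldsymbol\gamma^{(j)}\}\right)^{-1}\left(\sum_{j=1}^Jk_j\,\mathrm{diag}\{\boldsymbol\alpha^{(j)}\}\boldsymbol h_{\boldsymbol k-\boldsymbol e_j}-\frac12\sum_{j=1}^Jk_j(k_j-1)\,\mathrm{diag}\{(\boldsymbol\sigma^{(j)})^2\}\boldsymbol h_{\boldsymbol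 k-2\boldsymbol e_j}\right),$$ where terms with coefficient $0$ are absent.
   Context: $X$ is a continuous-time Markov chain on $\{1,\dots,d\}$ with generator $Q$ and unique invariant distribution $\boldsymbol\pi$ (column vector); $B_1,\dots,B_J$ are independent standard Brownian motions, independent of $X$. For each $j$, $\boldsymbol\alpha^{(j)},\boldsymbol\gamma^{(j)},\boldsymbol\sigma^{(j)}\in\mathbb R^d$ with $\gamma^{(j)}_i>0$, and $(\boldsymbol\sigma^{(j)})^2$ denotes the vector of squared entries. $\boldsymbol e_j\in\mathbb R^J$ is the $j$-th unit vector. *)

(* Defs.v *)
From HB Require Import structures.
From mathcomp Require Import all_boot all_order all_algebra.
From mathcomp Require Import all_classical all_reals all_analysis.

Set Implicit Arguments.
Unset Strict Implicit.
Unset Printing Implicit Defensive.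

Import Order.TTheory GRing.Theory Num.Theory.
Import numFieldTopology.Exports numFieldNormedType.Exports.

Local Open Scope classical_set_scope.
Local Open Scope ring_scope.

(* The library has no sigma-algebra on 'I_n; finite types get the discrete one.
   Measurable types are pointed, hence the successor. *)
HB.instance Definition _ (n : nat) := isPointed.Build 'I_n.+1 ord0.
HB.instance Definition _ (n : nat) :=
  @isMeasurable.Build default_measure_display 'I_n.+1
    discrete_measurable discrete_measurable0
    discrete_measurableC discrete_measurableU.

Section Independence.
Context {R : realType} {dT : measure_display} {T : measurableType dT}.
Implicit Types (P : {measure set T -> \bar R}).

(* sigma(Y_i : i in D) *)
Definition sigma_family {I : Type} {dE : measure_display} {E : measurableType dE}
    (D : set I) (Y : I -> T -> E) : set (set T) :=
  <<s \bigcup_(i in D) preimage_set_system setT (Y i) measurable >>.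

Definition independent P (F G : set (set T)) : Prop :=
  forall A B, F A -> G B -> (P (A `&` B) = P A * P B)%E.

Definition mutually_independent P {I : finType} (F : I -> set (set T)) : Prop :=
  forall (S : {set I}) (A : I -> set T), (forall i, i \in S -> F i (A i)) ->
    fine (P (\bigcap_(i in [set` S]) A i)) = \prod_(i in S) fine (P (A i)).

End Independence.

Section MarkovChain.
Context {R : realType} {d : nat}.
Implicit Types (Q : 'M[R]_d.+1) (p : R -> 'M[R]_d.+1) (rho : 'cV[R]_d.+1).

Definition is_generator Q : Prop :=
  (forall i j, i != j -> 0 <= Q i j) /\ (forall i, \sum_j Q i j = 0).

Definition invariant_distribution Q rho : Prop :=
  [/\ forall i, 0 <= rho i 0, \sum_i rho i 0 = 1 & Q^T *m rho = 0].

Definition unique_invariant_distribution Q rho : Prop :=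
  invariant_distribution Q rho /\
  forall rho', invariant_distribution Q rho' -> rho' = rho.

(* p is the semigroup of stochastic matrices generated by Q, i.e. exp(tQ). *)
Definition transition_semigroup Q p : Prop :=
  [/\ forall t, 0 <= t ->
        (forall i j, 0 <= p t i j) /\ (forall i, \sum_j p t i j = 1),
      p 0 = 1%:M,
      forall s t, 0 <= s -> 0 <= t -> p (s + t) = p s *m p t
    & forall i j, h^-1 * (p h i j - p 0 i j) @[h --> 0^'+] --> Q i j].

Context {dT : measure_display} {T : measurableType dT}.

(* Being right-continuous with left limits in a discrete space means being
   constant on some [t, t + e[ and on some ]t - e, t[. *)
Definition cadlag_discrete (x : R -> 'I_d.+1) : Prop :=
  (forall t, 0 <= t -> \forall s \near t^'+, x s = x t) /\
  (forall t, 0 < t -> exists i, \forall s \near t^'-, x s = i).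

Definition markov_chain (P : {measure set T -> \bar R}) Q
    (X : R -> T -> 'I_d.+1) : Prop :=
  [/\ forall t, 0 <= t -> measurable_fun setT (X t),
      forall w, cadlag_discrete (X ^~ w)
    & exists2 p, transition_semigroup Q p &
        forall s t, 0 <= s <= t -> forall i j A, sigma_family `[0, s] X A ->
          (P (A `&` [set w | X s w = i] `&` [set w | X t w = j]) =
           P (A `&` [set w | X s w = i]) * (p (t - s) i j)%:E)%E].

End MarkovChain.

Section BrownianMotion.
Context {R : realType} {dT : measure_display} {T : measurableType dT}.

(* normal_prob is parametrised by the standard deviation. *)
Definition standard_brownian_motion (P : {measure set T -> \bar R})
    (B : R -> T -> R) : Prop :=
  [/\ forall t, 0 <= t -> measurable_fun setT (B t),
      forall w, {within `[0, +oo[, continuous (B ^~ w)},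
      {ae P, forall w, B 0 w = 0},
      forall s t, 0 <= s < t -> forall A : set R, measurable A ->
        P ((fun w => B t w - B s w) @^-1` A) = normal_prob 0 (Num.sqrt (t - s)) A
    & forall s t, 0 <= s <= t ->
        independent P
          (preimage_set_system setT (fun w => B t w - B s w) measurable)
          (sigma_family `[0, s] B)].

End BrownianMotion.

Section ItoIntegral.
Context {R : realType} {dT : measure_display} {T : measurableType dT}.
Variables (P : {measure set T -> \bar R}) (F : R -> set (set T)).

(* The elementary process \sum_k xi_k 1_]a_k, b_k] on [0, t], with xi_k bounded
   and F_{a_k}-measurable; the intervals ]a_k, b_k] may overlap. *)
Record elementary (t : R) := Elementary {
  el_size : nat;
  el_left : 'I_el_size -> R;
  el_right : 'I_el_size -> R;
  el_coef : 'I_el_size -> T -> R;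
  el_itv : forall k, 0 <= el_left k <= el_right k /\ el_right k <= t;
  el_bounded : forall k, exists C, forall w, `|el_coef k w| <= C;
  el_adapted : forall k (A : set R), measurable A ->
    F (el_left k) (el_coef k @^-1` A) }.

Arguments el_left {t} e k.
Arguments el_right {t} e k.
Arguments el_coef {t} e k w.

Definition el_process t (phi : elementary t) (s : R) (w : T) : R :=
  \sum_k el_coef phi k w * \1_(`]el_left phi k, el_right phi k]) s.

Definition el_integral (B : R -> T -> R) t (phi : elementary t) (w : T) : R :=
  \sum_k el_coef phi k w * (B (el_right phi k) w - B (el_left phi k) w).

(* I is (a version of) the Ito integral of H against B over [0, t]: the L^2(P)
   limit of the integrals of elementary processes that approximate H in
   L^2([0, t] x T). *)
Definition ito_integral (B H : R -> T -> R) (t : R) (I : T -> R) : Prop :=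
  measurable_fun setT I /\
  exists phi : nat -> elementary t,
    ((\int[P]_w \int[lebesgue_measure]_(s in `[0%R, t])
         ((H s w - el_process (phi n) s w) ^+ 2)%:E)%E @[n --> \oo] --> 0%E) /\
    ((\int[P]_w ((I w - el_integral B (phi n) w) ^+ 2)%:E)%E
       @[n --> \oo] --> 0%E).

End ItoIntegral.

Section ModulatedOU.
Context {R : realType} {d J : nat}.

Context {dT : measure_display} {T : measurableType dT}.

Definition joint_process (M : 'I_J -> R -> T -> R) (X : R -> T -> 'I_d.+1)
    (t : R) (w : T) : J.-tuple R * 'I_d.+1 :=
  ([tuple M j t w | j < J], X t w).

Definition history (X : R -> T -> 'I_d.+1) (B : 'I_J -> R -> T -> R) (t : R) :
    set (set T) :=
  <<s sigma_family `[0, t] X `|` \bigcup_j sigma_family `[0, t] (B j) >>.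

(* Under P: X is a Markov chain with generator Q, the B_j are independent
   standard Brownian motions independent of X, and M solves
     dM_j = (alpha_j(X) - gamma_j(X) M_j) dt + sigma_j(X) dB_j
   with (M(0), X(0)) = x. *)
Record modulated_OU (Q : 'M[R]_d.+1) (alpha gamma sigma : 'I_J -> 'rV[R]_d.+1)
    (P : {measure set T -> \bar R}) (x : J.-tuple R * 'I_d.+1)
    (X : R -> T -> 'I_d.+1) (B M : 'I_J -> R -> T -> R) : Prop := ModulatedOU {
  mou_chain : markov_chain P Q X;
  mou_brownian : forall j, standard_brownian_motion P (B j);
  mou_brownian_indep :
    mutually_independent P (fun j => sigma_family `[0, +oo[ (B j));
  mou_chain_indep :
    independent P (sigma_family `[0, +oo[ X)
      <<s \bigcup_j sigma_family `[0, +oo[ (B j) >>;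
  mou_start : {ae P, forall w, joint_process M X 0 w = x};
  mou_measurable : forall j t, 0 <= t -> measurable_fun setT (M j t);
  mou_continuous : forall j w, {within `[0, +oo[, continuous (M j ^~ w)};
  mou_sde : forall j, exists2 I : R -> T -> R,
    forall t, 0 <= t ->
      ito_integral P (history X B) (B j) (fun s w => sigma j 0 (X s w)) t (I t) &
    {ae P, forall w, forall t, 0 <= t ->
      M j t w = M j 0 w
        + \int[lebesgue_measure]_(s in `[0, t])
            (alpha j 0 (X s w) - gamma j 0 (X s w) * M j s w)
        + I t w} }.

End ModulatedOU.

(* (P_x, Y) is a Markov process given as a family of laws indexed by the starting
   point, so that x, A |-> P_x(Y_t \in A) is its transition kernel at time t. *)
Definition stationary_distribution {R : realType} {dE dT : measure_display}
    {E : measurableType dE} {T : measurableType dT}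
    (P : R.-pker E ~> T) (Y : R -> T -> E) (mu : probability E R) : Prop :=
  forall t, 0 <= t -> forall A : set E, measurable A ->
    (\int[mu]_x P x (Y t @^-1` A))%E = mu A.

Section Moments.
Context {R : realType} {d J : nat}.
Context {dS : measure_display} {S : measurableType dS}.

Definition moment_rv (Z : S -> J.-tuple R * 'I_d.+1) (k : {ffun 'I_J -> nat})
    (i : 'I_d.+1) (w : S) : R :=
  (-1) ^+ (\sum_j k j)%N * (\prod_j tnth (Z w).1 j ^+ k j) * ((Z w).2 == i)%:R.

Definition moment_vector (P : probability S R) (Z : S -> J.-tuple R * 'I_d.+1)
    (k : {ffun 'I_J -> nat}) : 'cV[R]_d.+1 :=
  \col_i fine 'E_P[moment_rv Z k i].

End Moments.

(* k - n e_j, truncated at 0. *)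
Definition index_sub {J : nat} (k : {ffun 'I_J -> nat}) (j : 'I_J) (n : nat) :
    {ffun 'I_J -> nat} :=
  [ffun l => (k l - (if l == j then n else 0))%N].

(* Main.v *)
From HB Require Import structures.
Require Import Defs.
From mathcomp Require Import all_boot all_order all_algebra.
From mathcomp Require Import all_classical all_reals all_analysis.
From mathcomp Require Import measurable_realfun.
From mathcomp Require Import ring lra.

Set Implicit Arguments.
Unset Strict Implicit.
Unset Printing Implicit Defensive.

Import Order.TTheory GRing.Theory Num.Theory.
Import numFieldTopology.Exports numFieldNormedType.Exports.
Local Open Scope classical_set_scope.
Local Open Scope ring_scope.

(* The recursion says that L g has mean 0 under the stationary law, where L is the
   generator and g the monomial f restricted to {X = i}; so a small-time expansion
   suffices and Ito's formula is not needed. Put t = s^2 and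
   M_j(t) = M_j(0) + A_j + N_j with A_j the integral of the drift, of order s^2,
   and N_j the Ito integral, of order s. Expanding the monomial in (A_j + N_j) / s
   to second order and using E[1{X(t) = i} N_j] = 0,
   E[1{X(t) = i} N_j N_l] = 0 for j <> l and
   E[1{X(t) = i} N_j^2] = 1{X(0) = i} sigma_j^2 t + O(t^2) gives
     E_x[g(M(t), X(t))] = g(x) + t L g(x) + o(t),   x = (m, i0),
   where o(t) is uniform up to a power of 1 + sum_j |m_j|. Integrating against the
   stationary law, whose moments are finite because
   |M_j(t)| <= c |M_j(0)| + zeta with c < 1 and zeta having bounded moments for a
   fixed small t, cancels the terms of order 0 and leaves that L g has mean 0.
   The facts on N_j are obtained by approximating it by the sums
   sum_k sigma_j(X(t_k)) (B_j(t_{k+1}) - B_j(t_k)): the increments of B_j after t_k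
   are independent of the whole chain, of the other Brownian motions and of the
   past of B_j up to t_k. The matrix of the recursion is invertible because its
   transpose is strictly diagonally dominant. *)

(** * Moments and means *)

(** The Ito integral is given only as an [L^2] limit of elementary integrals, separately for each
    time and up to null sets, so nothing can be computed on it directly. Families of adapted
    coefficients are compared with it through the isometry; explicit sums on a regular grid, whose
    mean square error is of order [1 / n] because the chain leaves a state at a bounded rate, then
    carry each identity to the limit. Convergence in [L^2] says nothing of higher moments, which
    come from truncation. Finite moments of the stationary law are not assumed either, so the
    contraction estimate is also run on truncated functions. With [s] the square root of time, all
    rescaled quantities have moments bounded uniformly in [s] by a power of the starting weight;
    such quantities form an algebra, so the remainder of a product never has to be estimated by
    hand. Three conditions fix the range of [s]: [s <= 1], [s ^+ 2 <= h0] for the linear exit bound,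
    and [C * s ^+ 2 <= 1 / 2], with which the drift is absorbed without Gronwall's lemma. *)

Section Mixture.
Context {d d'} {X : measurableType d} {Y : measurableType d'} {R : realType}.
Variables (mu : {measure set X -> \bar R}) (k : X -> {measure set Y -> \bar R}).
Variable m : {measure set Y -> \bar R}.
Hypothesis mk : forall U, measurable U -> measurable_fun setT (k ^~ U).
Hypothesis mE : forall U, measurable U -> m U = (\int[mu]_x (k x U))%E.
Local Open Scope ereal_scope.
Import HBNNSimple.

Lemma integral_mixture_nnsfun (f : {nnsfun Y >-> R}) :
  \int[m]_y (f y)%:E = \int[mu]_x \int[k x]_y (f y)%:E.
Proof.
have kE x : \int[k x]_y (f y)%:E =
    \sum_(r \in range f) r%:E * k x (f @^-1` [set r]).
  under eq_integral do rewrite fimfunE -fsumEFin//.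
  rewrite ge0_integral_fsum//; last 2 first.
    by move=> r; exact/measurable_EFinP/measurableT_comp.
    by move=> r z _; rewrite EFinM nnfun_muleindic_ge0.
  apply: eq_fsbigr => r _; rewrite integralZl_indic_nnsfun//=.
  by rewrite integral_indic//= setIT.
have mE' : \int[m]_y (f y)%:E = \sum_(r \in range f) r%:E * m (f @^-1` [set r]).
  under eq_integral do rewrite fimfunE -fsumEFin//.
  rewrite ge0_integral_fsum//; last 2 first.
    by move=> r; exact/measurable_EFinP/measurableT_comp.
    by move=> r z _; rewrite EFinM nnfun_muleindic_ge0.
  apply: eq_fsbigr => r _; rewrite integralZl_indic_nnsfun//=.
  by rewrite integral_indic//= setIT.
rewrite mE'; under [RHS]eq_integral do rewrite kE.
have kge0 r x : 0 <= r%:E * k x (f @^-1` [set r]).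
  have [r0|r0] := leP 0%R r; first by rewrite mule_ge0 ?lee_fin.
  by rewrite preimage_nnfun0// measure0 mule0.
rewrite ge0_integral_fsum//; last first.
  move=> r; apply: emeasurable_funM; first exact: measurable_cst.
  exact: mk.
apply: eq_fsbigr => r _.
have [r0|r0] := leP 0%R r.
  by rewrite ge0_integralZl ?lee_fin// ?mE//; exact: mk.
by rewrite preimage_nnfun0// measure0 mule0 integral0_eq// => x _;
  rewrite measure0 mule0.
Qed.

(** Simple functions and monotone convergence extend [mE] from sets to functions. Two mixtures
    occur: the normal law as Dirac masses weighted by its density, and the stationary law as the
    average of the laws at a fixed time. *)
Lemma integral_mixture (f : Y -> \bar R) :
  (forall y, 0 <= f y) -> measurable_fun setT f ->
  \int[m]_y f y = \int[mu]_x \int[k x]_y f y.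
Proof.
move=> f0 mf.
pose f_ := nnsfun_approx measurableT mf.
have H (nu : {measure set Y -> \bar R}) :
    \int[nu]_y f y = limn (fun n => \int[nu]_y (f_ n y)%:E).
  rewrite -monotone_convergence//; last 3 first.
    by move=> n; exact/measurable_EFinP.
    by move=> n z _; rewrite lee_fin.
    by move=> z _ a b ab; rewrite lee_fin; exact/lefP/nd_nnsfun_approx.
  apply: eq_integral => y _; apply/esym/cvg_lim => //.
  exact: cvg_nnsfun_approx.
rewrite H; under eq_fun do rewrite integral_mixture_nnsfun.
under [RHS]eq_integral do rewrite H.
rewrite monotone_convergence//.
- move=> n; apply: measurable_fun_integral_kernel => //.
  + by move=> z; rewrite lee_fin.
  + exact/measurable_EFinP.
- by move=> n y _; apply: integral_ge0 => // z _; rewrite lee_fin.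
- move=> y _ a b ab; apply: ge0_le_integral => //.
  + by move=> z _; rewrite lee_fin.
  + exact/measurable_EFinP.
  + exact/measurable_EFinP.
  + by move=> z _; rewrite lee_fin; exact/lefP/nd_nnsfun_approx.
Qed.

End Mixture.

Lemma integral_normal_prob (R : realType) (s : R) (f : R -> R) :
  (forall x, 0 <= f x) -> measurable_fun setT f ->
  (\int[normal_prob 0 s]_x (f x)%:E =
   \int[lebesgue_measure]_x (f x * normal_pdf 0 s x)%:E)%E.
Proof.
move=> f0 mf.
(* The normal law is the mixture, over Lebesgue measure, of the Dirac masses at [x] with weight the
   density at [x]. *)
pose k (x : R) : {measure set (measurableTypeR R) -> \bar R} := mscale (NngNum (normal_pdf_ge0 0 s x)) (dirac (x : measurableTypeR R)).
have kE x (A : set R) : k x A = ((normal_pdf 0 s x)%:E * (\1_A x)%:E)%E.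
  by rewrite /k/= /mscale/= diracE.
pose m : {measure set (measurableTypeR R) -> \bar R} := normal_prob 0 s.
rewrite -[LHS]/(\int[m]_x (f x)%:E)%E.
rewrite (@integral_mixture _ _ _ _ _ lebesgue_measure k m).
- apply: eq_integral => x _.
  rewrite ge0_integral_mscale//=; last 2 first.
  + exact/measurable_EFinP.
  + by move=> *; rewrite lee_fin.
  rewrite integral_dirac//=; last exact/measurable_EFinP.
  by rewrite diracT mul1e -EFinM mulrC.
- move=> U mU; under eq_fun do rewrite kE; apply: emeasurable_funM.
  + by apply/measurable_EFinP; exact: measurable_normal_pdf.
  + by apply/measurable_EFinP; exact: measurable_indic.
- move=> U mU.
  rewrite -[LHS]/(\int[lebesgue_measure]_(x in U) (normal_pdf 0 s x)%:E)%E.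
  rewrite [LHS]integral_mkcond; congr (integral _ _ _); apply/funext => x.
  by rewrite kE patchE indicE; case: (x \in U); rewrite ?mule1 ?mule0.
- by move=> x; rewrite lee_fin.
- exact/measurable_EFinP.
Qed.

Section AllMoments.
Context {d} {T : measurableType d} {R : realType} (P : probability T R).
Implicit Types (U V : T -> R).

(** Unlike integrability, this property is stable under products and powers, so the integrability
    conditions in all later computations of means follow from the shape of the integrand. *)
Definition all_moments U : Prop :=
  measurable_fun setT U /\
  forall n, P.-integrable setT (EFin \o (fun w => `|U w| ^+ n)).

Lemma all_moments_measurable U : all_moments U -> measurable_fun setT U.
Proof. by case. Qed.

Lemma le_all_moments U V : measurable_fun setT U ->
  (forall w, `|U w| <= `|V w|) -> all_moments V -> all_moments U.
Proof.
move=> mU UV [mV iV]; split=> // n; apply: le_integrable (iV n) => //.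
- apply/measurable_EFinP; apply: measurable_funX; exact: measurableT_comp.
- move=> w _ /=; rewrite lee_fin !normrX !normr_id.
  by rewrite lerXn2r// nnegrE.
Qed.

Lemma all_moments_cst c : all_moments (fun=> c).
Proof.
split=> [|n]; first exact: measurable_cst.
exact: finite_measure_integrable_cst.
Qed.

Lemma all_momentsN U : all_moments U -> all_moments (fun w => - U w).
Proof.
move=> UP; apply: le_all_moments (UP) => [|w]; last by rewrite normrN.
by apply: measurable_funN; case: UP.
Qed.

Lemma normr_exp2D (a b : R) n : `|a + b| ^+ n <= 2 ^+ n * (`|a| ^+ n + `|b| ^+ n).
Proof.
wlog : a b / `|a| <= `|b| => [hw|ab].
  have [/hw//|/ltW/hw] := lerP `|a| `|b|.
  by rewrite addrC (addrC (`|b| ^+ n)).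
apply: (@le_trans _ _ ((2 * `|b|) ^+ n)).
  rewrite lerXn2r ?nnegrE ?mulr_ge0//.
  by rewrite (le_trans (ler_normD _ _))// mulr_natl mulr2n lerD2r.
rewrite exprMn ler_pM2l ?exprn_gt0//.
by rewrite lerDr exprn_ge0.
Qed.

Lemma all_momentsD U V : all_moments U -> all_moments V ->
  all_moments (fun w => U w + V w).
Proof.
move=> [mU iU] [mV iV]; split=> [|n]; first exact: measurable_funD.
apply: (@le_integrable _ _ _ P _ measurableT _
  (fun w => (2 ^+ n)%:E * ((`|U w| ^+ n)%:E + (`|V w| ^+ n)%:E))%E).
- apply/measurable_EFinP; apply: measurable_funX; apply: measurableT_comp => //.
  exact: measurable_funD.
- move=> w _ /=; rewrite lee_fin !normrX normr_id.
  by rewrite [leRHS]ger0_norm ?mulr_ge0 ?addr_ge0// ?exprn_ge0// normr_exp2D.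
- apply: integrableZl => //; apply: integrableD => //; [exact: iU|exact: iV].
Qed.

Lemma normr_expM_le (a b : R) n :
  `|a * b| ^+ n <= `|a| ^+ n.*2 + `|b| ^+ n.*2.
Proof.
rewrite normrM exprMn -!addnn !exprD.
have : 0 <= (`|a| ^+ n - `|b| ^+ n) ^+ 2 by rewrite sqr_ge0.
have : 0 <= `|a| ^+ n * `|b| ^+ n by rewrite mulr_ge0.
nra.
Qed.

Lemma all_momentsM U V : all_moments U -> all_moments V ->
  all_moments (fun w => U w * V w).
Proof.
move=> [mU iU] [mV iV]; split=> [|n]; first exact: measurable_funM.
apply: (@le_integrable _ _ _ P _ measurableT _
  (fun w => ((`|U w| ^+ n.*2)%:E + (`|V w| ^+ n.*2)%:E))%E).
- apply/measurable_EFinP; apply: measurable_funX; apply: measurableT_comp => //.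
  exact: measurable_funM.
- move=> w _ /=; rewrite lee_fin normrX normr_id.
  by rewrite [leRHS]ger0_norm ?addr_ge0// normr_expM_le.
- by apply: integrableD => //; [exact: iU|exact: iV].
Qed.

Lemma all_momentsB U V : all_moments U -> all_moments V ->
  all_moments (fun w => U w - V w).
Proof. by move=> UP VP; apply: all_momentsD => //; exact: all_momentsN. Qed.

Lemma all_momentsZ c U : all_moments U -> all_moments (fun w => c * U w).
Proof. by apply: all_momentsM; exact: all_moments_cst. Qed.

Lemma all_momentsX U n : all_moments U -> all_moments (fun w => U w ^+ n).
Proof.
move=> UP; elim: n => [|n ih].
  by under eq_fun do rewrite expr0; exact: all_moments_cst.
by under eq_fun do rewrite exprS; exact: all_momentsM.
Qed.

Lemma all_moments_sum (I : Type) (s : seq I) (Q : pred I) (U : I -> T -> R) :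
  (forall i, all_moments (U i)) ->
  all_moments (fun w => \sum_(i <- s | Q i) U i w).
Proof.
move=> UP; elim: s => [|i s ih].
  by under eq_fun do rewrite big_nil; exact: all_moments_cst.
under eq_fun do rewrite big_cons; case: (Q i) => //; exact: all_momentsD.
Qed.

Lemma all_moments_prod (I : Type) (s : seq I) (Q : pred I) (U : I -> T -> R) :
  (forall i, all_moments (U i)) ->
  all_moments (fun w => \prod_(i <- s | Q i) U i w).
Proof.
move=> UP; elim: s => [|i s ih].
  by under eq_fun do rewrite big_nil; exact: all_moments_cst.
under eq_fun do rewrite big_cons; case: (Q i) => //; exact: all_momentsM.
Qed.

Lemma all_moments_bounded U C : measurable_fun setT U ->
  (forall w, `|U w| <= C) -> all_moments U.
Proof.
move=> mU UC; apply: le_all_moments mU _ (all_moments_cst C) => w.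
exact: le_trans (UC w) (ler_norm _).
Qed.

Lemma all_moments_integrable U : all_moments U ->
  P.-integrable setT (EFin \o U).
Proof.
move=> [mU /(_ 1%N) iU]; apply: le_integrable iU => //.
- exact/measurable_EFinP.
- by move=> w _ /=; rewrite lee_fin expr1 normr_id.
Qed.

(** From [|u| ^+ n <= 1 + u ^+ n.*2]. Even powers are nonnegative, so their integrals make sense in
    the extended reals before anything is known to be integrable. *)
Lemma all_moments_even U : measurable_fun setT U ->
  (forall n, (\int[P]_w (U w ^+ n.*2)%:E < +oo)%E) -> all_moments U.
Proof.
move=> mU h; split=> // n.
apply: (@le_integrable _ _ _ P _ measurableT _
  (fun w => (1%:E + (U w ^+ n.*2)%:E))%E).
- apply/measurable_EFinP; apply: measurable_funX; exact: measurableT_comp.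
- move=> w _ /=; rewrite lee_fin normrX normr_id.
  have U0 : 0 <= U w ^+ n.*2 by rewrite exprn_even_ge0// odd_double.
  rewrite [leRHS]ger0_norm ?addr_ge0//.
  have -> : U w ^+ n.*2 = `|U w| ^+ n * `|U w| ^+ n.
    by rewrite -[LHS]ger0_norm// normrX -addnn exprD.
  by set a := `|U w| ^+ n; have := sqr_ge0 (a - 1); nra.
- apply: integrableD => //; first exact: finite_measure_integrable_cst.
  apply/integrableP; split.
    by apply/measurable_EFinP; exact: measurable_funX.
  under eq_integral do rewrite /= ger0_norm ?exprn_even_ge0// ?odd_double//.
  exact: h.
Qed.

Lemma all_moments_integral U : all_moments U ->
  (\int[P]_w (U w)%:E)%E = (\int[P]_w U w)%:E.
Proof.
move=> /all_moments_integrable iU; rewrite /Rintegral fineK//.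
exact: integrable_fin_num.
Qed.

Lemma meanD U V : all_moments U -> all_moments V ->
  \int[P]_w (U w + V w) = \int[P]_w U w + \int[P]_w V w.
Proof. by move=> *; rewrite RintegralD//; exact: all_moments_integrable. Qed.

Lemma meanB U V : all_moments U -> all_moments V ->
  \int[P]_w (U w - V w) = \int[P]_w U w - \int[P]_w V w.
Proof. by move=> *; rewrite RintegralB//; exact: all_moments_integrable. Qed.

Lemma meanZ c U : all_moments U -> \int[P]_w (c * U w) = c * \int[P]_w U w.
Proof. by move=> *; rewrite RintegralZl//; exact: all_moments_integrable. Qed.

Lemma mean_cst c : \int[P]_w c = c.
Proof. by rewrite /Rintegral integral_cst//= probability_setT mule1. Qed.

Lemma mean_sum (I : Type) (s : seq I) (Q : pred I) (U : I -> T -> R) :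
  (forall i, all_moments (U i)) ->
  \int[P]_w (\sum_(i <- s | Q i) U i w) = \sum_(i <- s | Q i) \int[P]_w U i w.
Proof.
move=> UP; elim: s => [|i s ih].
  by under eq_Rintegral do rewrite big_nil; rewrite big_nil mean_cst.
under eq_Rintegral do rewrite big_cons; rewrite big_cons.
by case: (Q i) => //; rewrite meanD// ?ih//; exact: all_moments_sum.
Qed.

Lemma le_mean U V : all_moments U -> all_moments V -> (forall w, U w <= V w) ->
  \int[P]_w U w <= \int[P]_w V w.
Proof.
by move=> UP VP UV; apply: le_Rintegral => //; exact: all_moments_integrable.
Qed.

Lemma mean_ge0 U : (forall w, 0 <= U w) -> 0 <= \int[P]_w U w.
Proof. by move=> U0; apply: Rintegral_ge0. Qed.

Lemma normr_mean_le U V : all_moments U -> all_moments V ->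
  (forall w, `|U w| <= V w) -> `|\int[P]_w U w| <= \int[P]_w V w.
Proof.
move=> UP VP UV; apply: le_trans.
  by apply: le_normr_Rintegral => //; exact: all_moments_integrable.
apply: le_mean => //; apply: le_all_moments (UP) => [|w].
  by apply: measurableT_comp => //; case: UP.
by rewrite normr_id.
Qed.

Lemma mean_indic A : measurable A -> (\int[P]_w (\1_A w : R)) = fine (P A).
Proof. by move=> mA; rewrite /Rintegral integral_indic// setIT. Qed.

Lemma eq_mean_ae U V : measurable_fun setT U -> measurable_fun setT V ->
  {ae P, forall w, U w = V w} -> \int[P]_w U w = \int[P]_w V w.
Proof.
move=> mU mV UV; rewrite /Rintegral; congr fine; apply: ae_eq_integral => //.
- exact/measurable_EFinP.
- exact/measurable_EFinP.
- by apply: filterS UV => w -> _.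
Qed.

End AllMoments.

(** * Moments of the centred normal law *)

Section NormalMoments.
Context {R : realType}.
Implicit Types (s r : R).

(** Raise [y / k <= 1 + y / k <= expR (y / k)] to the power [k]; the exponent 0 is treated apart. *)
Lemma exprn_le_expR (y : R) k : 0 <= y -> y ^+ k <= k%:R ^+ k * expR y.
Proof.
move=> y0; case: k => [|k]; first by rewrite !expr0 mul1r -expR0 ler_expR.
have k0 : 0 < k.+1%:R :> R by rewrite ltr0n.
have -> : expR y = expR (y / k.+1%:R) ^+ k.+1.
  by rewrite -expRM_natl mulrC divfK// gt_eqF.
rewrite -exprMn lerXn2r ?nnegrE ?mulr_ge0 ?expR_ge0//.
rewrite -ler_pdivrMl// mulrC (le_trans _ (expR_ge1Dx _))// lerDr//.
Qed.

(** The factor [1 - r ^- 2] is what changes the exponent of the density of deviation [s] into that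
    of deviation [r * s]; the two normalising constants differ by [r]. *)
Lemma normal_pdf_dilate s r (x : R) : 0 < s -> 0 < r ->
  expR ((1 - r ^- 2) * x ^+ 2 / (s ^+ 2 *+ 2)) * normal_pdf 0 s x =
  r * normal_pdf 0 (r * s) x.
Proof.
move=> s0 r0; have rs0 : 0 < r * s by rewrite mulr_gt0.
rewrite !normal_pdfE ?gt_eqF// /normal_peak /normal_fun !subr0.
rewrite mulrCA -expRD [RHS]mulrA; congr (_ * expR _); last first.
  by field; rewrite ?gt_eqF.
have -> : (r * s) ^+ 2 * pi *+ 2 = r ^+ 2 * (s ^+ 2 * pi *+ 2) by ring.
rewrite (@sqrtrM R (r ^+ 2)) ?sqr_ge0// sqrtr_sqr gtr0_norm//.
by rewrite invfM mulrA mulfV ?gt_eqF// mul1r.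
Qed.

(** An exponential moment of the square, for every dilation [r]. The even moments and the variance
    are both read off from it, without integration by parts. *)
Lemma integral_expR_normal s r : 0 < s -> 0 < r ->
  (\int[normal_prob 0 s]_x
     (expR ((1 - r ^- 2) * x ^+ 2 / (s ^+ 2 *+ 2)))%:E = r%:E)%E.
Proof.
move=> s0 r0; rewrite integral_normal_prob//; last first.
  apply: measurableT_comp => //; apply: measurable_funM => //.
  by apply: measurable_funM => //; exact: measurable_funX.
under eq_integral do rewrite normal_pdf_dilate// EFinM.
rewrite ge0_integralZl//.
- by rewrite integral_normal_pdf mule1.
- by apply/measurable_EFinP; exact: measurable_normal_pdf.
- by move=> x _; rewrite lee_fin normal_pdf_ge0.
- by rewrite lee_fin ltW.
Qed.

(** Take the dilation [r = sqrt 2], for which the exponent is [x ^+ 2 / (4 * s ^+ 2)]. Its [k]-th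
    power is at most [k ^ k] times its exponential, whose mean is [sqrt 2]; the factor [4 ^+ k]
    comes from the rescaling. *)
Definition normal_moment_bound (k : nat) : R :=
  4 ^+ k * k%:R ^+ k * Num.sqrt 2.

Lemma normal_moment_bound_ge0 k : 0 <= normal_moment_bound k.
Proof. by rewrite /normal_moment_bound !mulr_ge0// ?exprn_ge0// sqrtr_ge0. Qed.

Context {d} {T : measurableType d} (P : probability T R) (V : T -> R) (s : R).
Hypothesis s0 : 0 < s.
Hypothesis mV : measurable_fun setT V.
Hypothesis lawV : forall A, measurable A -> P (V @^-1` A) = normal_prob 0 s A.

Lemma integral_normal_law (f : R -> R) : (forall x, 0 <= f x) ->
  measurable_fun setT f ->
  (\int[P]_w (f (V w))%:E = \int[normal_prob 0 s]_x (f x)%:E)%E.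
Proof.
move=> f0 mf.
transitivity (\int[pushforward P (V : T -> measurableTypeR R)]_x (f x)%:E)%E.
  rewrite ge0_integral_pushforward//.
  - exact/measurable_EFinP.
  - by move=> x _; rewrite lee_fin.
by apply: eq_measure_integral => // A mA _; exact: lawV.
Qed.

Lemma normal_even_moment_le k :
  (\int[P]_w (V w ^+ k.*2)%:E <= (normal_moment_bound k * s ^+ k.*2)%:E)%E.
Proof.
pose c : R := (s ^+ 2 *+ 2)^-1.
have s2 : 0 < s ^+ 2 by rewrite exprn_gt0.
have sq2 : 0 < Num.sqrt 2 :> R by rewrite sqrtr_gt0.
have h (x : R) : x ^+ k.*2 <= (4 * s ^+ 2) ^+ k * k%:R ^+ k *
    expR ((1 - (Num.sqrt 2) ^- 2) * x ^+ 2 / (s ^+ 2 *+ 2)).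
  have -> : (1 - (Num.sqrt 2) ^- 2) * x ^+ 2 / (s ^+ 2 *+ 2) =
      x ^+ 2 / (4 * s ^+ 2).
    by rewrite sqr_sqrtr//; field; rewrite gt_eqF.
  rewrite -mulrA -ler_pdivrMl ?exprn_gt0 ?mulr_gt0//.
  rewrite -mul2n exprM -exprVn -exprMn mulrC.
  by apply: exprn_le_expR; rewrite divr_ge0 ?sqr_ge0// mulr_ge0// ltW.
have mE : measurable_fun setT
    (fun x : R => expR ((1 - (Num.sqrt 2) ^- 2) * x ^+ 2 / (s ^+ 2 *+ 2))).
  apply: measurableT_comp => //; apply: measurable_funM => //.
  by apply: measurable_funM => //; exact: measurable_funX.
apply: (@le_trans _ _ (\int[P]_w (((4 * s ^+ 2) ^+ k * k%:R ^+ k)%:E *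
    (expR ((1 - (Num.sqrt 2) ^- 2) * V w ^+ 2 / (s ^+ 2 *+ 2)))%:E))%E).
  apply: ge0_le_integral => //.
  - by move=> w _; rewrite lee_fin exprn_even_ge0// odd_double.
  - by apply/measurable_EFinP; exact: measurable_funX.
  - by apply/measurable_EFinP; apply: measurable_funM => //;
      exact: (measurableT_comp mE mV).
  - by move=> w _; rewrite -EFinM lee_fin; exact: h.
rewrite ge0_integralZl//.
- rewrite (integral_normal_law _ mE) => [|x]; last exact: expR_ge0.
  rewrite integral_expR_normal// -EFinM lee_fin /normal_moment_bound.
  rewrite exprMn -exprM mul2n; move: (s ^+ k.*2) (4 ^+ k) (k%:R ^+ k) => u v z.
  by rewrite [leLHS](_ : _ = v * z * Num.sqrt 2 * u)//; ring.
- by apply/measurable_EFinP; exact: (measurableT_comp mE mV).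
- by rewrite lee_fin mulr_ge0// exprn_ge0// mulr_ge0// ltW.
Qed.

Lemma normal_all_moments : all_moments P V.
Proof.
apply: all_moments_even => // n.
exact: le_lt_trans (normal_even_moment_le n) (ltry _).
Qed.

Lemma normal_mean_even_le k :
  \int[P]_w (V w ^+ k.*2) <= normal_moment_bound k * s ^+ k.*2.
Proof.
rewrite -lee_fin -(all_moments_integral (all_momentsX k.*2 normal_all_moments)).
exact: normal_even_moment_le.
Qed.

Lemma normal_integralN (f : R -> R) : (forall x, 0 <= f x) ->
  measurable_fun setT f ->
  (\int[P]_w (f (- V w))%:E = \int[P]_w (f (V w))%:E)%E.
Proof.
move=> f0 mf.
have mfN : measurable_fun setT (fun x : R => f (- x)).
  by apply: measurableT_comp => //; exact: oppr_measurable.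
rewrite (integral_normal_law (f := fun x => f (- x)))//.
rewrite (integral_normal_law f0)// !integral_normal_prob//.
have phiN (x : R) : normal_pdf 0 s (- x) = normal_pdf 0 s x.
  by rewrite !normal_pdfE ?gt_eqF// /normal_fun !subr0 sqrrN.
pose g (x : R) : \bar R := (f x * normal_pdf 0 s x)%:E.
rewrite -[RHS]/(\int[lebesgue_measure]_x g x)%E.
transitivity (\int[pushforward lebesgue_measure
                (-%R : measurableTypeR R -> measurableTypeR R)]_x g x)%E.
  rewrite ge0_integral_pushforward//.
  - by apply: eq_integral => x _ /=; rewrite /g phiN.
  - apply/measurable_EFinP; apply: measurable_funM => //.
    exact: measurable_normal_pdf.
  - by move=> x _; rewrite lee_fin mulr_ge0// normal_pdf_ge0.
by apply: eq_measure_integral => // A mA _; exact: lebesgue_measureN.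
Qed.

(** The odd power is [f (V w) - f (- V w)] with [f] the positive part of the power, and the two
    terms have the same mean by symmetry of the law. Nonnegativity of [f] allows the symmetry to be
    used on extended integrals. *)
Lemma normal_mean_odd n : odd n -> \int[P]_w (V w ^+ n) = 0.
Proof.
move=> on; pose f (x : R) := Num.max (x ^+ n) 0.
have f0 x : 0 <= f x by rewrite /f le_max lexx orbT.
have mf : measurable_fun setT f.
  by apply: measurable_maxr => //; exact: measurable_funX.
have fle x : `|f x| <= `|x ^+ n|.
  by rewrite ger0_norm// /f ge_max normr_ge0 ler_norm.
have VE x : x ^+ n = f x - f (- x).
  rewrite /f exprNn -signr_odd on expr1 mulN1r.
  by case: (leP (x ^+ n) 0) => h; case: leP => h'; lra.
have fP : all_moments P (fun w => f (V w)).
  apply: le_all_moments (all_momentsX n normal_all_moments) => [|w].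
    exact: measurableT_comp.
  exact: fle.
have fNP : all_moments P (fun w => f (- V w)).
  apply: le_all_moments (all_momentsX n (all_momentsN normal_all_moments)) => [|w].
    by apply: measurableT_comp => //; exact: measurable_funN.
  exact: fle.
under eq_Rintegral do rewrite VE.
by rewrite meanB// /Rintegral normal_integralN// subrr.
Qed.

(** Integrating [1 + y <= expR y] in the exponential moment gives, for all [r > 0], an inequality
    that is an equality at [r = 1]. The derivatives of the two sides at 1 must therefore agree,
    which forces [v = s ^+ 2]. The comparison of slopes is made with explicit values of [r]. *)
Lemma normal_mean_sqr : \int[P]_w (V w ^+ 2) = s ^+ 2.
Proof.
have V2 := all_momentsX 2 normal_all_moments.
set v := \int[P]_w (V w ^+ 2).
have s2 : 0 < s ^+ 2 by rewrite exprn_gt0.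
have E (r : R) : 0 < r -> 1 + (1 - r ^- 2) * v / (s ^+ 2 *+ 2) <= r.
  move=> r0; rewrite -lee_fin -(integral_expR_normal s0 r0).
  have mE : measurable_fun setT
      (fun x : R => expR ((1 - r ^- 2) * x ^+ 2 / (s ^+ 2 *+ 2))).
    apply: measurableT_comp => //; apply: measurable_funM => //.
    by apply: measurable_funM => //; exact: measurable_funX.
  rewrite -(integral_normal_law _ mE) => [|x]; last exact: expR_ge0.
  have VE : all_moments P (fun w => 1 + (1 - r ^- 2) / (s ^+ 2 *+ 2) * V w ^+ 2).
    by apply: all_momentsD; [exact: all_moments_cst|exact: all_momentsZ].
  have -> : 1 + (1 - r ^- 2) * v / (s ^+ 2 *+ 2) =
      \int[P]_w (1 + (1 - r ^- 2) / (s ^+ 2 *+ 2) * V w ^+ 2).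
    rewrite meanD ?mean_cst ?meanZ//; first by rewrite mulrAC.
    + exact: all_moments_cst.
    + exact: all_momentsZ.
  rewrite -(all_moments_integral VE).
  apply: le_integral => //.
  - exact: all_moments_integrable.
  - apply/integrableP; split.
      by apply/measurable_EFinP; exact: (measurableT_comp mE mV).
    under eq_integral do rewrite /= ger0_norm ?expR_ge0//.
    rewrite (integral_normal_law _ mE) => [|x]; last exact: expR_ge0.
    by rewrite integral_expR_normal// ltry.
  - move=> w _ /=; rewrite lee_fin (mulrAC _ _ (V w ^+ 2)); exact: expR_ge1Dx.
have v0 : 0 <= v by apply: mean_ge0 => w; exact: sqr_ge0.
pose q := v / (s ^+ 2 *+ 2).
have q0 : 0 <= q by rewrite divr_ge0// mulrn_wge0// ltW.
have Eq (r : R) : 0 < r -> (r ^+ 2 - 1) * q <= r ^+ 2 * (r - 1).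
  move=> r0; have := E r r0; rewrite -mulrA -/q -lerBrDl => h.
  have r2 : 0 < r ^+ 2 by rewrite exprn_gt0.
  have -> : (r ^+ 2 - 1) * q = r ^+ 2 * ((1 - r ^- 2) * q).
    by field; rewrite gt_eqF.
  by rewrite ler_pM2l.
(* A value below [1 / 2] is refuted at [r = 1 - e], a value above it at [r = 1 + e]. *)
have [q1|q1|q1] := ltgtP q (1 / 2).
- pose e := (1 - 2 * q) / 4.
  have e0 : 0 < e by rewrite /e; lra.
  have e1 : e <= 1 / 4 by rewrite /e; lra.
  have qe : q = 1 / 2 - 2 * e by rewrite /e; lra.
  have e1' : 0 < 1 - e by lra.
  have := Eq _ e1'; rewrite qe => h.
  have : 0 < e ^+ 2 * (5 / 2 - e) by rewrite mulr_gt0 ?exprn_gt0//; lra.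
  by nra.
(* After division by [e] the inequality reads [(2 + e) * q <= (1 + e) ^+ 2]. This [e] makes
   [2 * q - 1] equal to [e * (2 * q + 3)], which is too large since [e < 1]. *)
- pose e := (2 * q - 1) / (2 * q + 3).
  have d0 : 0 < 2 * q + 3 by lra.
  have e0 : 0 < e by rewrite /e divr_gt0//; lra.
  have e1 : e < 1 by rewrite /e ltr_pdivrMr//; lra.
  have qe : e * (2 * q + 3) = 2 * q - 1 by rewrite /e divfK ?gt_eqF.
  have := Eq _ (addr_gt0 ltr01 e0).
  have -> : (1 + e) ^+ 2 - 1 = e * (2 + e) by ring.
  have -> : (1 + e) ^+ 2 * (1 + e - 1) = e * (1 + e) ^+ 2 by ring.
  rewrite -mulrA ler_pM2l//; nra.
- have : v = q * (s ^+ 2 *+ 2) by rewrite /q divfK// gt_eqF// pmulrn_lgt0.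
  by rewrite q1 => ->; field.
Qed.

End NormalMoments.

(** * Means of products of independent variables *)

Section IndependentMean.
Context {d} {T : measurableType d} {R : realType} (P : probability T R).

(** The joint law agrees with the product of the two laws on rectangles, hence everywhere; Fubini's
    theorem then separates the integrals. *)
Lemma indep_mean (U V : T -> R) : all_moments P U -> all_moments P V ->
  (forall A B : set R, measurable A -> measurable B ->
     P (U @^-1` A `&` V @^-1` B) = (P (U @^-1` A) * P (V @^-1` B))%E) ->
  \int[P]_w (U w * V w) = \int[P]_w U w * \int[P]_w V w.
Proof.
move=> UP VP UV.
have mU := all_moments_measurable UP; have mV := all_moments_measurable VP.
have UVP := all_momentsM UP VP.
pose X : {RV P >-> R} := mfun_Sub (mem_set mU).
pose Y : {RV P >-> R} := mfun_Sub (mem_set mV).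
have mXY : measurable_fun setT (fun w => (U w, V w)) by exact: measurable_fun_pair.
pose Z : {RV P >-> (R * R)%type} := mfun_Sub (mem_set mXY).
pose m1 := distribution P X; pose m2 := distribution P Y.
have m12 A : measurable A -> (m1 \x m2)%E A = distribution P Z A.
  apply: product_measure_unique => B1 B2 mB1 mB2.
  rewrite /distribution /pushforward/=.
  by rewrite -(UV _ _ mB1 mB2); congr (P _); apply/seteqP; split.
pose f (z : R * R) : \bar R := (z.1 * z.2)%:E.
have mf : measurable_fun setT f.
  apply/measurable_EFinP; apply: measurable_funM.
    exact: measurable_fst.
  exact: measurable_snd.
have iZ : (distribution P Z).-integrable setT f.
  apply: integrable_pushforward => //; exact: (all_moments_integrable UVP).
have i12 : (m1 \x m2)%E.-integrable setT f.
  apply/integrableP; split => //.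
  rewrite (eq_measure_integral (distribution P Z)) => [|A mA _]; last exact: m12.
  by case/integrableP : iZ.
have iY : (distribution P Y).-integrable setT (EFin : R -> \bar R).
  by apply: integrable_pushforward => //; exact: (all_moments_integrable VP).
have YE : (\int[m2]_y (y%:E) = (\int[P]_w V w)%:E)%E.
  rewrite integral_distribution//; last exact: (all_moments_integrable VP).
  exact: all_moments_integral.
apply: EFin_inj; rewrite EFinM -!all_moments_integral//.
transitivity (\int[m1 \x m2]_z f z)%E.
  rewrite (eq_measure_integral (distribution P Z)) => [|A mA _]; last exact: m12.
  by rewrite integral_distribution//; exact: (all_moments_integrable UVP).
rewrite -integral12_prod_meas1//.
have -> : (\int[distribution P X]_x
      fubini_F (distribution P Y) f x =
    \int[distribution P X]_x (x%:E * (\int[P]_w V w)%:E))%E.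
  apply: eq_integral => x _; rewrite /fubini_F -YE -integralZl//.
rewrite (all_moments_integral VP) integralZr//; last first.
  by apply: integrable_pushforward => //; exact: (all_moments_integrable UP).
by rewrite integral_distribution//; exact: (all_moments_integrable UP).
Qed.

(** Measurability for the sigma-algebra generated by [G], expressed on the generated measurable type
    so that the general closure properties of measurable functions apply as they are. *)
Definition adapted (G : set (set T)) (U : T -> R) : Prop :=
  @measurable_fun _ _ (g_sigma_algebraType G) R setT U.

Variables (G : set (set T)) (V : T -> R).
Hypothesis GI : setI_closed G.
Hypothesis GT : G setT.
Hypothesis Gm : G `<=` measurable.
Hypothesis mV : measurable_fun setT V.
Hypothesis GV : forall A D, G A -> measurable D ->
  P (A `&` V @^-1` D) = (P A * P (V @^-1` D))%E.

(** For fixed [D] both sides are finite measures in [A], the left one a restriction of [P] and the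
    right one a multiple of it. They agree on the pi-system [G], hence on what it generates. *)
Lemma g_sigma_algebra_indep A D : <<s G >> A -> measurable D ->
  P (A `&` V @^-1` D) = (P A * P (V @^-1` D))%E.
Proof.
move=> GA mD.
have mVD : measurable (V @^-1` D) by rewrite -[_ @^-1` _]setTI; exact: mV.
have PD : P (V @^-1` D) \is a fin_num by exact: fin_num_measure.
have P0 : 0 <= fine (P (V @^-1` D)) by rewrite fine_ge0.
rewrite muleC -(fineK PD) -[LHS]/(mrestr P mVD A)
  -[RHS]/(mscale (NngNum P0) P A).
apply: (@g_sigma_algebra_measure_unique _ _ _ G Gm (fun=> setT)) => //.
- by rewrite bigcup_const.
- by move=> B GB; rewrite /= /mrestr /mscale/= GV// fineK// muleC.
- by move=> k; rewrite /= /mrestr setTI ltey_eq PD.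
Qed.

Lemma adapted_measurable U : adapted G U -> measurable_fun setT U.
Proof.
move=> aU _ A mA; have /= := aU measurableT A mA.
by apply: smallest_sub => //; exact: sigma_algebra_measurable.
Qed.

Lemma adapted_mean_mul U n : adapted G U -> all_moments P U ->
  all_moments P V ->
  \int[P]_w (U w * V w ^+ n) = \int[P]_w U w * \int[P]_w (V w ^+ n).
Proof.
move=> aU UP VP; apply: indep_mean => //; first exact: all_momentsX.
move=> A B mA mB.
have -> : (fun w => V w ^+ n) @^-1` B = V @^-1` ((fun x => x ^+ n) @^-1` B) by [].
apply: g_sigma_algebra_indep.
  by have := aU measurableT A mA; rewrite setTI.
by rewrite -[_ @^-1` _]setTI; exact: (@measurable_funX _ _ _ setT id n).
Qed.

End IndependentMean.

(** * Independence of future increments *)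

Section SigmaFamily.
Context {d} {T : measurableType d} {I : Type} {dE} {E : measurableType dE}.
Implicit Types (D : set I) (Y : I -> T -> E).

Lemma sigma_family_preimage D Y i A : D i -> measurable A ->
  sigma_family D Y (Y i @^-1` A).
Proof.
move=> Di mA; apply: sub_sigma_algebra; exists i => //; exists A => //.
by rewrite setTI.
Qed.

Lemma sub_sigma_family D D' Y : D `<=` D' -> sigma_family D Y `<=` sigma_family D' Y.
Proof.
move=> DD'; apply: smallest_sub; first exact: smallest_sigma_algebra.
by move=> A [i Di iA]; apply: sub_sigma_algebra; exists i => //; exact: DD'.
Qed.

Lemma sigma_family_measurable D Y :
  (forall i, D i -> measurable_fun setT (Y i)) -> sigma_family D Y `<=` measurable.
Proof.
move=> mY; apply: smallest_sub; first exact: sigma_algebra_measurable.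
by move=> _ [i Di [A mA <-]]; exact: mY.
Qed.

Lemma g_sigma_setI (G : set (set T)) A A' : <<s G >> A -> <<s G >> A' -> <<s G >> (A `&` A').
Proof. exact: (@measurableI _ (g_sigma_algebraType G)). Qed.

Lemma g_sigma_setT (G : set (set T)) : <<s G >> setT.
Proof. exact: (@measurableT _ (g_sigma_algebraType G)). Qed.

Lemma sigma_familyI D Y A A' : sigma_family D Y A -> sigma_family D Y A' ->
  sigma_family D Y (A `&` A').
Proof. exact: g_sigma_setI. Qed.

Lemma sigma_familyT D Y : sigma_family D Y setT.
Proof. exact: g_sigma_setT. Qed.

End SigmaFamily.

Section Past.
Context {R : realType} {d J : nat} {dT} {T : measurableType dT}.
Variables (X : R -> T -> 'I_d.+1) (B : 'I_J -> R -> T -> R).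

(* The generated sigma-algebra knows all of X, all of B_l for l <> j, and B_j up to time a:
   it contains the history up to time a and is still independent of the later
   increments of B_j. *)
Definition past (j : 'I_J) (a : R) : set (set T) :=
  [set E | exists A (C : 'I_J -> set T),
    [/\ sigma_family `[0, +oo[ X A,
        forall l, sigma_family `[0, +oo[ (B l) (C l),
        sigma_family `[0, a] (B j) (C j) &
        E = A `&` \bigcap_l C l]].

Lemma past_setI j a : setI_closed (past j a).
Proof.
move=> _ _ [A [C [AX CB Ca ->]]] [A' [C' [AX' CB' Ca' ->]]].
exists (A `&` A'), (fun l => C l `&` C' l); split.
- exact: sigma_familyI.
- by move=> l; exact: sigma_familyI.
- exact: sigma_familyI.
- by rewrite bigcapI setIACA.
Qed.

Lemma past_setT j a : past j a setT.
Proof.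
exists setT, (fun=> setT); split; [exact: sigma_familyT|
  by move=> l; exact: sigma_familyT|exact: sigma_familyT|].
by rewrite bigcap_const ?setIid//; exists j.
Qed.

Lemma chain_sub_past j a : sigma_family `[0, +oo[ X `<=` <<s past j a >>.
Proof.
move=> A AX; apply: sub_sigma_algebra; exists A, (fun=> setT).
split=> //; [by move=> l; exact: sigma_familyT|exact: sigma_familyT|].
by rewrite bigcap_const ?setIT//; exists j.
Qed.

Lemma brownian_sub_past j a l : l != j ->
  sigma_family `[0, +oo[ (B l) `<=` <<s past j a >>.
Proof.
move=> lj A AB; apply: sub_sigma_algebra.
exists setT, (fun m => if m == l then A else setT); split.
- exact: sigma_familyT.
- by move=> m; case: eqVneq => [->//|_]; exact: sigma_familyT.
- by rewrite eq_sym (negbTE lj); exact: sigma_familyT.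
- rewrite setTI; apply/seteqP; split => [w Aw m _|w /(_ l I)].
    by case: eqP.
  by rewrite eqxx.
Qed.

Lemma brownian_upto_sub_past j a : sigma_family `[0, a] (B j) `<=` <<s past j a >>.
Proof.
move=> A AB; apply: sub_sigma_algebra.
exists setT, (fun m => if m == j then A else setT); split.
- exact: sigma_familyT.
- move=> m; case: eqVneq => [->|_]; last exact: sigma_familyT.
  apply: sub_sigma_family AB => t /=; rewrite !in_itv/= andbT.
  by case/andP.
- by rewrite eqxx.
- rewrite setTI; apply/seteqP; split => [w Aw m _|w /(_ j I)].
    by case: eqP.
  by rewrite eqxx.
Qed.

Lemma g_sigma_sub (G H : set (set T)) : G `<=` <<s H >> -> <<s G >> `<=` <<s H >>.
Proof. by move=> GH; apply: smallest_sub => //; exact: smallest_sigma_algebra. Qed.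

Lemma itv_upto_sub (a : R) : (`[0, a] : set R) `<=` `[0, +oo[.
Proof. by move=> t /=; rewrite !in_itv/= andbT => /andP[]. Qed.

(** The coefficients of the elementary processes in the definition of the Ito integral are
    measurable for [history]; through this inclusion they obey the same independence as coefficients
    depending on the whole chain. *)
Lemma history_sub_past j a : history X B a `<=` <<s past j a >>.
Proof.
apply: g_sigma_sub => A [AX|[l _ AB]].
  by apply: chain_sub_past; exact: sub_sigma_family (@itv_upto_sub a) _ AX.
have [lj|lj] := eqVneq l j.
  by apply: brownian_upto_sub_past; rewrite -lj.
apply: (brownian_sub_past lj).
exact: sub_sigma_family (@itv_upto_sub a) _ AB.
Qed.

Lemma past_nondecreasing j a b : a <= b -> <<s past j a >> `<=` <<s past j b >>.
Proof.
move=> ab; apply: g_sigma_sub => _ [A [C [AX CB Ca ->]]].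
apply: sub_sigma_algebra; exists A, C; split=> //.
apply: sub_sigma_family Ca => t /=; rewrite !in_itv/= => /andP[-> ta].
exact: le_trans ta ab.
Qed.

Lemma adapted_past_nondecreasing j a b (U : T -> R) : a <= b ->
  adapted (past j a) U -> adapted (past j b) U.
Proof.
move=> ab aU _ A mA; apply: (past_nondecreasing ab); exact: aU.
Qed.

Lemma adapted_brownian_upto j a t : 0 <= t <= a -> adapted (past j a) (B j t).
Proof.
move=> ta _ A mA; rewrite setTI; apply: brownian_upto_sub_past.
by apply: sigma_family_preimage.
Qed.

Lemma adapted_brownian_other j a l t : l != j -> 0 <= t -> adapted (past j a) (B l t).
Proof.
move=> lj t0 _ A mA; rewrite setTI; apply: (brownian_sub_past lj).
by apply: sigma_family_preimage => //=; rewrite in_itv/= andbT.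
Qed.

Lemma adapted_chain j a t (f : 'I_d.+1 -> R) : 0 <= t ->
  adapted (past j a) (fun w => f (X t w)).
Proof.
move=> t0 _ A mA; rewrite setTI; apply: chain_sub_past.
rewrite -[_ @^-1` _]/(X t @^-1` (f @^-1` A)).
by apply: sigma_family_preimage => //=; rewrite in_itv/= andbT.
Qed.

Variable P : probability T R.
Hypothesis mX : forall t, 0 <= t -> measurable_fun setT (X t).
Hypothesis hB : forall j, standard_brownian_motion P (B j).
Hypothesis indB : mutually_independent P (fun j => sigma_family `[0, +oo[ (B j)).
Hypothesis indX : independent P (sigma_family `[0, +oo[ X)
  <<s \bigcup_j sigma_family `[0, +oo[ (B j) >>.

Lemma chain_sigma_measurable : sigma_family `[0, +oo[ X `<=` measurable.
Proof.
by apply: sigma_family_measurable => t; rewrite /= in_itv/= andbT; exact: mX.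
Qed.

Lemma brownian_sigma_measurable j : sigma_family `[0, +oo[ (B j) `<=` measurable.
Proof.
apply: sigma_family_measurable => t; rewrite /= in_itv/= andbT.
by have [mB _ _ _ _] := hB j; exact: mB.
Qed.

Lemma past_measurable j a : past j a `<=` measurable.
Proof.
move=> _ [A [C [AX CB _ ->]]]; apply: measurableI.
  exact: chain_sigma_measurable.
apply: fin_bigcap_measurable => // l _; exact: brownian_sigma_measurable (CB l).
Qed.

Lemma brownian_increment_sigma j a b (D : set R) : 0 <= a -> 0 <= b -> measurable D ->
  sigma_family `[0, +oo[ (B j) ((fun w => B j b w - B j a w) @^-1` D).
Proof.
move=> a0 b0 mD.
pose G := \bigcup_(i in `[0%R, +oo[) preimage_set_system setT (B j i) measurable.
have mBG t : 0 <= t -> @measurable_fun _ _ (g_sigma_algebraType G) R setT (B j t).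
  move=> t0 _ A mA; rewrite setTI.
  by apply: sigma_family_preimage => //=; rewrite in_itv/= andbT.
by have := measurable_funB (mBG _ b0) (mBG _ a0) measurableT mD; rewrite setTI.
Qed.

Lemma brownian_prod (C : 'I_J -> set T) :
  (forall l, sigma_family `[0, +oo[ (B l) (C l)) ->
  P (\bigcap_l C l) = (\prod_l fine (P (C l)))%:E.
Proof.
move=> CB; have := @indB [set: 'I_J]%SET C (fun l _ => CB l).
have -> : [set` [set: 'I_J]%SET] = setT :> set 'I_J.
  by apply/seteqP; split => // l _ /=; rewrite inE.
move=> h; rewrite -[LHS]fineK; last first.
  apply: fin_num_measure; apply: fin_bigcap_measurable => // l _.
  exact: brownian_sigma_measurable (CB l).
by rewrite h; congr EFin; apply: eq_bigl => l; rewrite inE.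
Qed.

Lemma chain_brownian_indep A (C : 'I_J -> set T) : sigma_family `[0, +oo[ X A ->
  (forall l, sigma_family `[0, +oo[ (B l) (C l)) ->
  P (A `&` \bigcap_l C l) = (P A * (\prod_l fine (P (C l)))%:E)%E.
Proof.
move=> AX CB; rewrite indX//; first by congr (_ * _)%E; exact: brownian_prod.
pose G := \bigcup_j sigma_family `[0%R, +oo[ (B j).
apply: (@fin_bigcap_measurable _ (g_sigma_algebraType G)) => // l _.
by apply: sub_sigma_algebra; exists l.
Qed.

(** The event of the increment is merged into the [j]-th Brownian event. The chain and the different
    Brownian motions then factor on both sides, and only the factor [j] remains, where the increment
    is independent of the path of [B j] up to [a]. *)
Lemma past_increment_indep j (a b : R) A (D : set R) : 0 <= a <= b -> past j a A -> measurable D ->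
  P (A `&` (fun w => B j b w - B j a w) @^-1` D) =
  (P A * P ((fun w => (B j b w - B j a w)%R) @^-1` D))%E.
Proof.
move=> /andP[a0 ab] [{}A [C [AX CB Ca ->]]] mD; set V := (X in _ `&` X).
have b0 := le_trans a0 ab.
have VB : sigma_family `[0, +oo[ (B j) V by exact: brownian_increment_sigma.
have mV := brownian_sigma_measurable VB.
(* The intersection with [V] is still an event of the full path of [B j], so the factorisation over
   the Brownian motions applies to [C'] as well as to [C]. *)
pose C' l := if l == j then C j `&` V else C l.
have CB' l : sigma_family `[0, +oo[ (B l) (C' l).
  by rewrite /C'; case: eqVneq => [->|_]//; exact: sigma_familyI.
have -> : A `&` \bigcap_l C l `&` V = A `&` \bigcap_l C' l.
  apply/seteqP; split => [w [[Aw Cw] Vw]|w [Aw Cw]].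
    by split=> // l _; rewrite /C'; case: eqVneq => [lj|_]; [split=> //; exact: Cw|exact: Cw].
  have [] : (C j `&` V) w by have := Cw j I; rewrite /C' eqxx.
  move=> Cjw Vw; split=> //; split=> // l _; have := Cw l I; rewrite /C'.
  by case: eqVneq => [-> []|].
rewrite !chain_brownian_indep// -muleA; congr (_ * _)%E.
have [_ _ _ _ /(_ a b)] := hB j; rewrite a0 ab => /(_ isT) ind.
have CV : P (C j `&` V) = (P (C j) * P V)%E.
  rewrite setIC muleC; apply: ind => //.
  by exists D => //; rewrite setTI.
rewrite -[P V]fineK; last exact: fin_num_measure.
rewrite -EFinM; congr EFin.
rewrite (bigD1 j)//= [in RHS](bigD1 j)//= /C' eqxx CV fineM; last 2 first.
- by apply: fin_num_measure; exact: brownian_sigma_measurable.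
- exact: fin_num_measure.
rewrite mulrAC; congr (_ * _ * _).
by apply: eq_bigr => l lj; rewrite (negbTE lj).
Qed.

End Past.

(** * Generators and transition semigroups *)

Section GeneratorMatrix.
Context {R : realType} {d : nat}.
Implicit Types (Q A : 'M[R]_d.+1) (p q : R -> 'M[R]_d.+1).

(** A maximum principle for row vectors in the kernel: at an index where [u] is largest, the
    generator contributes at most 0 while the diagonal contributes [u 0 i * g 0 i], so the largest
    entry cannot be positive. Applied to [v] and to [- v]. *)
Lemma generator_sub_diag_unitmx Q (g : 'rV[R]_d.+1) : is_generator Q ->
  (forall i, 0 < g 0 i) -> Q^T - diag_mx g \in unitmx.
Proof.
move=> [Q0 Q1] g0; rewrite -row_free_unit; apply: inj_row_free => v.
have key (u : 'rV[R]_d.+1) : u *m (Q^T - diag_mx g) = 0 -> forall i, u 0 i <= 0.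
  move=> u0; case: (@Order.TotalTheory.arg_maxP _ _ _ ord0 xpredT (fun i => u 0 i))=> // i _ imax j.
  apply: le_trans (imax j isT) _; rewrite leNgt; apply/negP => ui.
  have := congr1 (fun M : 'rV[R]_(d.+1) => M 0 i) u0.
  rewrite mulmxBr mul_mx_diag !mxE => /eqP; rewrite subr_eq0 => /eqP E.
  have : \sum_j u 0 j * Q^T j i - u 0 i * \sum_j Q i j <= 0.
    rewrite mulr_sumr -sumrB; apply: sumr_le0 => l _; rewrite mxE -mulrBl.
    have [->|li] := eqVneq l i; first by rewrite subrr mul0r.
    apply: mulr_le0_ge0; first by rewrite subr_le0; exact: imax.
    by apply: Q0; rewrite eq_sym.
  rewrite Q1 mulr0 subr0 E; apply/negP; rewrite -ltNge.
  by rewrite mulr_gt0.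
move=> v0; apply/rowP => i; rewrite [RHS]mxE; apply/eqP; rewrite eq_le key//=.
have /key/(_ i) : - v *m (Q^T - diag_mx g) = 0 by rewrite mulNmx v0 oppr0.
by rewrite mxE oppr_le0.
Qed.

Definition mx_norm1 A : R := \sum_i \sum_j `|A i j|.

Lemma mx_norm1_ge0 A : 0 <= mx_norm1 A.
Proof. by apply: sumr_ge0 => i _; apply: sumr_ge0. Qed.

Lemma le_mx_norm1 A i j : `|A i j| <= mx_norm1 A.
Proof.
rewrite /mx_norm1 (bigD1 i)//= (bigD1 j)//= -addrA lerDl addr_ge0//.
  by apply: sumr_ge0.
by apply: sumr_ge0 => l _; apply: sumr_ge0.
Qed.

Lemma mx_norm1D A A' : mx_norm1 (A + A') <= mx_norm1 A + mx_norm1 A'.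
Proof.
rewrite /mx_norm1 -big_split/=; apply: ler_sum => i _.
by rewrite -big_split/=; apply: ler_sum => j _; rewrite mxE ler_normD.
Qed.

Definition stochastic A := (forall i j, 0 <= A i j) /\ (forall i, \sum_j A i j = 1).

Lemma stochastic_le1 A i j : stochastic A -> A i j <= 1.
Proof.
move=> [A0 A1]; rewrite -(A1 i) (bigD1 j)//= lerDl.
by apply: sumr_ge0.
Qed.

Lemma mx_norm1_mulr A S : stochastic S -> mx_norm1 (A *m S) <= mx_norm1 A.
Proof.
move=> [S0 S1]; apply: ler_sum => i _.
apply: (@le_trans _ _ (\sum_j \sum_k `|A i k| * S k j)).
  apply: ler_sum => j _; rewrite mxE; apply: le_trans (ler_norm_sum _ _ _) _.
  by apply: ler_sum => k _; rewrite normrM (ger0_norm (S0 _ _)).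
rewrite exchange_big/=; apply: ler_sum => k _.
by rewrite -mulr_sumr S1 mulr1.
Qed.

Lemma mx_norm1_mull A S : stochastic S -> mx_norm1 (S *m A) <= d.+1%:R * mx_norm1 A.
Proof.
move=> SS; have [S0 S1] := SS.
have -> : d.+1%:R * mx_norm1 A = \sum_(i < d.+1) mx_norm1 A.
  by rewrite sumr_const card_ord mulr_natl.
apply: ler_sum => i _.
apply: (@le_trans _ _ (\sum_j \sum_k `|A k j|)).
  apply: ler_sum => j _; rewrite mxE; apply: le_trans (ler_norm_sum _ _ _) _.
  apply: ler_sum => k _; rewrite normrM (ger0_norm (S0 _ _)).
  by rewrite ler_piMl// stochastic_le1.
by rewrite exchange_big.
Qed.

Section Semigroups.
Variables (Q : 'M[R]_d.+1) (p : R -> 'M[R]_d.+1).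
Hypothesis hp : transition_semigroup Q p.

Lemma semigroup_stochastic t : 0 <= t -> stochastic (p t).
Proof. by case: hp => + _ _ _ t0 => /(_ t t0). Qed.

Lemma semigroup_near (e : R) : 0 < e ->
  \forall h \near 0^'+, forall i j, `|(p h - 1%:M) i j - h * Q i j| <= e * h.
Proof.
move=> e0; case: hp => _ p0 _ pQ.
apply: filter_forall => i; apply: filter_forall => j.
have /cvgrPdist_le/(_ e e0) := pQ i j; rewrite p0.
move=> H; near=> h.
have h0 : 0 < h by near: h; exact: nbhs_right_gt.
have -> : (p h - 1%:M) i j - h * Q i j =
    - (h * (Q i j - h^-1 * (p h i j - (1%:M : 'M[R]_(d.+1)) i j))).
  by rewrite !mxE; field; rewrite gt_eqF.
rewrite normrN normrM gtr0_norm// mulrC ler_pM2r//.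
by near: h.
Unshelve. all: by end_near. Qed.

Lemma semigroup_exit_bound : exists kappa h0 : R,
  [/\ 0 <= kappa, 0 < h0 & forall h, 0 <= h <= h0 -> forall i j,
    `|(p h - 1%:M) i j| <= kappa * h].
Proof.
have := semigroup_near ltr01; rewrite near_withinE => -[e /= e0 he].
(* The first-order term is at most [mx_norm1 Q * h] and the error, taken with tolerance 1, at most
   [h]. Halving the radius turns an open neighbourhood into a closed interval. *)
exists (mx_norm1 Q + 1), (e / 2); split.
- by rewrite addr_ge0// mx_norm1_ge0.
- by rewrite divr_gt0.
move=> h /andP[]; rewrite le_eqVlt => /predU1P[<- _ i j|h0 he2 i j].
  by case: hp => _ -> _ _; rewrite subrr mxE normr0 mulr0.
have : `|(p h - 1%:M) i j - h * Q i j| <= 1 * h.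
  apply: he => //=; rewrite sub0r normrN gtr0_norm//.
  by rewrite (le_lt_trans he2)// ltr_pdivrMr// ltr_pMr// ltr1n.
have : `|h * Q i j| <= mx_norm1 Q * h.
  by rewrite normrM (gtr0_norm h0) mulrC ler_wpM2r ?(ltW h0)// le_mx_norm1.
rewrite !ler_norml; lra.
Qed.

End Semigroups.

(** Each law [P x] provides a semigroup of its own for the chain; uniqueness lets one semigroup
    serve all starting points. Over [n] steps of length [h / n] the one-step difference, which is
    [o(h / n)], is accumulated at most [n] times up to a constant. *)
Lemma transition_semigroup_unique Q p q : transition_semigroup Q p ->
  transition_semigroup Q q -> forall h, 0 <= h -> p h = q h.
Proof.
move=> hp hq h; rewrite le_eqVlt => /predU1P[<-|h0].
  by case: hp => _ -> _ _; case: hq => _ -> _ _.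
have step (dl : R) k : 0 <= dl -> mx_norm1 (p (dl *+ k) - q (dl *+ k)) <=
    k%:R * (d.+1%:R * mx_norm1 (p dl - q dl)).
  move=> dl0; elim: k => [|k ih].
    case: hp => _ p0 _ _; case: hq => _ q0 _ _.
    rewrite mulr0n p0 q0 subrr mul0r /mx_norm1.
    by rewrite big1// => i _; rewrite big1// => j _; rewrite mxE normr0.
  case: (hp) => _ _ pD _; case: (hq) => _ _ qD _.
  have dk0 : 0 <= dl *+ k by rewrite mulrn_wge0.
  rewrite mulrSr pD// qD//.
  (* One step of the telescoping: the new error is carried by a stochastic matrix on the left, the
     old one by a stochastic matrix on the right, which does not increase the norm. *)
  rewrite (_ : _ - _ = p (dl *+ k) *m (p dl - q dl) + (p (dl *+ k) - q (dl *+ k)) *m q dl); last first.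
    by rewrite mulmxBr mulmxBl addrA subrK.
  apply: le_trans (mx_norm1D _ _) _.
  rewrite -natr1 mulrDl mul1r addrC; apply: lerD.
    apply: le_trans ih; apply: mx_norm1_mulr; exact: semigroup_stochastic hq _ dl0.
  apply: mx_norm1_mull; exact: semigroup_stochastic hp _ dk0.
have main (e : R) : 0 < e -> mx_norm1 (p h - q h) <= e.
  (* [c] collects three dimension factors, one from the step estimate and two from summing over
     entries, together with [2 * h] from the two semigroups; the final bound is then exactly [e]. *)
  move=> e0; pose c : R := d.+1%:R * (d.+1%:R * (d.+1%:R * (h *+ 2))).
  have c0 : 0 < c by rewrite /c !mulr_gt0// mulrn_wgt0.
  have e'0 : 0 < e / c by rewrite divr_gt0.
  have := semigroup_near hp e'0; have := semigroup_near hq e'0.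
  rewrite !near_withinE => -[e1 /= e10 he1] [e2 /= e20 he2].
  pose m : R := Num.min e1 e2.
  have m0 : 0 < m by rewrite lt_min e10.
  pose n := (Num.bound (h / m)).+1.
  have n0 : 0 < n%:R :> R by rewrite ltr0n.
  have hn : h / n%:R < m.
    rewrite ltr_pdivrMr// mulrC -ltr_pdivrMr//.
    rewrite (@lt_le_trans _ _ (Num.bound (h / m))%:R) ?ler_nat//.
    by rewrite archi_boundP// divr_ge0// ltW.
  have hn0 : 0 < h / n%:R by rewrite divr_gt0.
  have := step (h / n%:R) n (ltW hn0).
  have -> : (h / n%:R) *+ n = h by rewrite -mulr_natr divfK// gt_eqF.
  move/le_trans; apply.
  have entry i j : `|(p (h / n%:R) - q (h / n%:R)) i j| <= 2 * (e / c * (h / n%:R)).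
    have a1 : `|0 - h / n%:R| < e1.
      by rewrite sub0r normrN gtr0_norm// (lt_le_trans hn)// /m ge_min lexx.
    have a2 : `|0 - h / n%:R| < e2.
      by rewrite sub0r normrN gtr0_norm// (lt_le_trans hn)// /m ge_min lexx orbT.
    have := he1 _ a1 hn0 i j; have := he2 _ a2 hn0 i j.
    by rewrite !mxE !ler_norml; lra.
  have : mx_norm1 (p (h / n%:R) - q (h / n%:R)) <=
      d.+1%:R * (d.+1%:R * (2 * (e / c * (h / n%:R)))).
    apply: (@le_trans _ _ (\sum_(i < d.+1) \sum_(j < d.+1) 2 * (e / c * (h / n%:R)))).
      by apply: ler_sum => i _; apply: ler_sum => j _; exact: entry.
    by rewrite !sumr_const !card_ord !mulr_natl.
  move=> H; apply: (@le_trans _ _ (n%:R * (d.+1%:R *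
      (d.+1%:R * (d.+1%:R * (2 * (e / c * (h / n%:R)))))))).
    by rewrite ler_pM2l// ler_pM2l.
  rewrite (_ : _ * _ = e)//; rewrite /c.
  field; rewrite !gt_eqF//=.
have : mx_norm1 (p h - q h) <= 0.
  by apply/ler_addgt0Pl => e e0; rewrite addr0; exact: main.
move=> N0; apply/matrixP => i j; apply/eqP; rewrite -subr_eq0 -normr_le0.
by have := le_trans (le_mx_norm1 (p h - q h) i j) N0; rewrite !mxE.
Qed.

End GeneratorMatrix.

(** * Elementary stochastic integrals *)

Section Adapted.
Context {R : realType} {dT} {T : measurableType dT} (G : set (set T)).
Implicit Types U V : T -> R.

Lemma adaptedM U V : adapted G U -> adapted G V -> adapted G (fun w => U w * V w).
Proof. exact: measurable_funM. Qed.

Lemma adaptedD U V : adapted G U -> adapted G V -> adapted G (fun w => U w + V w).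
Proof. exact: measurable_funD. Qed.

Lemma adaptedB U V : adapted G U -> adapted G V -> adapted G (fun w => U w - V w).
Proof. exact: measurable_funB. Qed.

Lemma adaptedN U : adapted G U -> adapted G (fun w => - U w).
Proof. exact: measurable_funN. Qed.

Lemma adaptedX U n : adapted G U -> adapted G (fun w => U w ^+ n).
Proof. exact: measurable_funX. Qed.

Lemma adapted_cst c : adapted G (fun=> c : R).
Proof. exact: measurable_cst. Qed.

Lemma adapted_sum (I : Type) (s : seq I) (U : I -> T -> R) :
  (forall i, adapted G (U i)) -> adapted G (fun w => \sum_(i <- s) U i w).
Proof.
move=> aU; elim: s => [|i s ih].
  by under eq_fun do rewrite big_nil; exact: adapted_cst.
by under eq_fun do rewrite big_cons; exact: adaptedD.
Qed.

End Adapted.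

(** What the stochastic integrals use of the model: measurability of the chain and its independence
    from the Brownian motions. The rate at which the chain moves enters separately, through a bound
    on exit probabilities. *)
Record driving_noise {R : realType} {d J : nat} {dT} {T : measurableType dT}
    (P : probability T R) (X : R -> T -> 'I_d.+1) (B : 'I_J -> R -> T -> R) : Prop :=
  DrivingNoise {
  noise_chain : forall t, 0 <= t -> measurable_fun setT (X t);
  noise_brownian : forall j, standard_brownian_motion P (B j);
  noise_brownian_indep :
    mutually_independent P (fun j => sigma_family `[0, +oo[ (B j));
  noise_chain_indep : independent P (sigma_family `[0, +oo[ X)
    <<s \bigcup_j sigma_family `[0, +oo[ (B j) >> }.

Section Increments.
Context {R : realType} {d J : nat} {dT} {T : measurableType dT}.
Variables (P : probability T R) (X : R -> T -> 'I_d.+1) (B : 'I_J -> R -> T -> R).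
Hypothesis noise : driving_noise P X B.

Definition increment (j : 'I_J) (a b : R) (w : T) : R := B j b w - B j a w.

Lemma increment_self j a w : increment j a a w = 0.
Proof. exact: subrr. Qed.

Lemma increment_split j a b c w :
  increment j a c w = increment j a b w + increment j b c w.
Proof. by rewrite /increment; ring. Qed.

Lemma measurable_increment j a b : 0 <= a -> 0 <= b ->
  measurable_fun setT (increment j a b).
Proof.
by move=> a0 b0; have [mB _ _ _ _] := noise_brownian noise j;
  apply: measurable_funB; exact: mB.
Qed.

Section OneIncrement.
Variables (j : 'I_J) (a b : R).
Hypotheses (a0 : 0 <= a) (ab : a <= b).

Let law : a < b -> forall A : set R, measurable A ->
  P (increment j a b @^-1` A) = normal_prob 0 (Num.sqrt (b - a)) A.
Proof.
move=> ab' A mA; have [_ _ _ /(_ a b) h _] := noise_brownian noise j.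
by apply: h => //; rewrite a0.
Qed.

Let s0 : a < b -> 0 < Num.sqrt (b - a).
Proof. by move=> ?; rewrite sqrtr_gt0 subr_gt0. Qed.

Let mD : measurable_fun setT (increment j a b).
Proof. by apply: measurable_increment => //; exact: le_trans ab. Qed.

(** The law of an increment is prescribed for [a < b] only; on an empty interval the increment is
    the constant 0. *)
Let self (U : (T -> R) -> Prop) :
  U (fun=> 0) -> (a < b -> U (increment j a b)) -> U (increment j a b).
Proof.
move=> U0 Uab; move: (ab); rewrite le_eqVlt => /predU1P[<-|/Uab//].
by rewrite (_ : increment j a a = fun=> 0)//; apply/funext => w; rewrite increment_self.
Qed.

Lemma increment_all_moments : all_moments P (increment j a b).
Proof.
apply: self => [|ab']; first exact: all_moments_cst.
exact: normal_all_moments (s0 ab') mD (law ab').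
Qed.

Lemma increment_mean_odd n : odd n -> \int[P]_w (increment j a b w ^+ n) = 0.
Proof.
move=> on; apply: (self (U := fun V => \int[P]_w (V w ^+ n) = 0)) => [|ab'].
  by rewrite mean_cst expr0n; case: n on.
by rewrite (normal_mean_odd (s0 ab') mD (law ab') on).
Qed.

Lemma increment_mean_sqr : \int[P]_w (increment j a b w ^+ 2) = b - a.
Proof.
move: (ab); rewrite le_eqVlt => /predU1P[<-|ab'].
  by under eq_Rintegral do rewrite increment_self expr0n; rewrite mean_cst subrr.
rewrite (normal_mean_sqr (s0 ab') mD (law ab')) sqr_sqrtr// subr_ge0//.
Qed.

Lemma increment_mean_even_le k :
  \int[P]_w (increment j a b w ^+ k.*2) <= normal_moment_bound k * (b - a) ^+ k.
Proof.
move: (ab); rewrite le_eqVlt => /predU1P[<-|ab'].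
  under eq_Rintegral do rewrite increment_self; rewrite mean_cst.
  rewrite subrr !expr0n double_eq0 /normal_moment_bound; case: k => [|k] /=.
    by rewrite !expr0 !mul1r !mulr1 -{1}sqrtr1 ler_sqrt// ler1n.
  by rewrite mulr0.
apply: le_trans (normal_mean_even_le (s0 ab') mD (law ab') k) _.
by rewrite -mul2n exprM sqr_sqrtr// subr_ge0.
Qed.

Lemma increment_mean_mul (U : T -> R) n : adapted (past X B j a) U ->
  all_moments P U ->
  \int[P]_w (U w * increment j a b w ^+ n) =
  \int[P]_w U w * \int[P]_w (increment j a b w ^+ n).
Proof.
move=> aU UP; apply: (adapted_mean_mul (G := past X B j a)) => //.
- exact: past_setI.
- exact: past_setT.
- by apply: past_measurable; case: noise.
- move=> A D GA md; case: noise => mX hB iB iX.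
  by apply: (past_increment_indep (X := X)) => //; rewrite a0.
- exact: increment_all_moments.
Qed.

Lemma increment_mean_mul0 (U : T -> R) : adapted (past X B j a) U ->
  all_moments P U -> \int[P]_w (U w * increment j a b w) = 0.
Proof.
move=> aU UP; have := increment_mean_mul 1 aU UP.
by under eq_Rintegral do rewrite expr1; rewrite (@increment_mean_odd 1)// mulr0.
Qed.

End OneIncrement.

Lemma adapted_increment_upto j a b t : 0 <= a <= t -> 0 <= b <= t ->
  adapted (past X B j t) (increment j a b).
Proof. by move=> at_ bt; apply: adaptedB; exact: adapted_brownian_upto. Qed.

Lemma adapted_increment_other j l a b t : l != j -> 0 <= a -> 0 <= b ->
  adapted (past X B j t) (increment l a b).
Proof. by move=> lj a0 b0; apply: adaptedB; exact: adapted_brownian_other. Qed.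

(** The length of the intersection of the intervals from [a] to [b] and from [c] to [e], that is,
    the covariance of the two Brownian increments. *)
Definition overlap (a b c e : R) : R := Num.max 0 (Num.min b e - Num.max a c).

Lemma overlapC a b c e : overlap a b c e = overlap c e a b.
Proof. by rewrite /overlap minC (maxC a). Qed.

(** The intervals are in arbitrary position because those of an elementary process may overlap. By
    symmetry [a <= c]; cutting at the end points leaves one squared increment, over the common part,
    and products whose last increment is independent of all their other factors. *)
Lemma increment_pair j a b c e (xi eta : T -> R) :
  0 <= a <= b -> 0 <= c <= e ->
  adapted (past X B j a) xi -> adapted (past X B j c) eta ->
  all_moments P xi -> all_moments P eta ->
  \int[P]_w (xi w * eta w * (increment j a b w * increment j c e w)) =
  \int[P]_w (xi w * eta w) * overlap a b c e.
Proof.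
wlog ac : a b c e xi eta / a <= c => [hw|].
  move=> ab ce axi aeta xiP etaP; have [ac|/ltW ca] := leP a c; first exact: hw.
  have -> : \int[P]_w (xi w * eta w) = \int[P]_w (eta w * xi w).
    by apply: eq_Rintegral => w _; rewrite mulrC.
  rewrite overlapC -(hw c e a b eta xi)//; apply: eq_Rintegral => w _.
  by rewrite (mulrC (xi w)) (mulrC (increment j a b w)).
move=> /andP[a0 ab] /andP[c0 ce] axi aeta xiP etaP.
have axi' := adapted_past_nondecreasing ac axi.
have uP u v : 0 <= u -> u <= v -> all_moments P (increment j u v).
  exact: increment_all_moments.
have xeP := all_momentsM xiP etaP.
have axe := adaptedM axi' aeta.
have [bc|cb] := leP b c.
  have -> : overlap a b c e = 0.
    rewrite /overlap; apply/max_idPl; rewrite subr_le0.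
    by rewrite ge_min le_max bc orbT.
  rewrite mulr0; under eq_Rintegral do rewrite mulrA.
  apply: increment_mean_mul0 => //.
  - apply: adaptedM => //; apply: adapted_increment_upto; first by rewrite a0.
    by rewrite bc andbT (le_trans a0).
  - by apply: all_momentsM => //; exact: uP.
pose m := Num.min b e.
have cm : c <= m by rewrite le_min ce (ltW cb).
have mb : m <= b by rewrite ge_min lexx.
have me : m <= e by rewrite ge_min lexx orbT.
have m0 := le_trans c0 cm.
have -> : overlap a b c e = m - c.
  rewrite /overlap -/m (max_idPr ac); apply/max_idPr.
  by rewrite subr_ge0.
(* The common part runs from [c] to [m]. Of the two remainders after [m], one is empty, since [m] is
   the smaller of the right end points. *)
have dec w : xi w * eta w * (increment j a b w * increment j c e w) =
    xi w * eta w * increment j a c w * increment j c e w +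
    (xi w * eta w * increment j c m w ^+ 2 +
     (xi w * eta w * increment j c m w * increment j m e w +
      xi w * eta w * increment j c e w * increment j m b w)).
  rewrite (increment_split j a c b) (increment_split j c m b).
  rewrite (increment_split j c m e); ring.
under eq_Rintegral do rewrite dec.
have P1 : all_moments P (fun w => xi w * eta w * increment j a c w).
  by apply: all_momentsM => //; exact: uP.
have P2 : all_moments P (fun w => xi w * eta w * increment j c m w).
  by apply: all_momentsM => //; exact: uP.
have P3 : all_moments P (fun w => xi w * eta w * increment j c e w).
  by apply: all_momentsM => //; exact: uP.
have P4 : all_moments P (fun w => xi w * eta w * increment j c m w ^+ 2).
  by apply: all_momentsM => //; apply: all_momentsX; exact: uP.
have Q1 := all_momentsM P1 (uP _ _ c0 ce).
have Q2 := all_momentsM P2 (uP _ _ m0 me).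
have Q3 := all_momentsM P3 (uP _ _ m0 mb).
have Q23 := all_momentsD Q2 Q3.
rewrite (meanD Q1 (all_momentsD P4 Q23)) (meanD P4 Q23) (meanD Q2 Q3).
rewrite increment_mean_mul0//; last first.
  by apply: adaptedM => //; apply: adapted_increment_upto;
    rewrite ?a0 ?ac ?c0 ?lexx.
rewrite increment_mean_mul// increment_mean_sqr//.
rewrite (@increment_mean_mul0 j m e)//; last first.
  apply: adaptedM => //; first exact: adapted_past_nondecreasing axe.
  by apply: adapted_increment_upto; rewrite ?c0 ?m0 ?lexx.
suff -> : \int[P]_w (xi w * eta w * increment j c e w * increment j m b w) = 0.
  by rewrite add0r !addr0.
rewrite /m; have [be|eb] := leP b e.
  by under eq_Rintegral do rewrite increment_self mulr0; rewrite mean_cst.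
apply: increment_mean_mul0 => //; first exact: le_trans ce.
- exact: ltW.
- apply: adaptedM => //; first exact: adapted_past_nondecreasing axe.
  by apply: adapted_increment_upto; rewrite ?c0 ?ce ?lexx ?andbT// (le_trans c0).
Qed.

End Increments.

Lemma ge0_integral_2MD {d} {T : measurableType d} {R : realType}
    (mu : {measure set T -> \bar R}) (D : set T) (f g : T -> \bar R) :
  measurable D -> measurable_fun D f -> measurable_fun D g ->
  (forall x, (0 <= f x)%E) -> (forall x, (0 <= g x)%E) ->
  (\int[mu]_(x in D) (2%:E * f x + 2%:E * g x) =
   2%:E * \int[mu]_(x in D) f x + 2%:E * \int[mu]_(x in D) g x)%E.
Proof.
move=> mD mf mg f0 g0; rewrite ge0_integralD//.
- by rewrite !ge0_integralZl.
- by move=> x _; rewrite mule_ge0.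
- by apply: emeasurable_funM.
- by move=> x _; rewrite mule_ge0.
- by apply: emeasurable_funM.
Qed.

(** * Interchange of time integrals and means *)

Section TimeTonelli.
Context {R : realType} {dT} {T : measurableType dT} (P : probability T R).
Notation leb := (@lebesgue_measure R).

Definition jointly_measurable (F : R -> T -> R) : Prop :=
  measurable_fun setT (fun z : R * T => F z.1 z.2).

Implicit Types F G : R -> T -> R.

Lemma jointly_measurableD F G : jointly_measurable F -> jointly_measurable G ->
  jointly_measurable (fun s w => F s w + G s w).
Proof. exact: measurable_funD. Qed.

Lemma jointly_measurableB F G : jointly_measurable F -> jointly_measurable G ->
  jointly_measurable (fun s w => F s w - G s w).
Proof. exact: measurable_funB. Qed.

Lemma jointly_measurableM F G : jointly_measurable F -> jointly_measurable G ->
  jointly_measurable (fun s w => F s w * G s w).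
Proof. exact: measurable_funM. Qed.

Lemma jointly_measurableX F n : jointly_measurable F ->
  jointly_measurable (fun s w => F s w ^+ n).
Proof. exact: measurable_funX. Qed.

Lemma jointly_measurable_norm F : jointly_measurable F ->
  jointly_measurable (fun s w => `|F s w|).
Proof. by move=> mF; apply: measurableT_comp. Qed.

Lemma jointly_measurable_time (f : R -> R) : measurable_fun setT f ->
  jointly_measurable (fun s _ => f s).
Proof. by move=> mf; exact: (measurableT_comp mf measurable_fst). Qed.

Lemma jointly_measurable_space (f : T -> R) : measurable_fun setT f ->
  jointly_measurable (fun _ w => f w).
Proof. by move=> mf; exact: (measurableT_comp mf measurable_snd). Qed.

Lemma jointly_measurable_sum (I : Type) (s : seq I) (F : I -> R -> T -> R) :
  (forall i, jointly_measurable (F i)) ->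
  jointly_measurable (fun u w => \sum_(i <- s) F i u w).
Proof.
move=> mF; elim: s => [|i s ih]; rewrite /jointly_measurable.
  by under eq_fun do rewrite big_nil; exact: measurable_cst.
under eq_fun do rewrite big_cons; exact: (jointly_measurableD (mF i) ih).
Qed.

Lemma jointly_measurable_section1 F s : jointly_measurable F -> measurable_fun setT (F s).
Proof. by move=> mF; exact: (measurableT_comp mF (pair1_measurable s)). Qed.

Lemma jointly_measurable_section2 F w :
  jointly_measurable F -> measurable_fun setT (F ^~ w).
Proof. by move=> mF; exact: (measurableT_comp mF (pair2_measurable w)). Qed.

Lemma time_integral_mkcond (D : set R) (f : R -> R) :
  (\int[leb]_(s in D) (f s)%:E = \int[leb]_s (f s * \1_D s)%:E)%E.
Proof.
rewrite integral_mkcond; congr (integral _ _ _); apply/funext => s.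
by rewrite patchE indicE; case: (s \in D); rewrite ?mulr1 ?mulr0.
Qed.

Lemma jointly_measurable_indic F (D : set R) : measurable D ->
  jointly_measurable F -> jointly_measurable (fun s w => F s w * \1_D s).
Proof.
move=> mD mF; apply: jointly_measurableM => //.
by apply: jointly_measurable_time; exact: measurable_indic.
Qed.

Lemma measurable_time_integral F (D : set R) : measurable D -> jointly_measurable F ->
  (forall s w, 0 <= F s w) ->
  measurable_fun setT (fun w => (\int[leb]_(s in D) (F s w)%:E)%E).
Proof.
move=> mD mF F0; under eq_fun do rewrite time_integral_mkcond.
apply: (@measurable_fun_fubini_tonelli_G _ _ _ _ _ leb
  (fun z : R * T => (F z.1 z.2 * \1_D z.1)%:E)).
  by apply/measurable_EFinP; exact: jointly_measurable_indic.
by move=> z; rewrite lee_fin mulr_ge0.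
Qed.

Lemma tonelli_time F (D : set R) : measurable D -> jointly_measurable F ->
  (forall s w, 0 <= F s w) ->
  (\int[P]_w \int[leb]_(s in D) (F s w)%:E =
   \int[leb]_(s in D) \int[P]_w (F s w)%:E)%E.
Proof.
move=> mD mF F0; under eq_integral do rewrite time_integral_mkcond.
have mf : measurable_fun setT (fun z : R * T => (F z.1 z.2 * \1_D z.1)%:E).
  by apply/measurable_EFinP; exact: jointly_measurable_indic.
have f0 (z : R * T) : (0 <= (F z.1 z.2 * \1_D z.1)%:E)%E.
  by rewrite lee_fin mulr_ge0.
have /= <- := @fubini_tonelli _ _ _ _ _ leb P _ mf f0.
rewrite [RHS]integral_mkcond; congr (integral _ _ _); apply/funext => s.
rewrite patchE indicE; case: (s \in D); last first.
  by rewrite integral0_eq// => w _; rewrite mulr0.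
by apply: eq_integral => w _; rewrite mulr1.
Qed.

Lemma measurable_mean_time F : jointly_measurable F -> (forall s w, 0 <= F s w) ->
  measurable_fun setT (fun s => (\int[P]_w (F s w)%:E)%E).
Proof.
move=> mF F0.
apply: (@measurable_fun_fubini_tonelli_F _ _ _ _ _ P
  (fun z : R * T => (F z.1 z.2)%:E)).
  exact/measurable_EFinP.
by move=> z; rewrite lee_fin.
Qed.

(** The squared [L^2] norm on the product of [[0, t]] and the sample space, with values in the
    extended reals since the processes compared need not be square integrable in advance. *)
Definition process_sqnorm (t : R) F : \bar R :=
  (\int[P]_w \int[leb]_(s in `[0%R, t]) (F s w ^+ 2)%:E)%E.

Lemma process_sqnormB t F G : jointly_measurable F -> jointly_measurable G ->
  (process_sqnorm t (fun s w => (F s w - G s w)%R) <=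
   2%:E * process_sqnorm t F + 2%:E * process_sqnorm t G)%E.
Proof.
move=> mF mG; rewrite /process_sqnorm.
have msq H : jointly_measurable H -> jointly_measurable (fun s w => H s w ^+ 2).
  exact: jointly_measurableX.
have mI H : jointly_measurable H -> measurable_fun setT
    (fun w => (\int[leb]_(s in `[0%R, t]) (H s w ^+ 2)%:E)%E).
  move=> mH; apply: (measurable_time_integral _ (msq _ mH)) => // s w.
  exact: sqr_ge0.
have I0 H w : (0 <= \int[leb]_(s in `[0%R, t]) (H s w ^+ 2)%:E)%E.
  by apply: integral_ge0 => s _; rewrite lee_fin sqr_ge0.
rewrite -ge0_integral_2MD//; [|exact: mI|exact: mI].
have mS H w : jointly_measurable H ->
    measurable_fun `[0, t] (fun s => (H s w ^+ 2)%:E).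
  move=> mH; apply/measurable_EFinP; apply: measurable_funTS.
  by apply: measurable_funX; exact: jointly_measurable_section2.
apply: ge0_le_integral => //.
- by move=> w _; exact: (I0 _ (fun s w => F s w - G s w)).
- by apply: (mI (fun s w => F s w - G s w)); exact: jointly_measurableB.
- by apply: emeasurable_funD; apply: emeasurable_funM => //; exact: mI.
move=> w _; have sq0 H s : (0 <= (H s w ^+ 2 : R)%:E :> \bar R)%E.
  by rewrite lee_fin sqr_ge0.
rewrite -ge0_integral_2MD//; [|exact: mS|exact: mS].
apply: ge0_le_integral => //.
- by move=> s _; rewrite lee_fin sqr_ge0.
- by apply: (mS (fun s w => F s w - G s w)); exact: jointly_measurableB.
- by apply: emeasurable_funD; apply: emeasurable_funM => //; exact: mS.
move=> s _; rewrite -!EFinM -EFinD lee_fin.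
by have := sqr_ge0 (F s w + G s w); nra.
Qed.

End TimeTonelli.

(** * The isometry and comparison with the Ito integral *)

Section Isometry.
Context {R : realType} {d J : nat} {dT} {T : measurableType dT}.
Variables (P : probability T R) (X : R -> T -> 'I_d.+1) (B : 'I_J -> R -> T -> R).
Hypothesis noise : driving_noise P X B.
Variable j : 'I_J.
Notation leb := (@lebesgue_measure R).

Lemma integral_overlap (t a b c e : R) : 0 <= a <= b -> 0 <= c <= e -> b <= t -> e <= t ->
  (\int[leb]_(s in `[0%R, t]) (\1_`]a, b] s * \1_`]c, e] s)%:E =
   (overlap a b c e)%:E)%E.
Proof.
move=> /andP[a0 ab] /andP[c0 ce] bt et.
have -> : (fun s => (\1_`]a, b] s * \1_`]c, e] s : R)%:E) =
    (fun s => (\1_`]Num.max a c, Num.min b e] s)%:E).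
  apply/funext => s; rewrite !indicE; congr EFin.
  have mE (x y : R) : (s \in `]x, y]%classic) = (x < s <= y).
    by apply/idP/idP; rewrite inE /= in_itv.
  rewrite !mE gt_max le_min.
  case: (a < s); case: (c < s); case: (s <= b); case: (s <= e);
    by rewrite /= ?mulr1 ?mulr0.
rewrite integral_indic// setIidl; last first.
  move=> s /=; rewrite !in_itv/= gt_max le_min => /andP[/andP[as_ _] /andP[sb _]].
  by rewrite (le_trans a0 (ltW as_)) (le_trans sb bt).
rewrite /= lebesgue_measure_itv/= lte_fin -EFinB.
rewrite /overlap; case: ifPn => [h|].
  by congr EFin; apply/esym/max_idPr; rewrite subr_ge0 ltW.
by rewrite -leNgt => h; congr EFin; apply/esym/max_idPl; rewrite subr_le0.
Qed.

Section Family.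
Variables (I : finType) (t : R) (a b : I -> R) (xi : I -> T -> R).
Hypothesis ab : forall i, 0 <= a i <= b i.
Hypothesis bt : forall i, b i <= t.
Hypothesis axi : forall i, adapted (past X B j (a i)) (xi i).
Hypothesis xiP : forall i, all_moments P (xi i).

(** The index is an arbitrary finite type, so that the difference of two such integrals is again
    one, indexed by a sum type. The coefficients are adapted to [past] and have all moments, which
    admits coefficients that depend on the future of the chain. *)
Definition family_integral (w : T) : R :=
  \sum_i xi i w * increment B j (a i) (b i) w.

Definition family_process (s : R) (w : T) : R :=
  \sum_i xi i w * \1_`]a i, b i] s.

Let incP i : all_moments P (increment B j (a i) (b i)).
Proof. by apply: (increment_all_moments noise); have /andP[] := ab i. Qed.

Lemma family_integral_all_moments : all_moments P family_integral.
Proof. by apply: all_moments_sum => i; exact: all_momentsM. Qed.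

Lemma family_integral_sqr : \int[P]_w (family_integral w ^+ 2) =
  \sum_i \sum_l \int[P]_w (xi i w * xi l w) * overlap (a i) (b i) (a l) (b l).
Proof.
under eq_Rintegral do rewrite expr2 big_distrlr/=.
rewrite mean_sum => [|i]; last first.
  by apply: all_moments_sum => l; do !apply: all_momentsM.
apply: eq_bigr => i _; rewrite mean_sum => [|l]; last by do !apply: all_momentsM.
apply: eq_bigr => l _; rewrite -(increment_pair noise (j := j))//.
by apply: eq_Rintegral => w _; rewrite mulrACA.
Qed.

Lemma family_process_jointly_measurable : jointly_measurable family_process.
Proof.
apply: jointly_measurable_sum => i; apply: jointly_measurableM.
  by apply: jointly_measurable_space; case: (xiP i).
by apply: jointly_measurable_time; exact: measurable_indic.
Qed.

(** Both sides expand to the double sum of the means of [xi i * xi l] times the overlaps: the time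
    integral of a product of two indicators and the covariance of two increments are the same
    number. *)
Lemma ito_isometry : process_sqnorm P t family_process =
  (\int[P]_w (family_integral w ^+ 2))%:E.
Proof.
rewrite family_integral_sqr /process_sqnorm.
have inner w : (\int[leb]_(s in `[0%R, t]) (family_process s w ^+ 2)%:E =
    (\sum_i \sum_l xi i w * xi l w * overlap (a i) (b i) (a l) (b l))%:E)%E.
  have iM i l : leb.-integrable `[0%R, t]
      (fun s => (\1_`]a i, b i] s * \1_`]a l, b l] s)%:E).
    apply/integrableP; split.
      by apply/measurable_EFinP; apply: measurable_funM; exact: measurable_indic.
    under eq_integral do rewrite /= ger0_norm ?mulr_ge0//.
    by rewrite integral_overlap ?ltry.
  have E s : (family_process s w ^+ 2)%:E = (\sum_(i : I) \sum_(l : I)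
      (xi i w * xi l w)%:E * (\1_`]a i, b i] s * \1_`]a l, b l] s)%:E)%E.
    rewrite expr2 big_distrlr/= -sumEFin; apply: eq_bigr => i _.
    by rewrite -sumEFin; apply: eq_bigr => l _; rewrite mulrACA.
  under eq_integral do rewrite E.
  rewrite integral_sum//; last first.
    by move=> i; apply: integrable_sum => // l _; exact: integrableZl.
  rewrite -sumEFin; apply: eq_bigr => i _.
  rewrite integral_sum//; last by move=> l; exact: integrableZl.
  rewrite -sumEFin; apply: eq_bigr => l _.
  by rewrite integralZl// integral_overlap.
under eq_integral do rewrite inner.
have xxP i l : all_moments P (fun w => xi i w * xi l w) by exact: all_momentsM.
have xoP i l : all_moments P
    (fun w => xi i w * xi l w * overlap (a i) (b i) (a l) (b l)).
  by apply: all_momentsM => //; exact: all_moments_cst.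
rewrite all_moments_integral; last first.
  by apply: all_moments_sum => i; exact: all_moments_sum.
congr EFin; rewrite mean_sum => [|i]; last exact: all_moments_sum.
apply: eq_bigr => i _; rewrite mean_sum//; apply: eq_bigr => l _.
by rewrite mulrC -meanZ//; apply: eq_Rintegral => w _; rewrite mulrC.
Qed.

End Family.

Lemma ereal_cvg0_le (u : nat -> \bar R) (e : R) : u @ \oo --> 0%E -> 0 < e ->
  \forall n \near \oo, (u n <= e%:E)%E.
Proof.
move=> /fine_cvgP[ufin /cvgrPdist_le/(_ e) u0] e0.
near=> n; have : `|0 - (fine \o u) n| <= e by near: n; exact: u0.
rewrite /= sub0r normrN => h; rewrite -[u n]fineK; last by near: n.
by rewrite lee_fin (le_trans (ler_norm _) h).
Unshelve. all: by end_near. Qed.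

Section Comparison.
Variables (t : R) (H : R -> T -> R) (Y : T -> R).
Hypothesis t0 : 0 <= t.
Hypothesis mH : jointly_measurable H.
Hypothesis ito : ito_integral P (history X B) (B j) H t Y.
Variables (I : finType) (a b : I -> R) (xi : I -> T -> R).
Hypothesis ab : forall i, 0 <= a i <= b i.
Hypothesis bt : forall i, b i <= t.
Hypothesis axi : forall i, adapted (past X B j (a i)) (xi i).
Hypothesis xiP : forall i, all_moments P (xi i).

Lemma elementary_adapted (phi : elementary (history X B) t) (k : 'I_(el_size phi)) :
  adapted (past X B j (el_left k)) (el_coef k).
Proof.
move=> _ A mA; rewrite setTI; apply: history_sub_past; exact: el_adapted.
Qed.

Lemma elementary_all_moments (phi : elementary (history X B) t) (k : 'I_(el_size phi)) :
  all_moments P (el_coef k).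
Proof.
have [C hC] := el_bounded k; apply: all_moments_bounded hC.
apply: (adapted_measurable (G := past X B j (el_left k))).
  by apply: past_measurable; case: noise.
exact: elementary_adapted.
Qed.

(** The integral [Y] is compared with its own elementary approximation, and the difference of that
    approximation and the family is measured by the isometry. The squared triangle inequality, used
    twice, produces the factor 4; the terms in [phi n] vanish in the limit. *)
Lemma ito_integral_sub_family_le :
  (\int[P]_w ((Y w - family_integral a b xi w) ^+ 2)%:E <=
   4%:E * process_sqnorm P t (fun s w => (H s w - family_process a b xi s w)%R))%E.
Proof.
have [mY [phi [phiH phiY]]] := ito.
set q := process_sqnorm _ _ _.
have psiP := family_integral_all_moments ab xiP.
have mpsi := family_process_jointly_measurable a b xiP.
have key n : (\int[P]_w ((Y w - family_integral a b xi w) ^+ 2)%:E <=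
   2%:E * (\int[P]_w ((Y w - el_integral (B j) (phi n) w) ^+ 2)%:E) +
   2%:E * (2%:E * q + 2%:E * process_sqnorm P t
       (fun s w => (H s w - el_process (phi n) s w)%R)))%E.
  (* The elementary process and the negated family are put together as a single family, to which the
     isometry applies. *)
  pose a' (i : 'I_(el_size (phi n)) + I) :=
    match i with inl k => el_left k | inr i => a i end.
  pose b' (i : 'I_(el_size (phi n)) + I) :=
    match i with inl k => el_right k | inr i => b i end.
  pose xi' (i : 'I_(el_size (phi n)) + I) :=
    match i with inl k => el_coef k | inr i => (fun w => - xi i w) end.
  have ab' i : 0 <= a' i <= b' i.
    by case: i => [k|i] /=; [have [] := el_itv k|exact: ab].
  have bt' i : b' i <= t.
    by case: i => [k|i] /=; [have [] := el_itv k|exact: bt].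
  have axi' i : adapted (past X B j (a' i)) (xi' i).
    case: i => [k|i] /=; first exact: elementary_adapted.
    by apply: adaptedN; exact: axi.
  have xiP' i : all_moments P (xi' i).
    case: i => [k|i] /=; first exact: elementary_all_moments.
    exact: all_momentsN.
  have phiP : all_moments P (el_integral (B j) (phi n)).
    apply: all_moments_sum => k; apply: all_momentsM.
      exact: elementary_all_moments.
    have [/andP[? ?] _] := el_itv k.
    exact: (increment_all_moments noise).
  have mphi : jointly_measurable (el_process (phi n)).
    apply: jointly_measurable_sum => k; apply: jointly_measurableM.
      by apply: jointly_measurable_space; case: (elementary_all_moments k).
    by apply: jointly_measurable_time; exact: measurable_indic.
  have intE w : family_integral a' b' xi' w =
      el_integral (B j) (phi n) w - family_integral a b xi w.
    rewrite /family_integral big_sumType/=; congr (_ + _).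
    by rewrite -sumrN; apply: eq_bigr => i _; rewrite mulNr.
  have procE s w : family_process a' b' xi' s w =
      (H s w - family_process a b xi s w) - (H s w - el_process (phi n) s w).
    transitivity (el_process (phi n) s w - family_process a b xi s w); last by ring.
    rewrite /family_process big_sumType/=; congr (_ + _).
    by rewrite -sumrN; apply: eq_bigr => i _; rewrite mulNr.
  have iso : (process_sqnorm P t (fun s w => ((H s w - family_process a b xi s w) -
      (H s w - el_process (phi n) s w))%R) =
      \int[P]_w ((el_integral (B j) (phi n) w - family_integral a b xi w) ^+ 2)%:E)%E.
    rewrite all_moments_integral; last exact/all_momentsX/all_momentsB.
    under [in RHS]eq_Rintegral do rewrite -intE.
    rewrite -(ito_isometry ab' bt' axi' xiP'); congr process_sqnorm.
    by apply/funext => s; apply/funext => w; rewrite procE.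
  apply: (@le_trans _ _ (2%:E * (\int[P]_w ((Y w - el_integral (B j) (phi n) w) ^+ 2)%:E)
    + 2%:E * (\int[P]_w ((el_integral (B j) (phi n) w - family_integral a b xi w) ^+ 2)%:E))%E).
    have msq (U V : T -> R) : measurable_fun setT U -> measurable_fun setT V ->
        measurable_fun setT (fun w => ((U w - V w) ^+ 2)%:E).
      move=> mU mV; apply/measurable_EFinP; apply: measurable_funX.
      exact: measurable_funB.
    have mint := all_moments_measurable psiP.
    have mphiI := all_moments_measurable phiP.
    rewrite -ge0_integral_2MD//.
    - apply: ge0_le_integral => //.
      + by move=> w _; rewrite lee_fin sqr_ge0.
      + exact: msq.
      + by apply: emeasurable_funD; apply: emeasurable_funM => //; exact: msq.
      move=> w _; rewrite -!EFinM -EFinD lee_fin.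
      set x := Y w; set y := el_integral _ _ _; set z := family_integral _ _ _ _.
      by have := sqr_ge0 (x - y - (y - z)); nra.
    - exact: msq.
    - exact: msq.
    - by move=> w; rewrite lee_fin sqr_ge0.
    - by move=> w; rewrite lee_fin sqr_ge0.
  apply: leeD => //; apply: lee_wpmul2l => //; rewrite -iso.
  by apply: process_sqnormB; exact: jointly_measurableB.
apply/lee_addgt0Pr => e e0.
(* The two vanishing terms have coefficients 2 and 4. *)
have e60 : 0 < e / 6 by rewrite divr_gt0.
near \oo => n.
have an : (\int[P]_w ((Y w - el_integral (B j) (phi n) w) ^+ 2)%:E <= (e / 6)%:E)%E.
  by near: n; exact: ereal_cvg0_le.
have bn : (process_sqnorm P t (fun s w => (H s w - el_process (phi n) s w)%R) <= (e / 6)%:E)%E.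
  by near: n; exact: ereal_cvg0_le.
apply: le_trans (key n) _.
apply: (@le_trans _ _ (2%:E * (e / 6)%:E + 2%:E * (2%:E * q + 2%:E * (e / 6)%:E))%E).
  apply: leeD; first by apply: lee_wpmul2l.
  by apply: lee_wpmul2l => //; apply: leeD => //; exact: lee_wpmul2l.
have q0 : (0 <= q)%E.
  apply: integral_ge0 => w _; apply: integral_ge0 => s _.
  by rewrite lee_fin sqr_ge0.
have -> : (4%:E * q = 2%:E * (2%:E * q))%E by rewrite muleA -EFinM; congr (_%:E * _)%E; ring.
have q20 : (0 <= 2%:E * q)%E by rewrite mule_ge0.
rewrite ge0_muleDr// -?EFinM ?lee_fin ?mulr_ge0 ?(ltW e60) ?(ltW e0)//.
by rewrite addeC -addeA -EFinD; apply: leeD => //; rewrite lee_fin; lra.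
Unshelve. all: by end_near. Qed.

End Comparison.
End Isometry.

(** * Ito integrals of functions of the chain *)

Section RightContinuous.
Context {R : realType} {dT} {T : measurableType dT}.

(** The time is rounded up to a grid of mesh [1 / n.+1]; the rounded process takes countably many
    times and converges by right continuity. Replacing [s] by its positive part gives a function on
    the whole line without assumptions at negative times. *)
Lemma right_continuous_jointly_measurable (F : R -> T -> R) :
  (forall s, 0 <= s -> measurable_fun setT (F s)) ->
  (forall w s, 0 <= s -> F r w @[r --> s^'+] --> F s w) ->
  jointly_measurable (fun s w => F (Num.max s 0) w).
Proof.
move=> mF cF.
(* In [q], the successor of the truncation makes the grid time strictly greater than [s], as the
   limit from the right requires. *)
pose k n (s : R) := Num.truncn (Num.max s 0 * n.+1%:R).
pose q n s : R := (k n s).+1%:R / n.+1%:R.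
have x0 n (s : R) : 0 <= Num.max s 0 * n.+1%:R.
  by rewrite mulr_ge0// le_max lexx orbT.
apply: (@measurable_fun_cvg _ _ _ _ (fun n (z : R * T) => F (q n z.1) z.2)).
  move=> n _ A mA; rewrite setTI.
  have -> : (fun z : R * T => F (q n z.1) z.2) @^-1` A =
      \bigcup_m ([set s | k n s = m] `*` (F (m.+1%:R / n.+1%:R) @^-1` A)).
    apply/seteqP; split => [[s w] /= Fsw|[s w] [m _ [/= km]]].
      by exists (k n s).
    by rewrite /q km.
  apply: bigcupT_measurable => m; apply: measurableX; last first.
    by rewrite -[X in measurable X]setTI; apply: mF.
  have -> : [set s | k n s = m] = [set s | (m%:R <= Num.max s 0 * n.+1%:R) &&
      (Num.max s 0 * n.+1%:R < m.+1%:R)].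
    apply/seteqP; split => s /=; first by move=> <-; exact: truncn_itv.
    by move=> h; apply: truncn_def.
  rewrite -[X in measurable X]setTI.
  have mg : measurable_fun setT (fun s : R => Num.max s 0 * n.+1%:R).
    by apply: measurable_funM => //; exact: measurable_maxr.
  have : measurable_fun setT (fun s : R => (m%:R <= Num.max s 0 * n.+1%:R) &&
      (Num.max s 0 * n.+1%:R < m.+1%:R)).
    by apply: measurable_and; [exact: measurable_fun_ler|exact: measurable_fun_ltr].
  by move=> /(_ measurableT [set true]); apply.
move=> [s w] _ /=.
have s0 : 0 <= Num.max s 0 by rewrite le_max lexx orbT.
have /cvg_at_rightP := cF w _ s0; apply; split.
  move=> n; rewrite /q ltr_pdivlMr// /k.
  by have /andP[] := truncn_itv (x0 n s).
apply: (@squeeze_cvgr _ _ _ _ (fun=> Num.max s 0)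
  (fun n => Num.max s 0 + n.+1%:R^-1)).
- near=> n; have /andP[h1 h2] := truncn_itv (x0 n s).
  rewrite /q ler_pdivlMr// (ltW h2)/= ler_pdivrMr// mulrDl mulVf//.
  by rewrite -natr1 lerD2r.
- exact: cvg_cst.
- rewrite -[X in _ --> X]addr0; apply: cvgD; first exact: cvg_cst.
  exact: cvg_harmonic.
Unshelve. all: by end_near. Qed.

Lemma measurable_ord_neq d (U V : T -> 'I_d.+1) : measurable_fun setT U ->
  measurable_fun setT V -> measurable [set w | U w != V w].
Proof.
move=> mU mV.
have -> : [set w | U w != V w] =
    \bigcup_(i in [set: 'I_d.+1]) (U @^-1` [set i] `&` V @^-1` (~` [set i])).
  apply/seteqP; split => [w /= UV|w [i _ [/= -> /= ]]].
    by exists (U w) => //; split=> //=; apply/eqP; rewrite eq_sym.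
  by move=> /eqP; rewrite eq_sym.
apply: fin_bigcup_measurable => // i _; apply: measurableI.
  by rewrite -[_ @^-1` _]setTI; exact: mU.
by rewrite -[_ @^-1` _]setTI; exact: mV.
Qed.

Lemma measurable_ord_comp d (U : T -> 'I_d.+1) (f : 'I_d.+1 -> R) :
  measurable_fun setT U -> measurable_fun setT (fun w => f (U w)).
Proof. by move=> mU; apply: (@measurableT_comp _ _ _ _ _ _ f). Qed.

End RightContinuous.

Section StepApproximation.
Context {R : realType} {d J : nat} {dT} {T : measurableType dT}.
Variables (P : probability T R) (X : R -> T -> 'I_d.+1) (B : 'I_J -> R -> T -> R).
Hypothesis noise : driving_noise P X B.
Hypothesis rcX : forall w t, 0 <= t -> \forall s \near t^'+, X s w = X t w.
Variables (kappa h0 : R).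
Hypothesis kappa0 : 0 <= kappa.
Hypothesis exitX : forall s t, 0 <= s <= t -> t - s <= h0 ->
  (P [set w | X s w != X t w] <= (kappa * (t - s))%:E)%E.
Variables (f : 'I_d.+1 -> R) (C : R).
Hypothesis fC : forall i, `|f i| <= C.
Notation leb := (@lebesgue_measure R).

Let mX := noise_chain noise.

Lemma chain_jointly_measurable (g : 'I_d.+1 -> R) :
  jointly_measurable (fun s w => g (X (Num.max s 0) w)).
Proof.
apply: (right_continuous_jointly_measurable (F := fun s w => g (X s w))).
  by move=> s s0; apply: measurable_ord_comp; exact: mX.
move=> w s s0; apply: cvg_near_cst.
by apply: filterS (rcX w s0) => r ->.
Qed.

Let C0 : 0 <= C. Proof. exact: le_trans (normr_ge0 _) (fC ord0). Qed.

(** The integrand vanishes unless the states at the two times differ, and it is at most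
    [(2 * C) ^+ 2] otherwise. *)
Lemma mean_chain_sqr_diff s r : 0 <= s <= r -> r - s <= h0 ->
  (\int[P]_w ((f (X r w) - f (X s w)) ^+ 2)%:E <=
   (4 * C ^+ 2 * (kappa * (r - s)))%:E)%E.
Proof.
move=> /andP[s0 sr] rs.
have r0 := le_trans s0 sr.
have mS : measurable [set w | X s w != X r w].
  by apply: measurable_ord_neq; exact: mX.
apply: (@le_trans _ _ (\int[P]_w ((4 * C ^+ 2)%:E *
    (\1_[set w | X s w != X r w] w)%:E))%E).
  apply: ge0_le_integral => //.
  - by move=> w _; rewrite lee_fin sqr_ge0.
  - apply/measurable_EFinP; apply: measurable_funX; apply: measurable_funB;
      by apply: measurable_ord_comp; exact: mX.
  - by apply/measurable_EFinP; apply: measurable_funM => //; exact: measurable_indic.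
  move=> w _; rewrite -EFinM lee_fin indicE.
  case: (boolP (X s w == X r w)) => [/eqP ->|h].
    by rewrite subrr expr0n mulr_ge0// mulr_ge0// sqr_ge0.
  rewrite mem_set// mulr1.
  have := fC (X r w); have := fC (X s w); rewrite !ler_norml.
  by move: (f _) (f _) => x y /andP[? ?] /andP[? ?]; nra.
rewrite ge0_integralZl//.
- rewrite integral_indic// setIT [leRHS]EFinM; apply: lee_wpmul2l.
    by rewrite lee_fin mulr_ge0// sqr_ge0.
  by apply: exitX => //; rewrite s0.
- by apply/measurable_EFinP; exact: measurable_indic.
- by rewrite lee_fin mulr_ge0// sqr_ge0.
Qed.

Variable t : R.
Hypothesis t0 : 0 <= t <= h0.

Definition grid (n k : nat) : R := t * k%:R / n%:R.

Lemma grid_ge0 n k : 0 <= grid n k.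
Proof. by have /andP[? _] := t0; rewrite divr_ge0// mulr_ge0. Qed.

Lemma grid_le n k l : (k <= l)%N -> grid n k <= grid n l.
Proof.
by move=> kl; have /andP[? _] := t0; rewrite ler_wpM2r ?invr_ge0// ler_wpM2l// ler_nat.
Qed.

Lemma grid_end n : (0 < n)%N -> grid n n = t.
Proof. by move=> n0; rewrite /grid mulfK// pnatr_eq0 -lt0n. Qed.

Lemma gridS n k : grid n k.+1 - grid n k = t / n%:R.
Proof. by rewrite /grid -natr1; ring. Qed.

Definition step_coef (n : nat) (k : 'I_n) (w : T) : R := f (X (grid n k) w).

Definition step_process n :=
  family_process (fun k : 'I_n => grid n k) (fun k : 'I_n => grid n k.+1) (@step_coef n).

Lemma step_processE n (k : 'I_n) s w : grid n k < s <= grid n k.+1 ->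
  step_process n s w = f (X (grid n k) w).
Proof.
move=> /andP[ks sk]; rewrite /step_process /family_process (bigD1 k)//=.
rewrite big1 => [|l lk].
  by rewrite addr0 indicE mem_set ?mulr1//= in_itv/= ks.
rewrite indicE memNset ?mulr0//= in_itv/= => /andP[ls sl].
have := lt_le_trans ls sk; have := lt_le_trans ks sl.
have mono m m' : grid n m < grid n m' -> (m < m')%N.
  by move=> h; rewrite ltnNge; apply/negP => /(grid_le n); rewrite leNgt h.
move=> /mono h1 /mono h2; case/negP: lk; apply/eqP/val_inj => /=.
by apply/eqP; rewrite eqn_leq -ltnS h2 -ltnS h1.
Qed.

Lemma grid_locate n s : (0 < n)%N -> 0 < s <= t ->
  exists k : 'I_n, grid n k < s <= grid n k.+1.
Proof.
move=> n0 /andP[s0 st].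
have exm : exists m, s <= grid n m by exists n; rewrite grid_end.
case: (ex_minnP exm) => -[|k] sk kmin.
  by move: sk; rewrite /grid mulr0 mul0r leNgt s0.
have kn : (k < n)%N by apply: kmin; rewrite grid_end.
exists (Ordinal kn); rewrite /= sk andbT ltNge; apply/negP => /kmin.
by rewrite ltnn.
Qed.

Lemma step_process_jointly_measurable n : jointly_measurable (step_process n).
Proof.
apply: (@family_process_jointly_measurable _ _ _ P) => k.
apply: (@all_moments_bounded _ _ _ _ _ C) => [|w]; last exact: fC.
by apply: measurable_ord_comp; apply: mX; exact: grid_ge0.
Qed.

(** After Tonelli's theorem the time [s] is fixed: it lies in one cell, of length [t / n], so the
    state at [s] differs from the state at the left end with probability at most
    [kappa * (t / n)]. *)
Lemma step_process_error n : (0 < n)%N ->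
  (process_sqnorm P t (fun s w => (f (X (Num.max s 0) w) - step_process n s w)%R) <=
   (4 * C ^+ 2 * (kappa * (t / n%:R)) * t)%:E)%E.
Proof.
move=> n0; have /andP[tge0 th0] := t0.
have mD : jointly_measurable
    (fun s w => (f (X (Num.max s 0) w) - step_process n s w) ^+ 2).
  apply: jointly_measurableX; apply: jointly_measurableB.
    exact: chain_jointly_measurable.
  exact: step_process_jointly_measurable.
have D0 s w : 0 <= (f (X (Num.max s 0) w) - step_process n s w) ^+ 2 by exact: sqr_ge0.
rewrite /process_sqnorm (tonelli_time _ _ mD)//.
have mI := measurable_mean_time P mD D0.
(* The cells are open on the left, so the time 0 belongs to none of them; it is removed as a null
   set. *)
rewrite -integral_itv_obnd_cbnd; last exact: measurable_funTS.
have n0R : 0 < n%:R :> R by rewrite ltr0n.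
apply: (@le_trans _ _ (\int[leb]_(s in `]0%R, t])
    (4 * C ^+ 2 * (kappa * (t / n%:R)))%:E)%E).
  apply: ge0_le_integral => //.
  - by move=> s _; apply: integral_ge0 => w _; rewrite lee_fin.
  - exact: measurable_funTS.
  move=> s /=; rewrite in_itv/= => st.
  have [k /[dup] ks /andP[ks1 ks2]] := grid_locate n0 st.
  have s0 : 0 <= s by have /andP[/ltW] := st.
  under eq_integral do rewrite (max_idPl s0) (step_processE _ ks).
  apply: le_trans (mean_chain_sqr_diff _ _) _.
  - by rewrite grid_ge0 ltW.
  - apply: le_trans th0; rewrite lerBlDr (le_trans ks2)//.
    have := gridS n k => /eqP; rewrite subr_eq => /eqP ->; rewrite lerD2r.
    by rewrite ler_pdivrMr// ler_peMr// ler1n.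
  rewrite lee_fin ler_wpM2l ?mulr_ge0 ?sqr_ge0// ler_wpM2l//.
  by rewrite -(gridS n k) lerD2r.
rewrite integral_cst// /= lebesgue_measure_itv/= lte_fin.
case: ifPn => [_|_]; first by rewrite -EFinD -EFinM subr0.
by rewrite mule0 lee_fin !mulr_ge0 ?sqr_ge0// invr_ge0 ltW.
Qed.

End StepApproximation.

Lemma sum_even_terms (V : nmodType) (F : nat -> V) n :
  (forall m, odd m -> F m = 0) ->
  \sum_(m < n.*2.+1) F m = \sum_(r < n.+1) F r.*2.
Proof.
move=> F0; elim: n => [|n ih]; first by rewrite !big_ord1.
rewrite doubleS 2!big_ord_recr/= ih [RHS]big_ord_recr/=.
by rewrite (F0 n.*2.+1) ?addr0//= odd_double.
Qed.

Section CauchySchwarz.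
Context {d} {T : measurableType d} {R : realType} (P : probability T R).

Lemma mean_mul_sqr_le (U V : T -> R) : all_moments P U -> all_moments P V ->
  (\int[P]_w (U w * V w)) ^+ 2 <= \int[P]_w (U w ^+ 2) * \int[P]_w (V w ^+ 2).
Proof.
move=> UP VP; set a := \int[P]_w (U w ^+ 2); set c := \int[P]_w (V w ^+ 2).
set b := \int[P]_w (U w * V w).
have U2 := all_momentsX 2 UP; have V2 := all_momentsX 2 VP.
have UV := all_momentsM UP VP.
have q l : 0 <= a + 2 * l * b + l ^+ 2 * c.
  have -> : a + 2 * l * b + l ^+ 2 * c = \int[P]_w ((U w + l * V w) ^+ 2).
    have -> : \int[P]_w ((U w + l * V w) ^+ 2) =
        \int[P]_w (U w ^+ 2 + (2 * l * (U w * V w) + l ^+ 2 * V w ^+ 2)).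
      by apply: eq_Rintegral => w _; ring.
    rewrite meanD//; last by apply: all_momentsD; exact: all_momentsZ.
    by rewrite meanD ?meanZ//; [rewrite addrA|exact: all_momentsZ|exact: all_momentsZ].
  by apply: mean_ge0 => w; exact: sqr_ge0.
have a0 : 0 <= a by apply: mean_ge0 => w; exact: sqr_ge0.
have c0 : 0 <= c by apply: mean_ge0 => w; exact: sqr_ge0.
move: c0; rewrite le_eqVlt => /predU1P[c0|c0].
  rewrite -c0 mulr0; have [->|b0] := eqVneq b 0; first by rewrite expr0n.
  (* When the quadratic coefficient is 0, the form is affine in [l]; at this [l] it takes the value
     [-1], so [b] must be 0. *)
  have := q (- (a + 1) / (2 * b)); rewrite -c0 mulr0 addr0.
  have -> : 2 * (- (a + 1) / (2 * b)) * b = - (a + 1) by field.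
  by move=> h; exfalso; lra.
have := q (- b / c).
have -> : a + 2 * (- b / c) * b + (- b / c) ^+ 2 * c = a - b ^+ 2 / c.
  by field; rewrite gt_eqF.
by rewrite subr_ge0 ler_pdivrMr.
Qed.

End CauchySchwarz.

Lemma eq0_of_sqr_le_harmonic (R : realType) (x c : R) :
  (forall n, (0 < n)%N -> x ^+ 2 <= c / n%:R) -> x = 0.
Proof.
move=> h; apply/eqP; rewrite -sqrf_eq0 eq_le sqr_ge0 andbT.
apply/ler_addgt0Pl => e e0; rewrite addr0.
have c0 : 0 <= c by have := h 1%N isT; rewrite divr1; apply: le_trans; exact: sqr_ge0.
apply: le_trans (h (Num.bound (c / e)) _) _.
  by have := archi_boundP (divr_ge0 c0 (ltW e0)); case: (Num.bound _) => //;
    rewrite ltNge divr_ge0// ltW.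
have b0 : 0 < (Num.bound (c / e))%:R :> R.
  exact: le_lt_trans (divr_ge0 c0 (ltW e0)) (archi_boundP (divr_ge0 c0 (ltW e0))).
rewrite ler_pdivrMr// mulrC -ler_pdivrMr//.
by rewrite ltW// archi_boundP// divr_ge0// ltW.
Qed.

Section MomentConstants.
Context {R : realType} (C : R).

(** The recursion comes from the binomial expansion of one more step in a sum of noise terms: only
    even powers of the new increment survive, each paired with a lower moment of the sum. The term
    [r = 0] already contributes [sqrt 2], so the sequence is nondecreasing. *)
Fixpoint step_moment_bound (p : nat) : R :=
  if p is q.+1 then step_moment_bound q *
    \sum_(r < q.+2) ('C(q.+1.*2, r.*2)%:R * (C ^+ r.*2 * normal_moment_bound r))
  else 1.

Let term_ge0 q r : 0 <= 'C(q.+1.*2, r.*2)%:R * (C ^+ r.*2 * normal_moment_bound r) :> R.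
Proof.
rewrite !mulr_ge0// ?normal_moment_bound_ge0// exprn_even_ge0// odd_double//.
Qed.

Lemma step_moment_bound_ge1 p : 1 <= step_moment_bound p.
Proof.
elim: p => //= q ih; rewrite -[leLHS]mulr1; apply: ler_pM => //.
rewrite big_ord_recl/= bin0 mul1r expr0 mul1r /normal_moment_bound !expr0 !mul1r.
rewrite -[leLHS]addr0; apply: lerD; last by apply: sumr_ge0 => i _; exact: term_ge0.
by rewrite -{1}sqrtr1 ler_sqrt// ler1n.
Qed.

Lemma step_moment_bound_ge0 p : 0 <= step_moment_bound p.
Proof. exact: le_trans ler01 (step_moment_bound_ge1 p). Qed.

Lemma step_moment_bound_le p q : (p <= q)%N -> step_moment_bound p <= step_moment_bound q.
Proof.
move=> /subnK <-; elim: (q - p)%N => [|k ih] //=.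
rewrite -[leLHS]mulr1; apply: ler_pM => //; first exact: step_moment_bound_ge0.
rewrite big_ord_recl/= bin0 mul1r expr0 mul1r /normal_moment_bound !expr0 !mul1r.
rewrite -[leLHS]addr0; apply: lerD; last by apply: sumr_ge0 => i _; exact: term_ge0.
by rewrite -{1}sqrtr1 ler_sqrt// ler1n.
Qed.

(** The growth of [k ^ (p + 1)] from [k] to [k + 1] dominates every lower power of [k]. This is what
    lets the binomial terms of positive order be absorbed in an induction on the number of steps. *)
Lemma expr_succ_ge k p r : (0 < r <= p.+1)%N ->
  k%:R ^+ p.+1 + k%:R ^+ (p.+1 - r) <= k.+1%:R ^+ p.+1 :> R.
Proof.
move=> /andP[r0 rp]; have -> : k.+1%:R ^+ p.+1 = k%:R * k.+1%:R ^+ p + k.+1%:R ^+ p :> R.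
  by rewrite exprS -{1}natr1 mulrDl mul1r.
rewrite exprS.
apply: lerD; first by rewrite ler_wpM2l// lerXn2r ?nnegrE// ler_nat.
apply: (@le_trans _ _ (k.+1%:R ^+ (p.+1 - r))).
  by rewrite lerXn2r ?nnegrE// ler_nat.
by apply: ler_weXn2l; [rewrite ler1n|rewrite leq_subLR -add1n leq_add2r].
Qed.

End MomentConstants.

Section ItoMoments.
Context {R : realType} {d J : nat} {dT} {T : measurableType dT}.
Variables (P : probability T R) (X : R -> T -> 'I_d.+1) (B : 'I_J -> R -> T -> R).
Hypothesis noise : driving_noise P X B.
Variables (f : 'I_d.+1 -> R) (C : R).
Hypothesis fC : forall i, `|f i| <= C.
Variables (t h0 : R).
Hypothesis t0 : 0 <= t <= h0.
Variable j : 'I_J.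

Let mX := noise_chain noise.
Let C0 : 0 <= C. Proof. exact: le_trans (normr_ge0 _) (fC ord0). Qed.

Definition step_sum (n k : nat) (w : T) : R :=
  \sum_(l < k) f (X (grid t n l) w) * increment B j (grid t n l) (grid t n l.+1) w.

Definition step_integral (n : nat) : T -> R := step_sum n n.

Lemma step_integralE n : step_integral n =
  family_integral B j (fun k : 'I_n => grid t n k) (fun k : 'I_n => grid t n k.+1)
    (step_coef X f t (n := n)).
Proof. by []. Qed.

Let grid0 n k : 0 <= grid t n k. Proof. exact: grid_ge0 t0 _ _. Qed.
Let gridle n k l : (k <= l)%N -> grid t n k <= grid t n l. Proof. exact: grid_le t0 _ _ _. Qed.

Let coefP n l : all_moments P (fun w => f (X (grid t n l) w)).
Proof.
apply: (@all_moments_bounded _ _ _ _ _ C) => [|w]; last exact: fC.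
by apply: measurable_ord_comp; apply: mX.
Qed.

Lemma step_sum_all_moments n k : all_moments P (step_sum n k).
Proof.
apply: all_moments_sum => l; apply: all_momentsM => //.
by apply: (increment_all_moments noise) => //; exact: gridle.
Qed.

Lemma adapted_step_sum n k a : grid t n k <= a -> adapted (past X B j a) (step_sum n k).
Proof.
move=> ka; apply: adapted_sum => l; apply: adaptedM.
  exact: adapted_chain.
apply: adapted_increment_upto; rewrite grid0/=; apply: le_trans ka; apply: gridle => //.
exact: ltnW.
Qed.

Lemma adapted_step_sum_other n k i a : j != i -> adapted (past X B i a) (step_sum n k).
Proof.
move=> ji; apply: adapted_sum => l; apply: adaptedM.
  exact: adapted_chain.
exact: adapted_increment_other.
Qed.

Lemma step_sumS n k w : step_sum n k.+1 w = step_sum n k w +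
  f (X (grid t n k) w) * increment B j (grid t n k) (grid t n k.+1) w.
Proof. by rewrite /step_sum big_ord_recr. Qed.

(** The sum behaves like Brownian motion at time [k * (t / n)]. The number [k] of terms is separate
    from the mesh so that terms can be added one at a time with the grid fixed. *)
Lemma step_sum_even_moment n p k : \int[P]_w (step_sum n k w ^+ p.*2) <=
  step_moment_bound C p * (k%:R * (t / n%:R)) ^+ p.
Proof.
set dl := t / n%:R.
have dl0 : 0 <= dl by rewrite divr_ge0//; case/andP : t0.
(* Strong induction on the order, because the term with the [2r]-th power of the increment involves
   the moment of order [2(p - r)] of the earlier sum; an induction on [k] runs inside it. *)
elim: p {-2}p (leqnn p) k => [|p ih] [|q]// qp k; try by
  under eq_Rintegral do rewrite expr0; rewrite mean_cst expr0 mulr1.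
move: qp; rewrite ltnS leq_eqVlt => /predU1P[->{q}|qp]; last exact: ih.
elim: k => [|k ihk].
  have -> : \int[P]_w (step_sum n 0 w ^+ p.+1.*2) = 0.
    by under eq_Rintegral do rewrite /step_sum big_ord0 expr0n/=; rewrite mean_cst.
  by rewrite mul0r expr0n mulr0.
pose D := increment B j (grid t n k) (grid t n k.+1).
pose xi w := f (X (grid t n k) w).
have DP : all_moments P D by apply: (increment_all_moments noise) => //; exact: gridle.
have SP := step_sum_all_moments n k.
pose F m := \int[P]_w (step_sum n k w ^+ (p.+1.*2 - m) * xi w ^+ m) *
  \int[P]_w (D w ^+ m) *+ 'C(p.+1.*2, m).
have UP m : all_moments P (fun w => step_sum n k w ^+ (p.+1.*2 - m) * xi w ^+ m).
  by apply: all_momentsM; apply: all_momentsX => //; exact: coefP.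
have FE : \int[P]_w (step_sum n k.+1 w ^+ p.+1.*2) = \sum_(m < p.+1.*2.+1) F m.
  have -> : \int[P]_w (step_sum n k.+1 w ^+ p.+1.*2) =
      \int[P]_w (\sum_(m < p.+1.*2.+1) 'C(p.+1.*2, m)%:R *
        (step_sum n k w ^+ (p.+1.*2 - m) * xi w ^+ m * D w ^+ m)).
    apply: eq_Rintegral => w _; rewrite step_sumS exprDn; apply: eq_bigr => m _.
    by rewrite exprMn mulrA mulr_natl.
  rewrite mean_sum => [|m]; last first.
    by apply: all_momentsZ; apply: all_momentsM => //; exact: all_momentsX.
  apply: eq_bigr => m _; rewrite meanZ; last first.
    by apply: all_momentsM => //; exact: all_momentsX.
  rewrite (increment_mean_mul noise)//; first by rewrite mulr_natl.
  - exact: gridle.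
  - apply: adaptedM; apply: adaptedX; first exact: adapted_step_sum.
    exact: adapted_chain.
rewrite FE sum_even_terms; last first.
  by move=> m om; rewrite /F (increment_mean_odd noise) ?mulr0 ?mul0rn//; exact: gridle.
(* The term of order 0 is the same moment with one step fewer, bounded by the inner induction; the
   others use lower moments. *)
rewrite big_ord_recl.
have F0 : F 0 <= step_moment_bound C p.+1 * (k%:R * dl) ^+ p.+1.
  rewrite /F bin0 mulr1n; under [X in _ * X]eq_Rintegral do rewrite expr0.
  rewrite mean_cst mulr1; under eq_Rintegral do rewrite subn0 expr0 mulr1.
  exact: ihk.
pose c r : R := 'C(p.+1.*2, r.*2)%:R * (C ^+ r.*2 * normal_moment_bound r).
have c0 r : 0 <= c r.
  by rewrite /c !mulr_ge0// ?normal_moment_bound_ge0// exprn_even_ge0// odd_double.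
(* The increment contributes [dl ^+ r.+1] and the earlier sum [(k * dl) ^+ (p - r)]. The remaining
   power of [k] is exchanged for a difference of consecutive powers, in the form in which the
   induction on [k] adds up. *)
have Fr (r : 'I_p.+1) : F r.+1.*2 <= c r.+1 * step_moment_bound C p * dl ^+ p.+1 *
    (k.+1%:R ^+ p.+1 - k%:R ^+ p.+1).
  rewrite /F -[in leLHS]mulr_natl -doubleB subSS.
  set u := Rintegral _ _ _; set v := Rintegral _ _ _.
  have v0 : 0 <= v.
    by apply: mean_ge0 => w; rewrite exprn_even_ge0// odd_double.
  have vle : v <= normal_moment_bound r.+1 * dl ^+ r.+1.
    by rewrite /dl -(gridS t n k); apply: (increment_mean_even_le noise) => //; exact: gridle.
  have u0 : 0 <= u.
    by apply: mean_ge0 => w; rewrite mulr_ge0// exprn_even_ge0// odd_double.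
  have ule : u <= C ^+ r.+1.*2 * (step_moment_bound C p * (k%:R * dl) ^+ (p - r)).
    apply: (@le_trans _ _ (C ^+ r.+1.*2 * \int[P]_w (step_sum n k w ^+ (p - r).*2))).
      rewrite -meanZ; last exact: all_momentsX.
      apply: le_mean.
      - by apply: all_momentsM; apply: all_momentsX => //; exact: coefP.
      - by apply: all_momentsZ; exact: all_momentsX.
      move=> w; rewrite mulrC ler_wpM2r//; first by rewrite exprn_even_ge0// odd_double.
      apply: le_trans (ler_norm _) _; rewrite normrX.
      by rewrite lerXn2r ?nnegrE//; exact: fC.
    rewrite ler_wpM2l ?exprn_ge0//; apply: le_trans (ih _ _ _) _; first exact: leq_subr.
    apply: ler_wpM2r; first by rewrite exprn_ge0// mulr_ge0.
    by apply: step_moment_bound_le; exact: leq_subr.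
  apply: (@le_trans _ _ (c r.+1 * step_moment_bound C p * dl ^+ p.+1 * k%:R ^+ (p - r))).
    have -> : c r.+1 * step_moment_bound C p * dl ^+ p.+1 * k%:R ^+ (p - r) =
        'C(p.+1.*2, r.+1.*2)%:R *
        (C ^+ r.+1.*2 * (step_moment_bound C p * (k%:R * dl) ^+ (p - r)) *
         (normal_moment_bound r.+1 * dl ^+ r.+1)).
      have -> : dl ^+ p.+1 = dl ^+ (p - r) * dl ^+ r.+1.
        by rewrite -exprD addnS subnK// -ltnS.
      rewrite (exprMn _ k%:R dl) /c.
      move: (C ^+ r.+1.*2) (dl ^+ (p - r)) (dl ^+ r.+1) (k%:R ^+ (p - r)).
      move: (normal_moment_bound r.+1) (step_moment_bound C p) => y1 y2 z1 z2 z3 z4.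
      by move: ('C(_, _)%:R) => y3; ring.
    by rewrite ler_wpM2l//; exact: ler_pM.
  apply: ler_wpM2l.
    apply: mulr_ge0; last exact: exprn_ge0.
    by apply: mulr_ge0; [exact: c0|exact: step_moment_bound_ge0].
  have /(expr_succ_ge (R := R) k) : (0 < r.+1 <= p.+1)%N by exact: (ltn_ord r).
  by rewrite subSS lerBrDl.
have dk : k%:R ^+ p.+1 <= k.+1%:R ^+ p.+1 :> R by rewrite lerXn2r ?nnegrE// ler_nat.
apply: (@le_trans _ _ (step_moment_bound C p.+1 * (k%:R * dl) ^+ p.+1 +
    \sum_(r < p.+1) c r.+1 * step_moment_bound C p * dl ^+ p.+1 *
      (k.+1%:R ^+ p.+1 - k%:R ^+ p.+1))).
  by apply: lerD; [exact: F0|apply: ler_sum => r _; exact: Fr].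
rewrite -!mulr_suml (exprMn _ k%:R dl) (exprMn _ k.+1%:R dl).
set A := k%:R ^+ p.+1 in dk *; set A' := k.+1%:R ^+ p.+1 in dk *.
have : (\sum_(r < p.+1) c r.+1) * step_moment_bound C p <= step_moment_bound C p.+1.
  rewrite /= mulrC ler_wpM2l ?step_moment_bound_ge0//.
  by rewrite [leRHS]big_ord_recl/= lerDr; exact: (c0 0%N).
move: (step_moment_bound C p.+1) (\sum_(r < p.+1) c r.+1) => K1 s h.
have : s * step_moment_bound C p * dl ^+ p.+1 * (A' - A) <= K1 * dl ^+ p.+1 * (A' - A).
  by rewrite ler_wpM2r ?subr_ge0// ler_wpM2r// exprn_ge0.
lra.
Qed.

End ItoMoments.

(** The definition sees the integral only through a mean square, so it may be changed on a null set.
    This allows the integral provided with the equation to be replaced by a version built from the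
    path of [M]. *)
Lemma ito_integral_ae {R : realType} {dT} {T : measurableType dT} (P : probability T R)
    (F : R -> set (set T)) (W H : R -> T -> R) (t : R) (Y Y' : T -> R) :
  measurable_fun setT Y' -> (forall s, 0 <= s -> measurable_fun setT (W s)) ->
  (forall s, F s `<=` measurable) ->
  {ae P, forall w, Y' w = Y w} ->
  ito_integral P F W H t Y -> ito_integral P F W H t Y'.
Proof.
move=> mY' mW FM YY' [mY [phi [phiH phiY]]]; split=> //; exists phi; split=> //.
have mint n : measurable_fun setT (el_integral W (phi n)).
  apply: measurable_sum => k; have [/andP[a0 ab] _] := el_itv k.
  apply: measurable_funM; last first.
    by apply: measurable_funB; apply: mW => //; exact: le_trans ab.
  move=> _ A mA; rewrite setTI; apply: (FM _); exact: el_adapted.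
have -> : (fun n => \int[P]_w ((Y' w - el_integral W (phi n) w) ^+ 2)%:E)%E =
    (fun n => \int[P]_w ((Y w - el_integral W (phi n) w) ^+ 2)%:E)%E.
  apply/funext => n; apply: ge0_ae_eq_integral => //.
  - by apply/measurable_EFinP; apply: measurable_funX; exact: measurable_funB.
  - by apply/measurable_EFinP; apply: measurable_funX; exact: measurable_funB.
  - by move=> w _; rewrite lee_fin sqr_ge0.
  - by move=> w _; rewrite lee_fin sqr_ge0.
  - by apply: filterS YY' => w -> _.
exact: phiY.
Qed.

Section ItoFacts.
Context {R : realType} {d J : nat} {dT} {T : measurableType dT}.
Variables (P : probability T R) (X : R -> T -> 'I_d.+1) (B : 'I_J -> R -> T -> R).
Hypothesis noise : driving_noise P X B.
Hypothesis rcX : forall w t, 0 <= t -> \forall s \near t^'+, X s w = X t w.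
Variables (kappa h0 : R).
Hypothesis kappa0 : 0 <= kappa.
Hypothesis exitX : forall s t, 0 <= s <= t -> t - s <= h0 ->
  (P [set w | X s w != X t w] <= (kappa * (t - s))%:E)%E.
Variables (f : 'I_d.+1 -> R) (C : R).
Hypothesis fC : forall i, `|f i| <= C.
Variables (t : R) (j : 'I_J) (Y : T -> R).
Hypothesis t0 : 0 <= t <= h0.
Hypothesis ito : ito_integral P (history X B) (B j) (fun s w => f (X s w)) t Y.

Let mX := noise_chain noise.
Let C0 : 0 <= C. Proof. exact: le_trans (normr_ge0 _) (fC ord0). Qed.
Let S n := step_integral X B f t j n.
Let SP n : all_moments P (S n).
Proof. exact: (step_sum_all_moments noise fC t0). Qed.
Let mY : measurable_fun setT Y. Proof. by case: ito. Qed.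

(** The constant 16 is 4 from the comparison of integrals times 4 from the squared oscillation of
    [f]. *)
Lemma ito_step_error n : (0 < n)%N ->
  (\int[P]_w ((Y w - S n w) ^+ 2)%:E <= (16 * C ^+ 2 * kappa * t ^+ 2 / n%:R)%:E)%E.
Proof.
move=> n0; have /andP[tge0 th0] := t0.
(* On [[0, t]] the integrand is unchanged; written with the positive part of the time it becomes
   jointly measurable on the whole line. *)
have ito' : ito_integral P (history X B) (B j) (fun s w => f (X (Num.max s 0) w)) t Y.
  have [_ [phi [phiH phiY]]] := ito; split=> //; exists phi; split=> //.
  have -> : (fun n => \int[P]_w \int[lebesgue_measure]_(s in `[0%R, t])
       ((f (X (Num.max s 0) w) - el_process (phi n) s w) ^+ 2)%:E)%E =
      (fun n => \int[P]_w \int[lebesgue_measure]_(s in `[0%R, t])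
       ((f (X s w) - el_process (phi n) s w) ^+ 2)%:E)%E.
    apply/funext => m; apply: eq_integral => w _; apply: eq_integral => s.
    by rewrite inE /= in_itv/= => /andP[s0 _]; rewrite (max_idPl s0).
  exact: phiH.
rewrite /S step_integralE.
apply: le_trans (ito_integral_sub_family_le noise _ ito' _ _ _ _) _.
- exact: chain_jointly_measurable noise rcX f.
- by move=> k; rewrite (grid_ge0 t0)/=; exact: (grid_le t0).
- by move=> k; rewrite -[leRHS](grid_end t n0); apply: (grid_le t0).
- by move=> k; apply: adapted_chain; exact: (grid_ge0 t0).
- move=> k; apply: (@all_moments_bounded _ _ _ _ _ C) => [|w]; last exact: fC.
  by apply: measurable_ord_comp; apply: mX; exact: (grid_ge0 t0).
apply: (@le_trans _ _ (4%:E * (4 * C ^+ 2 * (kappa * (t / n%:R)) * t)%:E)%E).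
  apply: lee_wpmul2l => //.
  exact: (step_process_error noise rcX kappa0 exitX fC t0 n0).
rewrite -EFinM lee_fin le_eqVlt; apply/orP; left; apply/eqP; ring.
Qed.

(** The factor [4 ^+ p] is [2 ^+ p.*2], the cost of splitting an even power of a sum into the powers
    of its terms. *)
Definition ito_moment_bound p : R := 4 ^+ p * step_moment_bound C p.

Lemma ito_moment_bound_ge0 p : 0 <= ito_moment_bound p.
Proof. by rewrite mulr_ge0 ?exprn_ge0// step_moment_bound_ge0. Qed.

(** With [|Y|] truncated at [L], the excess over the step sum is also at most [L], so its power is
    at most [L ^ (2p - 2)] times its square and vanishes with the mesh for fixed [L]. The bound left
    is uniform in [L], and monotone convergence removes the truncation. *)
Lemma ito_even_moment p :
  (\int[P]_w (Y w ^+ p.*2)%:E <= (ito_moment_bound p * t ^+ p)%:E)%E.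
Proof.
have /andP[tge0 th0] := t0.
case: p => [|p].
  under eq_integral do rewrite expr0.
  rewrite integral_cst//= probability_setT mule1 lee_fin /ito_moment_bound.
  by rewrite !expr0 mulr1 mul1r.
pose g (L : nat) w := Num.min `|Y w| L%:R ^+ p.+1.*2.
have g0 L w : 0 <= g L w by rewrite /g exprn_even_ge0// odd_double.
have mg L : measurable_fun setT (g L).
  apply: measurable_funX; apply: measurable_minr => //.
  exact: measurableT_comp.
have key L : (\int[P]_w (g L w)%:E <= (ito_moment_bound p.+1 * t ^+ p.+1)%:E)%E.
  apply/lee_addgt0Pr => e e0.
  (* The mesh is chosen after the level [L]: the error term is [c / n], and [n] makes it at most
     [e]. *)
  pose c := 4 ^+ p.+1 * L%:R ^+ p.*2 * (16 * C ^+ 2 * kappa * t ^+ 2).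
  have c0 : 0 <= c by rewrite /c !mulr_ge0// ?exprn_ge0// sqr_ge0.
  pose n := (Num.bound (c / e)).+1.
  have n0 : (0 < n)%N by [].
  have cn : c / n%:R <= e.
    rewrite ler_pdivrMr ?ltr0n// mulrC -ler_pdivrMr//.
    rewrite (@le_trans _ _ (Num.bound (c / e))%:R) ?ler_nat//.
    by rewrite ltW// archi_boundP// divr_ge0// ltW.
  have gle w : g L w <= 4 ^+ p.+1 * S n w ^+ p.+1.*2 +
      4 ^+ p.+1 * L%:R ^+ p.*2 * (Y w - S n w) ^+ 2.
    pose a := S n w; pose b := Num.min `|Y w - S n w| L%:R.
    have b0 : 0 <= b by rewrite le_min normr_ge0 ler0n.
    have minab : Num.min `|Y w| L%:R <= `|a| + `|b|.
      rewrite (ger0_norm b0) /b; case: (leP `|Y w - S n w| L%:R) => h.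
        rewrite ge_min; apply/orP; left.
        by have := ler_normD a (Y w - S n w); rewrite addrC subrK.
      by rewrite ge_min; apply/orP; right; rewrite lerDr.
    have m0 : 0 <= Num.min `|Y w| L%:R by rewrite le_min normr_ge0 ler0n.
    apply: (@le_trans _ _ ((`|a| + `|b|) ^+ p.+1.*2)).
      by rewrite /g lerXn2r// nnegrE// addr_ge0.
    have := normr_exp2D `|a| `|b| p.+1.*2.
    rewrite !normr_id (ger0_norm (addr_ge0 (normr_ge0 a) (normr_ge0 b))).
    move/le_trans; apply.
    have -> : 2 ^+ p.+1.*2 = 4 ^+ p.+1 :> R.
      by rewrite -mul2n exprM; congr (_ ^+ _); ring.
    rewrite mulrDr; apply: lerD.
      rewrite ler_wpM2l ?exprn_ge0// le_eqVlt; apply/orP; left; apply/eqP.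
      by rewrite -normrX ger0_norm// exprn_even_ge0// odd_double.
    rewrite -mulrA ler_wpM2l ?exprn_ge0// (ger0_norm b0) doubleS -addn2 exprD.
    apply: ler_pM; rewrite ?exprn_ge0//.
      by rewrite lerXn2r ?nnegrE// /b ge_min lexx orbT.
    rewrite -[leRHS]real_normK ?num_real// lerXn2r ?nnegrE//.
    by rewrite /b ge_min lexx.
  apply: (@le_trans _ _ (\int[P]_w ((4 ^+ p.+1)%:E * (S n w ^+ p.+1.*2)%:E +
      (4 ^+ p.+1 * L%:R ^+ p.*2)%:E * ((Y w - S n w) ^+ 2)%:E))%E).
    apply: ge0_le_integral => //.
    - by move=> w _; rewrite lee_fin.
    - exact/measurable_EFinP.
    - apply: emeasurable_funD; apply: emeasurable_funM => //; apply/measurable_EFinP.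
        by apply: measurable_funX; exact: all_moments_measurable (SP n).
      apply: measurable_funX; apply: measurable_funB => //.
      exact: all_moments_measurable (SP n).
    - by move=> w _; rewrite -!EFinM -EFinD lee_fin.
  have mS2 : measurable_fun setT (fun w => ((Y w - S n w) ^+ 2)%:E).
    apply/measurable_EFinP; apply: measurable_funX; apply: measurable_funB => //.
    exact: all_moments_measurable (SP n).
  have mS1 : measurable_fun setT (fun w => (S n w ^+ p.+1.*2)%:E).
    by apply/measurable_EFinP; apply: measurable_funX; exact: all_moments_measurable (SP n).
  have S0 w : 0 <= S n w ^+ p.+1.*2 by rewrite exprn_even_ge0// odd_double.
  have k0 : 0 <= 4 ^+ p.+1 * L%:R ^+ p.*2 :> R by rewrite mulr_ge0 ?exprn_ge0.
  rewrite ge0_integralD//; last 4 first.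
  - by move=> w _; rewrite -EFinM lee_fin; apply: mulr_ge0; [exact: exprn_ge0|exact: S0].
  - exact: emeasurable_funM.
  - by move=> w _; rewrite -EFinM lee_fin; apply: mulr_ge0; [exact: k0|exact: sqr_ge0].
  - exact: emeasurable_funM.
  have sq0 w : (0 <= ((Y w - S n w) ^+ 2)%:E)%E by rewrite lee_fin sqr_ge0.
  rewrite !ge0_integralZl//; last by move=> w _; rewrite lee_fin; exact: S0.
  apply: leeD.
    rewrite (all_moments_integral (all_momentsX _ (SP n))) -EFinM lee_fin.
    rewrite /ito_moment_bound -mulrA ler_wpM2l ?exprn_ge0//.
    apply: le_trans (step_sum_even_moment noise fC t0 j n p.+1 n) _.
    by rewrite mulrCA mulfV ?pnatr_eq0// mulr1.
  apply: (@le_trans _ _ ((4 ^+ p.+1 * L%:R ^+ p.*2)%:E *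
      (16 * C ^+ 2 * kappa * t ^+ 2 / n%:R)%:E)%E).
    by apply: lee_wpmul2l; rewrite ?lee_fin//; exact: ito_step_error.
  by rewrite -EFinM lee_fin mulrA.
have -> : (\int[P]_w (Y w ^+ p.+1.*2)%:E = limn (fun L => \int[P]_w (g L w)%:E))%E.
  rewrite -monotone_convergence//.
  - apply: eq_integral => w _; apply/esym/cvg_lim => //; apply: cvg_near_cst.
    near=> L; congr EFin; rewrite /g (min_idPl _).
      by rewrite -normrX ger0_norm// exprn_even_ge0// odd_double.
    by near: L; exact: nbhs_infty_ger.
  - by move=> L; exact/measurable_EFinP.
  - by move=> L w _; rewrite lee_fin.
  - move=> w _ L L' LL'; rewrite lee_fin /g lerXn2r ?nnegrE ?le_min ?normr_ge0 ?ler0n//.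
    by rewrite !ge_min lexx/= ler_nat LL' orbT.
apply: lime_le.
  apply: ereal_nondecreasing_is_cvgn => L L' LL'; apply: ge0_le_integral => //.
  - by move=> w _; rewrite lee_fin.
  - exact/measurable_EFinP.
  - exact/measurable_EFinP.
  - move=> w _; rewrite lee_fin /g lerXn2r ?nnegrE ?le_min ?normr_ge0 ?ler0n//.
    by rewrite !ge_min lexx/= ler_nat LL' orbT.
by apply: nearW => L; exact: key.
Unshelve. all: by end_near. Qed.

Lemma ito_all_moments : all_moments P Y.
Proof. by apply: all_moments_even => // p; apply: le_lt_trans (ito_even_moment p) (ltry _). Qed.

Lemma ito_step_mean_error n : (0 < n)%N ->
  \int[P]_w ((Y w - S n w) ^+ 2) <= 16 * C ^+ 2 * kappa * t ^+ 2 / n%:R.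
Proof.
move=> n0; rewrite -lee_fin -all_moments_integral; first exact: ito_step_error.
by apply: all_momentsX; apply: all_momentsB => //; exact: ito_all_moments.
Qed.

(** By the Cauchy-Schwarz inequality the square of the difference is at most a constant over [n]. A
    mean that is constant along the grid sums is thus also the mean for the Ito integral. *)
Lemma ito_step_mean_cvg (U : T -> R) (x : R) : all_moments P U ->
  (forall n, \int[P]_w (U w * S n w) = x) -> \int[P]_w (U w * Y w) = x.
Proof.
move=> UP Ux; apply/eqP; rewrite -subr_eq0; apply/eqP.
have YP := ito_all_moments.
apply: (@eq0_of_sqr_le_harmonic _ _
  (\int[P]_w (U w ^+ 2) * (16 * C ^+ 2 * kappa * t ^+ 2))) => n n0.
rewrite -(Ux n) -meanB//; [|exact: all_momentsM|exact: all_momentsM].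
rewrite [X in X ^+ 2](_ : _ = \int[P]_w (U w * (Y w - S n w))); last first.
  by apply: eq_Rintegral => w _; rewrite mulrBr.
apply: le_trans (mean_mul_sqr_le UP (all_momentsB YP (SP n))) _.
rewrite -[leRHS]mulrA; apply: ler_wpM2l; first by apply: mean_ge0 => w; exact: sqr_ge0.
exact: ito_step_mean_error.
Qed.

(** Adaptedness to [past X B j 0] is a weak demand: it allows functions of the entire chain,
    including its state at the final time, and of all the other Brownian motions. *)
Lemma ito_mean_mul0 (U : T -> R) : all_moments P U -> adapted (past X B j 0) U ->
  \int[P]_w (U w * Y w) = 0.
Proof.
move=> UP aU; apply: ito_step_mean_cvg => // n.
under eq_Rintegral do rewrite mulr_sumr.
have xiP (k : 'I_n) : all_moments P (fun w => U w * f (X (grid t n k) w)).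
  apply: all_momentsM => //.
  apply: (@all_moments_bounded _ _ _ _ _ C) => [|w]; last exact: fC.
  by apply: measurable_ord_comp; apply: mX; exact: (grid_ge0 t0).
have iP (k : 'I_n) : all_moments P (increment B j (grid t n k) (grid t n k.+1)).
  by apply: (increment_all_moments noise); [exact: (grid_ge0 t0)|exact: (grid_le t0)].
rewrite mean_sum => [|k]; last first.
  have := all_momentsM (xiP k) (iP k).
  by congr (all_moments P _); apply/funext => w; rewrite mulrA.
apply: big1 => k _.
under eq_Rintegral do rewrite mulrA.
apply: (increment_mean_mul0 noise) => //; [exact: (grid_ge0 t0)|exact: (grid_le t0)|].
apply: adaptedM; last by apply: adapted_chain; exact: (grid_ge0 t0).
by apply: adapted_past_nondecreasing aU; exact: (grid_ge0 t0).
Qed.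

End ItoFacts.

Section ItoSecondMoment.
Context {R : realType} {d J : nat} {dT} {T : measurableType dT}.
Variables (P : probability T R) (X : R -> T -> 'I_d.+1) (B : 'I_J -> R -> T -> R).
Hypothesis noise : driving_noise P X B.
Hypothesis rcX : forall w t, 0 <= t -> \forall s \near t^'+, X s w = X t w.
Variables (kappa h0 : R).
Hypothesis kappa0 : 0 <= kappa.
Hypothesis exitX : forall s t, 0 <= s <= t -> t - s <= h0 ->
  (P [set w | X s w != X t w] <= (kappa * (t - s))%:E)%E.
Variable i0 : 'I_d.+1.
Hypothesis startX : {ae P, forall w, X 0 w = i0}.

Let mX := noise_chain noise.

Lemma chain_all_moments (g : 'I_d.+1 -> R) s : 0 <= s ->
  all_moments P (fun w => g (X s w)).
Proof.
move=> s0; apply: (@all_moments_bounded _ _ _ _ _ (\sum_i `|g i|)) => [|w].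
  by apply: measurable_ord_comp; exact: mX.
by rewrite (bigD1 (X s w))//= lerDl sumr_ge0.
Qed.

Lemma exit_mean s : 0 <= s <= h0 -> \int[P]_w ((X s w != i0)%:R : R) <= kappa * s.
Proof.
move=> /andP[s0 sh].
have mS : measurable [set w | X 0 w != X s w].
  by apply: measurable_ord_neq; exact: mX.
have -> : \int[P]_w ((X s w != i0)%:R : R) =
    \int[P]_w (\1_[set w | X 0 w != X s w] w : R).
  apply: eq_mean_ae.
  - by apply: (measurable_ord_comp (fun i => (i != i0)%:R)); exact: mX.
  - exact: measurable_indic.
  apply: filterS startX => w Xw; rewrite indicE; congr (_%:R).
  have -> : (w \in [set w | X 0 w != X s w]) = (X 0 w != X s w).
    by apply/idP/idP; rewrite inE.
  by rewrite Xw eq_sym.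
rewrite mean_indic//; have := exitX (s := 0) (t := s).
rewrite lexx s0 subr0 => /(_ isT sh) h.
by rewrite -lee_fin fineK ?fin_num_measure.
Qed.

Variables (f : 'I_d.+1 -> R) (C : R).
Hypothesis fC : forall i, `|f i| <= C.
Variables (t : R) (j : 'I_J) (Y : T -> R).
Hypothesis t0 : 0 <= t <= h0.
Hypothesis ito : ito_integral P (history X B) (B j) (fun s w => f (X s w)) t Y.

Let S n := step_integral X B f t j n.
Let SP n : all_moments P (S n).
Proof. exact: (step_sum_all_moments noise fC t0). Qed.
Let tge0 : 0 <= t. Proof. by case/andP : t0. Qed.
Let C0 : 0 <= C. Proof. exact: le_trans (normr_ge0 _) (fC ord0). Qed.

(** Adding a step gives a cross term, linear in the new increment and hence of mean 0, and a square
    that factors off the variance [t / n]. The weight [U] is known before every increment of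
    [B j]. *)
Lemma step_mean_mul_sqr (U : T -> R) n k : all_moments P U ->
  adapted (past X B j 0) U ->
  \int[P]_w (U w * step_sum X B f t j n k w ^+ 2) =
  \sum_(l < k) \int[P]_w (U w * f (X (grid t n l) w) ^+ 2) * (t / n%:R).
Proof.
move=> UP aU; elim: k => [|k ih].
  rewrite big_ord0; under eq_Rintegral do rewrite /step_sum big_ord0 expr0n mulr0.
  exact: mean_cst.
rewrite big_ord_recr/= -ih.
pose D := increment B j (grid t n k) (grid t n k.+1).
pose xi w := f (X (grid t n k) w).
pose s := step_sum X B f t j n k.
have gk : 0 <= grid t n k by exact: (grid_ge0 t0).
have gkk : grid t n k <= grid t n k.+1 by exact: (grid_le t0).
have DP : all_moments P D by exact: (increment_all_moments noise).
have xiP : all_moments P xi by exact: chain_all_moments.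
have sP : all_moments P s by exact: (step_sum_all_moments noise fC t0).
have E w : U w * step_sum X B f t j n k.+1 w ^+ 2 = U w * s w ^+ 2 +
    (2 * (U w * (s w * xi w) * D w) + U w * xi w ^+ 2 * D w ^+ 2).
  by rewrite step_sumS -/(s w) -/(xi w) -/(D w); ring.
under eq_Rintegral do rewrite E.
have P1 : all_moments P (fun w => U w * s w ^+ 2).
  by apply: all_momentsM => //; exact: all_momentsX.
have P2 : all_moments P (fun w => U w * (s w * xi w)).
  by do !apply: all_momentsM.
have P3 : all_moments P (fun w => U w * xi w ^+ 2).
  by apply: all_momentsM => //; exact: all_momentsX.
have P4 := all_momentsZ 2 (all_momentsM P2 DP).
have P5 := all_momentsM P3 (all_momentsX 2 DP).
rewrite (meanD P1 (all_momentsD P4 P5)) (meanD P4 P5); congr (_ + _).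
have aUk : adapted (past X B j (grid t n k)) U by exact: adapted_past_nondecreasing aU.
have axi : adapted (past X B j (grid t n k)) xi by exact: adapted_chain.
have as_ : adapted (past X B j (grid t n k)) s by exact: (adapted_step_sum f t0).
rewrite (meanZ 2 (all_momentsM P2 DP)) (increment_mean_mul0 noise)//; last first.
  by apply: adaptedM => //; exact: adaptedM.
rewrite mulr0 add0r (increment_mean_mul noise)//; last first.
  by apply: adaptedM => //; exact: adaptedX.
by rewrite (increment_mean_sqr noise)// gridS.
Qed.

(** On the grid, replacing both the state at the grid time and the state at time [t] by [i0] costs
    [C ^+ 2] times two exit probabilities, each at most [kappa * t]; the cell lengths add up to the
    last factor [t]. The bound then passes to the Ito integral. *)
Lemma ito_mean_sqr_le i :
  `|\int[P]_w ((X t w == i)%:R * Y w ^+ 2) - (i0 == i)%:R * f i0 ^+ 2 * t| <=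
  2 * C ^+ 2 * kappa * t ^+ 2.
Proof.
pose U w : R := (X t w == i)%:R.
have UP : all_moments P U by exact: (chain_all_moments (fun x => (x == i)%:R)).
have aU : adapted (past X B j 0) U by exact: (@adapted_chain _ _ _ _ _ X B j 0 t (fun x => (x == i)%:R)).
have YP := ito_all_moments noise rcX kappa0 exitX fC t0 ito.
pose z := (i0 == i)%:R * f i0 ^+ 2 : R.
have f2 x : 0 <= f x ^+ 2 <= C ^+ 2.
  by rewrite sqr_ge0/= -real_normK ?num_real// lerXn2r ?nnegrE.
have term n (k : 'I_n) : (0 < n)%N ->
    `|\int[P]_w (U w * f (X (grid t n k) w) ^+ 2) - z| <= 2 * C ^+ 2 * kappa * t.
  move=> n0; have gk : 0 <= grid t n k by exact: (grid_ge0 t0).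
  have gt : grid t n k <= t by rewrite -{2}(grid_end t n0); apply: (grid_le t0); exact: ltnW.
  have fP : all_moments P (fun w => f (X (grid t n k) w) ^+ 2).
    exact/all_momentsX/chain_all_moments.
  have e1P s : 0 <= s -> all_moments P (fun w => (X s w != i0)%:R).
    exact: (chain_all_moments (fun x => (x != i0)%:R)).
  rewrite -(mean_cst P z) -meanB; [|exact: all_momentsM|exact: all_moments_cst].
  apply: (@le_trans _ _ (\int[P]_w (C ^+ 2 * ((X t w != i0)%:R + (X (grid t n k) w != i0)%:R)))).
    apply: normr_mean_le.
    - by apply: all_momentsB; [exact: all_momentsM|exact: all_moments_cst].
    - by apply: all_momentsZ; apply: all_momentsD; exact: e1P.
    move=> w; rewrite /U /z.
    have [-> /=|ht] := eqVneq (X t w) i0; last first.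
      have /andP[? ?] := f2 (X (grid t n k) w); have /andP[? ?] := f2 i0.
      rewrite ler_norml; case: (X t w == i); case: (i0 == i); case: (_ != i0) => /=; nra.
    have [-> /=|hs] := eqVneq (X (grid t n k) w) i0.
      by rewrite subrr normr0 addr0 mulr0.
    have /andP[? ?] := f2 (X (grid t n k) w); have /andP[? ?] := f2 i0.
    by rewrite ler_norml; case: (i0 == i) => /=; nra.
  rewrite meanZ; last by apply: all_momentsD; exact: e1P.
  rewrite meanD; [|exact: e1P|exact: e1P].
  have h1 := exit_mean t0.
  have h2 : \int[P]_w ((X (grid t n k) w != i0)%:R : R) <= kappa * t.
    apply: le_trans (exit_mean _) _.
      by rewrite gk (le_trans gt)//; case/andP : t0.
    exact: ler_wpM2l.
  have -> : 2 * C ^+ 2 * kappa * t = C ^+ 2 * (kappa * t + kappa * t) by ring.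
  by apply: ler_wpM2l; [exact: sqr_ge0|exact: lerD].
have Sbound n : (0 < n)%N ->
    `|\int[P]_w (U w * S n w ^+ 2) - z * t| <= 2 * C ^+ 2 * kappa * t ^+ 2.
  move=> n0; have n0R : 0 < n%:R :> R by rewrite ltr0n.
  rewrite /S /step_integral step_mean_mul_sqr//.
  have -> : z * t = \sum_(l < n) z * (t / n%:R).
    rewrite sumr_const card_ord -mulr_natl; field; rewrite gt_eqF//.
  rewrite -sumrB; apply: le_trans (ler_norm_sum _ _ _) _.
  have -> : 2 * C ^+ 2 * kappa * t ^+ 2 =
      \sum_(l < n) (2 * C ^+ 2 * kappa * t) * (t / n%:R).
    rewrite sumr_const card_ord -mulr_natl; field; rewrite gt_eqF//.
  apply: ler_sum => l _; rewrite -mulrBl normrM (ger0_norm (divr_ge0 tge0 (ltW n0R))).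
  by apply: ler_wpM2r; [rewrite divr_ge0// ltW|exact: term].
(* Arguing by contradiction makes the excess over the bound positive, so its square can be compared
   with the squared error of the grid sums. *)
set a := \int[P]_w _; rewrite -/z leNgt; apply/negP => Da.
pose D := 2 * C ^+ 2 * kappa * t ^+ 2.
(* From [Y ^+ 2 - S ^+ 2 = (Y + S) * (Y - S)]: the first factor bounds the mean square of the sum,
   the second is [n] times the mean square error. *)
pose K := (2 * (ito_moment_bound C 1 * t) + 2 * (step_moment_bound C 1 * t)) *
  (16 * C ^+ 2 * kappa * t ^+ 2).
suff : `|a - z * t| - D = 0 by rewrite /D in Da *; lra.
apply: (@eq0_of_sqr_le_harmonic _ _ K) => n n0.
have Y2 := all_momentsX 2 YP; have S2 := all_momentsX 2 (SP n).
have YSP := all_momentsD YP (SP n); have YmSP := all_momentsB YP (SP n).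
have dle : `|a - z * t| - D <= `|a - \int[P]_w (U w * S n w ^+ 2)|.
  rewrite lerBlDr; apply: le_trans (lerD (lexx _) (Sbound n n0)).
  by rewrite -[X in `|X|](_ : (a - \int[P]_w (U w * S n w ^+ 2)) +
    (\int[P]_w (U w * S n w ^+ 2) - z * t) = _) ?ler_normD//; ring.
apply: (@le_trans _ _ ((a - \int[P]_w (U w * S n w ^+ 2)) ^+ 2)).
  rewrite -[leRHS]real_normK ?num_real// lerXn2r ?nnegrE// subr_ge0; exact: ltW.
rewrite /a -meanB; [|exact: all_momentsM|exact: all_momentsM].
rewrite [X in X ^+ 2](_ : _ = \int[P]_w (U w * (Y w + S n w) * (Y w - S n w))); last first.
  by apply: eq_Rintegral => w _; ring.
apply: le_trans (mean_mul_sqr_le (all_momentsM UP YSP) YmSP) _.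
rewrite /K -[leRHS]mulrA; apply: ler_pM.
- by apply: mean_ge0 => w; exact: sqr_ge0.
- by apply: mean_ge0 => w; exact: sqr_ge0.
- apply: (@le_trans _ _ (\int[P]_w (2 * Y w ^+ 2 + 2 * S n w ^+ 2))).
    apply: le_mean.
    + exact/all_momentsX/all_momentsM.
    + by apply: all_momentsD; exact: all_momentsZ.
    move=> w; rewrite /U; case: (X t w == i).
      by rewrite mul1r; have := sqr_ge0 (Y w - S n w); nra.
    by rewrite mul0r expr0n/= addr_ge0// mulr_ge0// sqr_ge0.
  rewrite meanD ?meanZ//; [|exact: all_momentsZ|exact: all_momentsZ].
  apply: lerD; apply: ler_wpM2l => //.
    have := ito_even_moment noise rcX kappa0 exitX fC t0 ito 1.
    by rewrite (all_moments_integral Y2) lee_fin expr1.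
  have := step_sum_even_moment noise fC t0 j n 1 n.
  have -> : n%:R * (t / n%:R) = t by rewrite mulrCA mulfV ?mulr1// pnatr_eq0 -lt0n.
  by rewrite expr1.
exact: (ito_step_mean_error noise rcX kappa0 exitX fC t0 ito n0).
Qed.

End ItoSecondMoment.

Section ItoCross.
Context {R : realType} {d J : nat} {dT} {T : measurableType dT}.
Variables (P : probability T R) (X : R -> T -> 'I_d.+1) (B : 'I_J -> R -> T -> R).
Hypothesis noise : driving_noise P X B.
Hypothesis rcX : forall w t, 0 <= t -> \forall s \near t^'+, X s w = X t w.
Variables (kappa h0 : R).
Hypothesis kappa0 : 0 <= kappa.
Hypothesis exitX : forall s t, 0 <= s <= t -> t - s <= h0 ->
  (P [set w | X s w != X t w] <= (kappa * (t - s))%:E)%E.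
Variables (f f' : 'I_d.+1 -> R) (C : R).
Hypothesis fC : forall i, `|f i| <= C.
Hypothesis fC' : forall i, `|f' i| <= C.
Variables (t : R) (j l : 'I_J) (Y Y' : T -> R).
Hypothesis t0 : 0 <= t <= h0.
Hypothesis jl : j != l.
Hypothesis ito : ito_integral P (history X B) (B j) (fun s w => f (X s w)) t Y.
Hypothesis ito' : ito_integral P (history X B) (B l) (fun s w => f' (X s w)) t Y'.

(** Only one of the two integrals is replaced by grid sums. Those sums are driven by [B l], so
    together with the chain they are known to the past of [B j] at time 0, and the other integral
    has mean 0 against them. *)
Lemma ito_mean_cross (g : 'I_d.+1 -> R) : \int[P]_w (g (X t w) * Y w * Y' w) = 0.
Proof.
have tge0 : 0 <= t by case/andP : t0.
have YP := ito_all_moments noise rcX kappa0 exitX fC t0 ito.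
have gP : all_moments P (fun w => g (X t w)) by exact: (chain_all_moments noise).
apply: (ito_step_mean_cvg noise rcX kappa0 exitX fC' t0 ito').
  exact: all_momentsM.
move=> n; set S := step_integral _ _ _ _ _ _.
have SP : all_moments P S by exact: (step_sum_all_moments noise fC' t0).
have -> : \int[P]_w (g (X t w) * Y w * S w) = \int[P]_w (g (X t w) * S w * Y w).
  by apply: eq_Rintegral => w _; rewrite mulrAC.
apply: (ito_mean_mul0 noise rcX kappa0 exitX fC t0 ito).
  exact: all_momentsM.
apply: adaptedM; first exact: adapted_chain.
by apply: (adapted_step_sum_other f' t0); rewrite eq_sym.
Qed.

End ItoCross.

(** * Pathwise bounds for a linear drift *)

Section BoundedOn.
Context {R : realType}.
Notation leb := (@lebesgue_measure R).
Implicit Types (g h : R -> R) (t u : R).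

(** The paths met below are bounded on compact intervals, and this class is closed under products;
    it makes linearity of the time integral available without separate integrability arguments. *)
Definition bounded_on t g : Prop :=
  measurable_fun setT g /\ exists L, forall s, 0 <= s <= t -> `|g s| <= L.

Lemma bounded_on_cst t c : bounded_on t (fun=> c).
Proof. by split; [exact: measurable_cst|exists `|c|]. Qed.

Lemma bounded_onD t g h : bounded_on t g -> bounded_on t h ->
  bounded_on t (fun s => g s + h s).
Proof.
move=> [mg [L gL]] [mh [L' hL]]; split; first exact: measurable_funD.
by exists (L + L') => s st; rewrite (le_trans (ler_normD _ _))// lerD ?gL ?hL.
Qed.

Lemma bounded_onN t g : bounded_on t g -> bounded_on t (fun s => - g s).
Proof.
move=> [mg [L gL]]; split; first exact: measurable_funN.
by exists L => s st; rewrite normrN gL.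
Qed.

Lemma bounded_onB t g h : bounded_on t g -> bounded_on t h ->
  bounded_on t (fun s => g s - h s).
Proof. by move=> gt ht; apply: bounded_onD => //; exact: bounded_onN. Qed.

Lemma bounded_onM t g h : bounded_on t g -> bounded_on t h ->
  bounded_on t (fun s => g s * h s).
Proof.
move=> [mg [L gL]] [mh [L' hL]]; split; first exact: measurable_funM.
by exists (L * L') => s st; rewrite normrM ler_pM ?gL ?hL.
Qed.

Lemma bounded_onX t g n : bounded_on t g -> bounded_on t (fun s => g s ^+ n).
Proof.
move=> gt; elim: n => [|n ih].
  by under eq_fun do rewrite expr0; exact: bounded_on_cst.
by under eq_fun do rewrite exprS; exact: bounded_onM.
Qed.

Lemma bounded_on_norm t g : bounded_on t g -> bounded_on t (fun s => `|g s|).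
Proof.
move=> [mg [L gL]]; split; first exact: measurableT_comp.
by exists L => s st; rewrite normr_id gL.
Qed.

Lemma bounded_on_le t u g : u <= t -> bounded_on t g -> bounded_on u g.
Proof.
move=> ut [mg [L gL]]; split=> //; exists L => s /andP[s0 su].
by apply: gL; rewrite s0 (le_trans su).
Qed.

Lemma bounded_on_integrable t g : bounded_on t g ->
  leb.-integrable `[0, t] (EFin \o g).
Proof.
move=> [mg [L gL]].
have cL : leb.-integrable `[0, t] (cst L%:E).
  apply/integrableP; split; first exact: measurable_cst.
  rewrite /= integral_cst//= lebesgue_measure_itv/= lte_fin.
  by case: ifPn => _; rewrite ?mule0 ?ltry// -EFinD -EFinM ltry.
apply: le_integrable cL => //.
  by apply/measurable_EFinP; exact: measurable_funTS.
move=> s /=; rewrite in_itv/= => st; rewrite lee_fin.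
exact: le_trans (gL s st) (ler_norm _).
Qed.

Lemma time_integralD t g h : bounded_on t g -> bounded_on t h ->
  \int[leb]_(s in `[0, t]) (g s + h s) =
  \int[leb]_(s in `[0, t]) g s + \int[leb]_(s in `[0, t]) h s.
Proof. by move=> gt ht; rewrite RintegralD//; exact: bounded_on_integrable. Qed.

Lemma time_integralB t g h : bounded_on t g -> bounded_on t h ->
  \int[leb]_(s in `[0, t]) (g s - h s) =
  \int[leb]_(s in `[0, t]) g s - \int[leb]_(s in `[0, t]) h s.
Proof. by move=> gt ht; rewrite RintegralB//; exact: bounded_on_integrable. Qed.

Lemma time_integralZ t c g : bounded_on t g ->
  \int[leb]_(s in `[0, t]) (c * g s) = c * \int[leb]_(s in `[0, t]) g s.
Proof. by move=> gt; rewrite RintegralZl//; exact: bounded_on_integrable. Qed.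

Lemma time_integral_cst t c : 0 <= t -> \int[leb]_(s in `[0, t]) c = c * t.
Proof.
move=> t0; rewrite Rintegral_cst//= lebesgue_measure_itv/= lte_fin.
case: ltgtP t0 => // [t0|<-] _; first by rewrite -EFinD/= subr0.
by rewrite mulr0.
Qed.

Lemma le_time_integral t g h : bounded_on t g -> bounded_on t h ->
  (forall s, 0 <= s <= t -> g s <= h s) ->
  \int[leb]_(s in `[0, t]) g s <= \int[leb]_(s in `[0, t]) h s.
Proof.
move=> gt ht gh; apply: le_Rintegral => //; try exact: bounded_on_integrable.
Qed.

Lemma normr_time_integral_le t g h : bounded_on t g -> bounded_on t h ->
  (forall s, 0 <= s <= t -> `|g s| <= h s) ->
  `|\int[leb]_(s in `[0, t]) g s| <= \int[leb]_(s in `[0, t]) h s.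
Proof.
move=> gt ht gh; apply: le_trans.
  by apply: le_normr_Rintegral => //; exact: bounded_on_integrable.
by apply: le_time_integral => //; exact: bounded_on_norm.
Qed.

Lemma time_integral_ge0 t g : (forall s, 0 <= s <= t -> 0 <= g s) ->
  0 <= \int[leb]_(s in `[0, t]) g s.
Proof. by move=> g0; apply: Rintegral_ge0 => s /=; rewrite in_itv/=; exact: g0. Qed.

Lemma le_time_integral_upper t u g : 0 <= u <= t -> bounded_on t g ->
  (forall s, 0 <= g s) ->
  \int[leb]_(s in `[0, u]) g s <= \int[leb]_(s in `[0, t]) g s.
Proof.
move=> /andP[u0 ut] gt g0; have gu := bounded_on_le ut gt.
rewrite /Rintegral fine_le//.
- by apply: integrable_fin_num => //; exact: bounded_on_integrable.
- by apply: integrable_fin_num => //; exact: bounded_on_integrable.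
apply: ge0_subset_integral => //.
- by apply/measurable_EFinP; apply: measurable_funTS; case: gt.
- by move=> s _; rewrite lee_fin.
- by move=> s /=; rewrite !in_itv/= => /andP[-> su]; rewrite (le_trans su ut).
Qed.

(** The power function lies above its tangent at [c]; in the induction step the gain is a multiple
    of [(a - c) ^+ 2]. *)
Lemma tangent_le_exprn (a c : R) n : 0 <= a -> 0 <= c ->
  c ^+ n.+1 + n.+1%:R * c ^+ n * (a - c) <= a ^+ n.+1.
Proof.
move=> a0 c0; elim: n => [|n ih].
  by rewrite !expr1 expr0 mulr1 mul1r addrC subrK.
rewrite (exprS a) -subr_ge0.
have : 0 <= a * (a ^+ n.+1 - (c ^+ n.+1 + n.+1%:R * c ^+ n * (a - c))).
  by rewrite mulr_ge0// subr_ge0.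
have : 0 <= n.+1%:R * c ^+ n * (a - c) ^+ 2.
  by apply: mulr_ge0; [rewrite mulr_ge0 ?exprn_ge0|exact: sqr_ge0].
have -> : c ^+ n.+2 = c * c * c ^+ n by rewrite !exprS mulrA.
have -> : c ^+ n.+1 = c * c ^+ n by rewrite exprS.
have -> : n.+2%:R = n.+1%:R + 1 :> R by rewrite natr1.
move: (c ^+ n) (a ^+ n.+1) (n.+1%:R) => x y z h1 h2.
have -> : a * y - (c * c * x + (z + 1) * (c * x) * (a - c)) =
  a * (y - (c * x + z * x * (a - c))) + z * x * (a - c) ^+ 2 by ring.
exact: addr_ge0.
Qed.

(** Jensen's inequality for the uniform law on [[0, t]]: integrate the tangent inequality at the
    time average [c], where the linear term vanishes. *)
Lemma time_integral_expr_le t g n : 0 < t -> bounded_on t g -> (forall s, 0 <= g s) ->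
  (\int[leb]_(s in `[0, t]) g s / t) ^+ n.+1 <=
  \int[leb]_(s in `[0, t]) (g s ^+ n.+1) / t.
Proof.
move=> t0 gt g0; set I := \int[leb]_(s in `[0, t]) g s; pose c := I / t.
have I0 : 0 <= I by apply: time_integral_ge0.
have c0 : 0 <= c by rewrite divr_ge0// ltW.
rewrite ler_pdivlMr// -/c.
have kt : bounded_on t (fun s => n.+1%:R * c ^+ n * (g s - c)).
  apply: bounded_onM; first exact: bounded_on_cst.
  by apply: bounded_onB => //; exact: bounded_on_cst.
have -> : c ^+ n.+1 * t =
    \int[leb]_(s in `[0, t]) (c ^+ n.+1 + n.+1%:R * c ^+ n * (g s - c)).
  rewrite time_integralD//; last exact: bounded_on_cst.
  rewrite time_integral_cst ?(ltW t0)// time_integralZ; last first.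
    by apply: bounded_onB => //; exact: bounded_on_cst.
  rewrite time_integralB//; last exact: bounded_on_cst.
  by rewrite time_integral_cst ?(ltW t0)// -/I /c divfK ?gt_eqF// subrr mulr0 addr0.
apply: le_time_integral.
- by apply: bounded_onD => //; exact: bounded_on_cst.
- exact: bounded_onX.
by move=> s _; exact: tangent_le_exprn.
Qed.

End BoundedOn.

Section PathBounds.
Context {R : realType}.
Notation leb := (@lebesgue_measure R).
Variables (C t m : R) (D M A N : R -> R).
Hypotheses (C0 : 0 <= C) (t0 : 0 <= t) (Ct : C * t <= 1 / 2).
Hypotheses (Mt : bounded_on t M) (mD : measurable_fun setT D) (mA : measurable_fun setT A).
Hypothesis AE : forall u, 0 <= u <= t -> A u = \int[leb]_(s in `[0, u]) D s.
Hypothesis NE : forall u, 0 <= u <= t -> N u = M u - m - A u.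
Hypothesis mN : measurable_fun setT N.
Hypothesis DM : forall s, 0 <= s <= t -> `|D s| <= C * (1 + `|M s|).

Lemma drift_bounded_on : bounded_on t D.
Proof.
have [_ [L ML]] := Mt; split=> //; exists (C * (1 + L)) => s st.
by apply: le_trans (DM st) _; rewrite ler_wpM2l// lerD2l ML.
Qed.

Lemma compensator_bounded_on : bounded_on t A.
Proof.
have [_ [L DL]] := drift_bounded_on; split=> //; exists (`|L| * t) => u ut.
have /andP[u0 ut'] := ut; rewrite AE//.
have Du := bounded_on_le ut' drift_bounded_on.
apply: (@le_trans _ _ (\int[leb]_(s in `[0, u]) `|L|)).
  apply: normr_time_integral_le => //; first exact: bounded_on_cst.
  move=> s /andP[s0 su]; apply: le_trans (ler_norm L); apply: DL.
  by rewrite s0 (le_trans su).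
by rewrite time_integral_cst// ler_wpM2l.
Qed.

Lemma noise_bounded_on : bounded_on t N.
Proof.
have [mA' [L AL]] := compensator_bounded_on; have [mM [L' ML]] := Mt.
split=> //; exists (L' + `|m| + L) => u ut; rewrite NE//.
apply: le_trans (ler_normB _ _) _; apply: lerD; last exact: AL.
by apply: le_trans (ler_normB _ _) _; rewrite lerD2r ML.
Qed.

Let q := \int[leb]_(s in `[0, t]) `|N s|.
Let q0 : 0 <= q. Proof. by apply: time_integral_ge0 => s _. Qed.

(** A substitute for Gronwall's lemma on a short interval. The supremum [b] of [|A|], finite by the
    crude bound, satisfies [b <= K + C * t * b], and [C * t <= 1 / 2] solves this for [b]. *)
Lemma compensator_le u : 0 <= u <= t ->
  `|A u| <= 2 * (C * (1 + `|m|) * t + C * q).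
Proof.
have A_t := compensator_bounded_on; have N_t := noise_bounded_on.
have nA := bounded_on_norm A_t; have nN := bounded_on_norm N_t.
set K := C * (1 + `|m|) * t + C * q.
pose E := [set `|A u| | u in [set u | 0 <= u <= t]].
have E0 : E !=set0 by exists `|A 0|, 0 => //=; rewrite lexx.
have [_ [L AL]] := A_t.
have Eub : has_ubound E by exists L => _ [v /= vt <-]; exact: AL.
pose b := sup E.
have Ab v : 0 <= v <= t -> `|A v| <= b.
  by move=> vt; apply: ub_le_sup => //; exists v.
have b0 : 0 <= b by apply: le_trans (Ab 0 _); rewrite ?lexx.
suff bK : b <= K + b / 2 by move=> ut; apply: le_trans (Ab u ut) _; lra.
apply: ge_sup => // _ [v /= /[dup] vt /andP[v0 vt'] <-].
rewrite AE//.
have le_v := bounded_on_le vt'.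
pose g s := C * (1 + `|m|) + C * `|N s| + C * b.
have gt : bounded_on t g.
  apply: bounded_onD; last exact: bounded_on_cst.
  apply: bounded_onD; first exact: bounded_on_cst.
  by apply: bounded_onM => //; exact: bounded_on_cst.
apply: (@le_trans _ _ (\int[leb]_(s in `[0, v]) g s)).
  apply: normr_time_integral_le; [exact: le_v drift_bounded_on|exact: le_v|].
  move=> s /andP[s0 sv]; have st : 0 <= s <= t by rewrite s0 (le_trans sv).
  apply: le_trans (DM st) _; rewrite /g -!mulrDr ler_wpM2l// -!addrA lerD2l.
  have -> : M s = m + (N s + A s) by rewrite NE//; ring.
  apply: le_trans (ler_normD _ _) _; rewrite lerD2l.
  by apply: le_trans (ler_normD _ _) _; rewrite lerD2l Ab.
apply: (@le_trans _ _ (\int[leb]_(s in `[0, t]) g s)).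
  apply: le_time_integral_upper => // s.
  by rewrite /g !addr_ge0// mulr_ge0// ?addr_ge0.
rewrite time_integralD; last 2 first.
- apply: bounded_onD; first exact: bounded_on_cst.
  by apply: bounded_onM => //; exact: bounded_on_cst.
- exact: bounded_on_cst.
rewrite time_integralD; last 2 first.
- exact: bounded_on_cst.
- by apply: bounded_onM => //; exact: bounded_on_cst.
rewrite !time_integral_cst// time_integralZ// -/q /K lerD2l.
by have := ler_wpM2r b0 Ct; rewrite mulrAC; lra.
Qed.

(** The displacement is [N + A]. Integrating the bound on [A] yields a term [2 * C * t * q], at most
    [q] because [C * t <= 1 / 2]; this explains the coefficient 2 of [q]. *)
Lemma displacement_integral_le :
  \int[leb]_(s in `[0, t]) `|M s - m| <= 2 * q + 2 * C * (1 + `|m|) * t ^+ 2.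
Proof.
have A_t := compensator_bounded_on; have N_t := noise_bounded_on.
set K := C * (1 + `|m|) * t + C * q.
apply: (@le_trans _ _ (\int[leb]_(s in `[0, t]) (`|N s| + 2 * K))).
  apply: le_time_integral.
  - by apply: bounded_on_norm; apply: bounded_onB => //; exact: bounded_on_cst.
  - by apply: bounded_onD; [exact: bounded_on_norm|exact: bounded_on_cst].
  move=> s st; have -> : M s - m = N s + A s by rewrite NE//; ring.
  by apply: le_trans (ler_normD _ _) _; rewrite lerD2l compensator_le.
rewrite time_integralD; [|exact: bounded_on_norm|exact: bounded_on_cst].
rewrite time_integral_cst// -/q /K.
have : C * t * q <= 1 / 2 * q by rewrite ler_wpM2r.
by nra.
Qed.

End PathBounds.

Section MoreMoments.
Context {d} {T : measurableType d} {R : realType} (P : probability T R).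

Lemma all_moments_ae (U V : T -> R) : measurable_fun setT U ->
  {ae P, forall w, U w = V w} -> all_moments P V -> all_moments P U.
Proof.
move=> mU UV VP; have mV := all_moments_measurable VP.
have absX (W : T -> R) n : measurable_fun setT W -> measurable_fun setT
    (fun w => (`|W w| ^+ n)%:E).
  by move=> mW; apply/measurable_EFinP; apply: measurable_funX; exact: measurableT_comp.
split=> // n; have /integrableP[_ iV] := VP.2 n.
apply/integrableP; split; first exact: absX.
apply: le_lt_trans iV; rewrite le_eqVlt; apply/orP; left; apply/eqP.
apply: ae_eq_integral => //.
- by apply: measurableT_comp => //; exact: absX.
- by apply: measurableT_comp => //; exact: absX.
- by apply: filterS UV => w /= -> _.
Qed.

Lemma all_moments_norm (U : T -> R) : all_moments P U -> all_moments P (fun w => `|U w|).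
Proof.
move=> UP; apply: le_all_moments (UP) => [|w]; last by rewrite normr_id.
by apply: measurableT_comp => //; exact: (all_moments_measurable UP).
Qed.

Lemma le_mean_ae (U V : T -> R) : all_moments P U -> all_moments P V ->
  {ae P, forall w, U w <= V w} -> \int[P]_w U w <= \int[P]_w V w.
Proof.
move=> UP VP UV.
have -> : \int[P]_w V w = \int[P]_w Num.max (U w) (V w).
  have mU := all_moments_measurable UP; have mV := all_moments_measurable VP.
  apply: eq_mean_ae => //; first exact: measurable_maxr.
  by apply: filterS UV => w h; rewrite (max_idPr h).
apply: le_mean => //.
- apply: (@le_all_moments _ _ _ _ _ (fun w => `|U w| + `|V w|)).
  + by apply: measurable_maxr; [exact: (all_moments_measurable UP)|exact: (all_moments_measurable VP)].
  + move=> w; rewrite [leRHS]ger0_norm ?addr_ge0//.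
    by case: (leP (U w) (V w)) => _; rewrite ?lerDl ?lerDr.
  + exact: all_momentsD (all_moments_norm UP) (all_moments_norm VP).
by move=> w; rewrite le_max lexx.
Qed.

End MoreMoments.

Section TimeIntegralMeasurable.
Context {R : realType} {dT} {T : measurableType dT}.
Notation leb := (@lebesgue_measure R).
Variable D : R -> T -> R.
Hypothesis mD : jointly_measurable D.

(** The varying domain is encoded by the indicator of [S], a set in the product with a third
    coordinate for the integration variable, so that measurability is the one given by Tonelli's
    theorem. *)
Let pos_measurable (E : R -> T -> R) : jointly_measurable E -> (forall s w, 0 <= E s w) ->
  measurable_fun setT (fun z : R * T => (\int[leb]_(s in `[0%R, z.1]) (E s z.2)%:E)%E).
Proof.
move=> mE E0.
pose S := [set y : (R * T) * R | (0 <= y.2) && (y.2 <= y.1.1)].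
have mS : measurable S.
  have : measurable_fun setT (fun y : (R * T) * R => (0 <= y.2) && (y.2 <= y.1.1)).
    apply: measurable_and; apply: measurable_fun_ler => //.
    by apply: measurableT_comp; [exact: measurable_fst|exact: measurable_fst].
  by move=> /(_ measurableT [set true]); rewrite setTI; apply.
pose k (y : (R * T) * R) : \bar R := (E y.2 y.1.2 * \1_S y)%:E.
have mk : measurable_fun setT k.
  apply/measurable_EFinP; apply: measurable_funM.
    apply: (measurableT_comp (f := fun z : R * T => E z.1 z.2) (g := fun y : (R * T) * R => (y.2, y.1.2))) => //.
    apply: measurable_fun_pair; first exact: measurable_snd.
    by apply: measurableT_comp; [exact: measurable_snd|exact: measurable_fst].
  exact: measurable_indic.
have -> : (fun z : R * T => \int[leb]_(s in `[0%R, z.1]) (E s z.2)%:E)%E =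
    (fun z : R * T => \int[leb]_s k (z, s))%E.
  apply/funext => z; rewrite integral_mkcond; congr (integral _ _ _).
  apply/funext => s; rewrite patchE /k/=.
  rewrite indicE; have -> : (s \in `[0, z.1]%classic) = ((z, s) \in S).
    by apply/idP/idP => /set_mem h; apply/mem_set; move: h; rewrite /S/= in_itv.
  by case: ifP => _; rewrite ?mulr1 ?mulr0.
apply: (@measurable_fun_fubini_tonelli_F _ _ _ _ _ leb k) => //.
by move=> y; rewrite /k lee_fin mulr_ge0.
Qed.

Lemma time_integral_jointly_measurable :
  jointly_measurable (fun u w => \int[leb]_(s in `[0, u]) D s w).
Proof.
rewrite /jointly_measurable /Rintegral.
have mp : jointly_measurable (fun s w => Num.max (D s w) 0).
  exact: measurable_maxr.
have mn : jointly_measurable (fun s w => Num.max (- D s w) 0).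
  by apply: measurable_maxr => //; exact: measurable_funN.
apply: (measurableT_comp (f := fine)) => //.
have -> : (fun z : R * T => \int[leb]_(s in `[0%R, z.1]) (D s z.2)%:E)%E =
    (fun z : R * T => \int[leb]_(s in `[0%R, z.1]) (Num.max (D s z.2) 0)%:E -
      \int[leb]_(s in `[0%R, z.1]) (Num.max (- D s z.2) 0)%:E)%E.
  apply/funext => z; rewrite [LHS]integralE; congr (_ - _)%E;
    apply: eq_integral => s _.
    by rewrite funeposE EFin_max.
  by rewrite funenegE EFin_max.
apply: emeasurable_funB.
  by apply: (pos_measurable mp) => s w; rewrite le_max lexx orbT.
by apply: (pos_measurable mn) => s w; rewrite le_max lexx orbT.
Qed.

End TimeIntegralMeasurable.

Section HalfLineContinuous.
Context {R : realType} (g : R -> R).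
Hypothesis cg : {within `[0, +oo[, continuous g}.

Lemma half_line_right_cvg s : 0 <= s -> g r @[r --> s^'+] --> g s.
Proof.
have [cg1 cg2] := (continuous_within_itvcyP 0 g).1 cg.
rewrite le_eqVlt => /predU1P[<-//|s0].
apply: cvg_at_right_filter; apply: cg1.
by rewrite in_itv/= s0.
Qed.

Lemma half_line_bounded t : exists L, forall s, 0 <= s <= t -> `|g s| <= L.
Proof.
have [t0|t0] := leP 0 t; last first.
  by exists 0 => s /andP[s0 st]; have := le_lt_trans (le_trans s0 st) t0; rewrite ltxx.
have ct : {within `[0, t], continuous g}.
  by apply: continuous_subspaceW cg => s /=; rewrite !in_itv/= andbT => /andP[].
have [c _ cmax] := EVT_max t0 ct; have [e _ emin] := EVT_min t0 ct.
exists (`|g c| + `|g e|) => s st; have sI : s \in `[0, t] by rewrite in_itv.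
have h1 := cmax s sI; have h2 := emin s sI.
have h3 := ler_norm (g c); have h4 := ler_norm (- g e); rewrite normrN in h4.
have h5 := normr_ge0 (g c); have h6 := normr_ge0 (g e).
by rewrite ler_norml; lra.
Qed.

End HalfLineContinuous.

(** * Pathwise decomposition of one component *)

Section OUComponent.
Context {R : realType} {d : nat} {dT} {T : measurableType dT}.
Notation leb := (@lebesgue_measure R).
Variables (X : R -> T -> 'I_d.+1) (M : R -> T -> R) (al ga : 'I_d.+1 -> R).

(* Times are truncated at 0, where nothing is assumed of the processes. *)
Definition drift (s : R) (w : T) : R :=
  al (X (Num.max s 0) w) - ga (X (Num.max s 0) w) * M (Num.max s 0) w.

Definition compensator (u : R) (w : T) : R := \int[leb]_(s in `[0, u]) drift s w.

(** A version of the Ito integral defined from the path of [M]. It is jointly measurable in time and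
    sample point, which the integrals given for each time separately are not known to be. *)
Definition noise_part (u : R) (w : T) : R :=
  M (Num.max u 0) w - M 0 w - compensator u w.

(** The only functional of the noise that enters the drift estimates; with [t = s ^+ 2] it is of
    order [s ^+ 3]. *)
Definition noise_size (t : R) (w : T) : R := \int[leb]_(s in `[0, t]) `|noise_part s w|.

(** The time spent outside the starting state, of mean of order [t ^+ 2]: it measures how far the
    coefficients are from being frozen. *)
Definition time_away (i0 : 'I_d.+1) (t : R) (w : T) : R :=
  \int[leb]_(s in `[0, t]) (X (Num.max s 0) w != i0)%:R.

Hypothesis mX : forall t, 0 <= t -> measurable_fun setT (X t).
Hypothesis rcX : forall w t, 0 <= t -> \forall s \near t^'+, X s w = X t w.
Hypothesis mM : forall t, 0 <= t -> measurable_fun setT (M t).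
Hypothesis cM : forall w, {within `[0, +oo[, continuous (M ^~ w)}.

Lemma chain_comp_jointly_measurable (g : 'I_d.+1 -> R) :
  jointly_measurable (fun s w => g (X (Num.max s 0) w)).
Proof.
apply: (right_continuous_jointly_measurable (F := fun s w => g (X s w))).
  by move=> s s0; apply: measurable_ord_comp; exact: mX.
move=> w s s0; apply: cvg_near_cst.
by apply: filterS (rcX w s0) => r ->.
Qed.

Lemma path_jointly_measurable : jointly_measurable (fun s w => M (Num.max s 0) w).
Proof.
apply: right_continuous_jointly_measurable => // w s s0.
exact: half_line_right_cvg.
Qed.

Lemma drift_jointly_measurable : jointly_measurable drift.
Proof.
apply: jointly_measurableB; first exact: chain_comp_jointly_measurable.
apply: jointly_measurableM; first exact: chain_comp_jointly_measurable.
exact: path_jointly_measurable.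
Qed.

Lemma compensator_jointly_measurable : jointly_measurable compensator.
Proof. exact: time_integral_jointly_measurable drift_jointly_measurable. Qed.

Lemma noise_part_jointly_measurable : jointly_measurable noise_part.
Proof.
apply: jointly_measurableB; last exact: compensator_jointly_measurable.
apply: jointly_measurableB; first exact: path_jointly_measurable.
by apply: jointly_measurable_space; exact: mM.
Qed.

Lemma path_bounded_on t w : bounded_on t (fun s => M (Num.max s 0) w).
Proof.
split; first exact: jointly_measurable_section2 path_jointly_measurable.
have [L hL] := half_line_bounded (@cM w) t.
by exists L => s st; have /andP[s0 _] := st; rewrite (max_idPl s0); exact: hL.
Qed.

Lemma chain_bounded_on t w (g : 'I_d.+1 -> R) :
  bounded_on t (fun s => g (X (Num.max s 0) w)).
Proof.
split; first exact: (jointly_measurable_section2 w (chain_comp_jointly_measurable g)).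
by exists (\sum_i `|g i|) => s _; rewrite (bigD1 (X (Num.max s 0) w))//= lerDl sumr_ge0.
Qed.

Variable C : R.
Hypothesis alC : forall i, `|al i| <= C.
Hypothesis gaC : forall i, `|ga i| <= C.
Let C0 : 0 <= C. Proof. exact: le_trans (normr_ge0 _) (alC ord0). Qed.

Lemma drift_le s w : 0 <= s -> `|drift s w| <= C * (1 + `|M s w|).
Proof.
move=> s0; rewrite /drift (max_idPl s0); apply: le_trans (ler_normB _ _) _.
by rewrite mulrDr mulr1; apply: lerD => //; rewrite normrM ler_wpM2r.
Qed.

Section FixedTime.
Variables (t : R) (w : T).
Hypotheses (t0 : 0 <= t) (Ct : C * t <= 1 / 2).

Let Mt := path_bounded_on t w.
Let mD : measurable_fun setT (drift ^~ w).
Proof. exact: jointly_measurable_section2 drift_jointly_measurable. Qed.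
Let mA : measurable_fun setT (compensator ^~ w).
Proof. exact: jointly_measurable_section2 compensator_jointly_measurable. Qed.
Let mN : measurable_fun setT (noise_part ^~ w).
Proof. exact: jointly_measurable_section2 noise_part_jointly_measurable. Qed.
Let AE u : 0 <= u <= t -> compensator u w = \int[leb]_(s in `[0, u]) drift s w.
Proof. by []. Qed.
Let NE u : 0 <= u <= t -> noise_part u w = M (Num.max u 0) w - M 0 w - compensator u w.
Proof. by []. Qed.
Let DM s : 0 <= s <= t -> `|drift s w| <= C * (1 + `|M (Num.max s 0) w|).
Proof. by move=> /andP[s0 _]; rewrite (max_idPl s0) drift_le. Qed.

Lemma drift_bounded : bounded_on t (drift ^~ w).
Proof. exact: (drift_bounded_on C0 Mt mD DM). Qed.

Lemma noise_part_bounded : bounded_on t (noise_part ^~ w).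
Proof. exact: (noise_bounded_on C0 Mt mD mA AE NE mN DM). Qed.

Lemma path_compensator_le :
  `|compensator t w| <= 2 * (C * (1 + `|M 0 w|) * t + C * noise_size t w).
Proof.
by apply: (compensator_le C0 t0 Ct Mt mD mA AE NE mN DM); rewrite t0 lexx.
Qed.

Lemma path_displacement_le :
  \int[leb]_(s in `[0, t]) `|M (Num.max s 0) w - M 0 w| <=
  2 * noise_size t w + 2 * C * (1 + `|M 0 w|) * t ^+ 2.
Proof. exact: (displacement_integral_le C0 t0 Ct Mt mD mA AE NE mN DM). Qed.

Lemma noise_size_ge0 : 0 <= noise_size t w.
Proof. by apply: time_integral_ge0 => s _. Qed.

Let displacement_bounded : bounded_on t (fun s => M (Num.max s 0) w - M 0 w).
Proof. by apply: bounded_onB => //; exact: bounded_on_cst. Qed.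

(** Integrating the equation with [M] split as start plus displacement gives the factor [1 - b],
    where [b >= g * t]. The displacement depends on the start only at order [t ^+ 2], so the
    contraction survives for small [t]. *)
Lemma path_contraction g : (forall i, g <= ga i) -> 0 <= g ->
  `|M t w| <= (1 - g * t + 2 * C ^+ 2 * t ^+ 2) * `|M 0 w| +
    (C * t + 2 * C ^+ 2 * t ^+ 2 + 2 * C * noise_size t w + `|noise_part t w|).
Proof.
move=> gga g0.
pose a := \int[leb]_(s in `[0, t]) al (X (Num.max s 0) w).
pose b := \int[leb]_(s in `[0, t]) ga (X (Num.max s 0) w).
pose c := \int[leb]_(s in `[0, t]) (ga (X (Num.max s 0) w) * (M (Num.max s 0) w - M 0 w)).
have gb := chain_bounded_on t w ga; have ab := chain_bounded_on t w al.
have gyb := bounded_onM gb displacement_bounded.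
have gmb : bounded_on t (fun s => M 0 w * ga (X (Num.max s 0) w)).
  by apply: bounded_onM => //; exact: bounded_on_cst.
have AE' : compensator t w = a - M 0 w * b - c.
  rewrite /a /b /c -(time_integralZ _ gb) -time_integralB//.
  rewrite -time_integralB//; last exact: bounded_onB.
  by apply: eq_Rintegral => s _; rewrite /drift; ring.
have ME : M t w = M 0 w * (1 - b) + (a - c + noise_part t w).
  by rewrite /noise_part AE' (max_idPl t0); ring.
have aC : `|a| <= C * t.
  rewrite -(time_integral_cst _ t0); apply: normr_time_integral_le => //.
    exact: bounded_on_cst.
have bC : `|b| <= C * t.
  rewrite -(time_integral_cst _ t0); apply: normr_time_integral_le => //.
    exact: bounded_on_cst.
have bg : g * t <= b.
  rewrite -(time_integral_cst _ t0); apply: le_time_integral => //.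
  exact: bounded_on_cst.
have cC : `|c| <= C * (2 * noise_size t w + 2 * C * (1 + `|M 0 w|) * t ^+ 2).
  apply: le_trans (ler_wpM2l C0 path_displacement_le).
  have nyb := bounded_on_norm displacement_bounded.
  rewrite -(time_integralZ _ nyb); apply: normr_time_integral_le => //.
    by apply: bounded_onM => //; exact: bounded_on_cst.
  by move=> s _; rewrite normrM ler_wpM2r.
rewrite ME; apply: le_trans (ler_normD _ _) _.
have h1 : `|M 0 w * (1 - b)| <= (1 - g * t) * `|M 0 w|.
  rewrite normrM mulrC ler_wpM2r// ger0_norm ?lerD2l ?lerN2//.
  rewrite subr_ge0 (le_trans (ler_norm _))// (le_trans bC)// (le_trans Ct)//; lra.
have h2 : `|a - c + noise_part t w| <= `|a| + `|c| + `|noise_part t w|.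
  by apply: le_trans (ler_normD _ _) _; rewrite lerD2r ler_normB.
have : C * (2 * noise_size t w + 2 * C * (1 + `|M 0 w|) * t ^+ 2) =
   2 * C * noise_size t w + 2 * C ^+ 2 * t ^+ 2 + 2 * C ^+ 2 * t ^+ 2 * `|M 0 w| by ring.
move=> E; rewrite E in cC; rewrite mulrDl; move: cC h1 h2 aC.
move: (2 * C * noise_size t w) (2 * C ^+ 2 * t ^+ 2 * `|M 0 w|) => z1 z2.
move: (2 * C ^+ 2 * t ^+ 2) ((1 - g * t) * `|M 0 w|) => z3 z4.
move: (`|M 0 w * (1 - b)|) (`|a - c + noise_part t w|) => z5 z6; lra.
Qed.

(** The drift is compared with its value frozen at the start. It deviates only while the chain is
    away from [i0], or through the displacement of [M]. *)
Lemma path_drift_approx (i0 i : 'I_d.+1) :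
  `|(X t w == i)%:R * compensator t w - (i0 == i)%:R * (t * (al i0 - ga i0 * M 0 w))| <=
  2 * C * (1 + `|M 0 w|) * (t * (X t w != i0)%:R + time_away i0 t w) +
  C * (2 * noise_size t w + 2 * C * (1 + `|M 0 w|) * t ^+ 2).
Proof.
pose b := al i0 - ga i0 * M 0 w.
have bC : `|b| <= C * (1 + `|M 0 w|).
  apply: le_trans (ler_normB _ _) _; rewrite mulrDr mulr1 normrM.
  by apply: lerD => //; rewrite ler_wpM2r.
have nyb := bounded_on_norm displacement_bounded.
have eb := chain_bounded_on t w (fun x => (x != i0)%:R).
have Db := drift_bounded.
have e0 : 0 <= time_away i0 t w by apply: time_integral_ge0 => s _.
set r := C * (2 * _ + _).
have yr : C * \int[leb]_(s in `[0, t]) `|M (Num.max s 0) w - M 0 w| <= r.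
  exact: ler_wpM2l C0 _ _ path_displacement_le.
pose k := C * (1 + `|M 0 w|).
have k0 : 0 <= k by rewrite mulr_ge0 ?addr_ge0.
have Cyb : bounded_on t (fun s => C * `|M (Num.max s 0) w - M 0 w|).
  by apply: bounded_onM => //; exact: bounded_on_cst.
have keb : bounded_on t (fun s => 2 * k * (X (Num.max s 0) w != i0)%:R).
  by apply: bounded_onM => //; exact: bounded_on_cst.
rewrite -/b (_ : 2 * C * (1 + `|M 0 w|) = 2 * k); last by rewrite /k mulrA.
(* If the chain ends in [i0], both indicators agree and the difference is a time integral of drift
   differences. *)
have [Xt|Xt] := eqVneq (X t w) i0.
  rewrite Xt mulr0 add0r -mulrBr normrM.
  apply: (@le_trans _ _ `|compensator t w - t * b|).
    by rewrite ler_piMl//; case: (i0 == i); rewrite ?normr1 ?normr0.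
  have -> : compensator t w - t * b = \int[leb]_(s in `[0, t]) (drift s w - b).
    rewrite time_integralB//; last exact: bounded_on_cst.
    by rewrite time_integral_cst// (mulrC t).
  apply: le_trans (normr_time_integral_le (h := fun s =>
    2 * k * (X (Num.max s 0) w != i0)%:R + C * `|M (Num.max s 0) w - M 0 w|) _ _ _) _.
  - by apply: bounded_onB => //; exact: bounded_on_cst.
  - exact: bounded_onD.
  - move=> s _.
    have -> : drift s w - b = al (X (Num.max s 0) w) - ga (X (Num.max s 0) w) * M 0 w - b
        - ga (X (Num.max s 0) w) * (M (Num.max s 0) w - M 0 w) by rewrite /drift; ring.
    apply: le_trans (ler_normB _ _) _; apply: lerD; last by rewrite normrM ler_wpM2r.
    have [->|_] := eqVneq (X (Num.max s 0) w) i0.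
      by rewrite /b subrr normr0 mulr0.
    rewrite mulr1; apply: le_trans (ler_normB _ _) _.
    have h : `|al (X (Num.max s 0) w) - ga (X (Num.max s 0) w) * M 0 w| <= k.
      apply: le_trans (ler_normB _ _) _; rewrite /k mulrDr mulr1 normrM.
      by apply: lerD => //; rewrite ler_wpM2r.
    by rewrite mulr_natl mulr2n; exact: lerD.
  by rewrite time_integralD// !time_integralZ//; apply: lerD.
(* If the chain does not end in [i0], the two terms are bounded separately, each by [k * t] up to
   the displacement; the probability of this case supplies the missing smallness. *)
rewrite /= mulr1.
have Ale : `|compensator t w| <= k * t + r.
  rewrite /compensator.
  apply: le_trans (normr_time_integral_le (h := fun s =>
    k + C * `|M (Num.max s 0) w - M 0 w|) _ _ _) _ => //.
  - by apply: bounded_onD => //; exact: bounded_on_cst.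
  - move=> s /andP[s0 _]; apply: le_trans (drift_le _ s0) _.
    rewrite (max_idPl s0) /k -mulrDr ler_wpM2l// -addrA lerD2l.
    by rewrite -{1}(subrK (M 0 w) (M s w)) (addrC `|M 0 w|) ler_normD.
  by rewrite time_integralD// ?time_integral_cst ?time_integralZ ?lerD2l//; exact: bounded_on_cst.
have Bt : `|t * b| <= k * t by rewrite normrM (ger0_norm t0) mulrC ler_wpM2r.
apply: le_trans (ler_normB _ _) _.
have h1 : `|(X t w == i)%:R * compensator t w| <= k * t + r.
  rewrite normrM; apply: le_trans Ale; rewrite ler_piMl//.
  by case: (X t w == i); rewrite ?normr1 ?normr0.
have h2 : `|(i0 == i)%:R * (t * b)| <= k * t.
  rewrite normrM; apply: le_trans Bt; rewrite ler_piMl//.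
  by case: (i0 == i); rewrite ?normr1 ?normr0.
have : 0 <= 2 * k * time_away i0 t w by rewrite !mulr_ge0.
lra.
Qed.

End FixedTime.
End OUComponent.

(** * Small-time moments of one component *)

Section OUMoments.
Context {R : realType} {d J : nat} {dT} {T : measurableType dT}.
Notation leb := (@lebesgue_measure R).
Variables (P : probability T R) (X : R -> T -> 'I_d.+1) (B : 'I_J -> R -> T -> R).
Hypothesis noise : driving_noise P X B.
Hypothesis rcX : forall w t, 0 <= t -> \forall s \near t^'+, X s w = X t w.
Variables (kappa h0 : R).
Hypothesis kappa0 : 0 <= kappa.
Hypothesis exitX : forall s t, 0 <= s <= t -> t - s <= h0 ->
  (P [set w | X s w != X t w] <= (kappa * (t - s))%:E)%E.
Variable i0 : 'I_d.+1.
Hypothesis startX : {ae P, forall w, X 0 w = i0}.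
Variables (al ga sg : 'I_d.+1 -> R) (C : R).
Hypothesis alC : forall i, `|al i| <= C.
Hypothesis gaC : forall i, `|ga i| <= C.
Hypothesis sgC : forall i, `|sg i| <= C.
Variables (j : 'I_J) (M : R -> T -> R).
Hypothesis mM : forall t, 0 <= t -> measurable_fun setT (M t).
Hypothesis cM : forall w, {within `[0, +oo[, continuous (M ^~ w)}.
Variable m : R.
Hypothesis startM : {ae P, forall w, M 0 w = m}.
Variable Y : R -> T -> R.
Hypothesis itoY : forall t, 0 <= t ->
  ito_integral P (history X B) (B j) (fun s w => sg (X s w)) t (Y t).
Hypothesis sdeM : {ae P, forall w, forall t, 0 <= t ->
  M t w = M 0 w + \int[leb]_(s in `[0, t]) (al (X s w) - ga (X s w) * M s w) + Y t w}.

Let mX := noise_chain noise.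
Let C0 : 0 <= C. Proof. exact: le_trans (normr_ge0 _) (alC ord0). Qed.
Local Notation comp := (compensator X M al ga).
Local Notation np := (noise_part X M al ga).
Local Notation ns := (noise_size X M al ga).
Let npJ : jointly_measurable np := noise_part_jointly_measurable al ga mX rcX mM cM.

Lemma history_measurable s : history X B s `<=` measurable.
Proof.
apply: smallest_sub; first exact: sigma_algebra_measurable.
move=> A [AX|[l _ AB]].
  apply: (chain_sigma_measurable mX).
  exact: sub_sigma_family (@itv_upto_sub R s) _ AX.
apply: (brownian_sigma_measurable (noise_brownian noise)).
exact: sub_sigma_family (@itv_upto_sub R s) _ AB.
Qed.

(** The equation identifies [noise_part] at time [t] with the given integral outside a null set. *)
Lemma noise_part_ito t : 0 <= t ->
  ito_integral P (history X B) (B j) (fun s w => sg (X s w)) t (np t).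
Proof.
move=> t0; apply: ito_integral_ae (itoY t0).
- exact: (jointly_measurable_section1 t npJ).
- by move=> s s0; have [mB _ _ _ _] := noise_brownian noise j; exact: mB.
- exact: history_measurable.
apply: filterS sdeM => w /(_ t t0) Mt; rewrite /noise_part (max_idPl t0) Mt.
have -> : comp t w = \int[leb]_(s in `[0, t]) (al (X s w) - ga (X s w) * M s w).
  apply: eq_Rintegral => s; rewrite inE /= in_itv/= => /andP[s0 _].
  by rewrite /drift (max_idPl s0).
by ring.
Qed.

Lemma noise_part_all_moments t : 0 <= t <= h0 -> all_moments P (np t).
Proof.
move=> t0; apply: (ito_all_moments noise rcX kappa0 exitX sgC t0 (noise_part_ito _)).
by case/andP : t0.
Qed.

Lemma noise_part_even_moment t p : 0 <= t <= h0 ->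
  (\int[P]_w (np t w ^+ p.*2)%:E <= (ito_moment_bound C p * t ^+ p)%:E)%E.
Proof.
move=> t0; apply: (ito_even_moment noise rcX kappa0 exitX sgC t0 (noise_part_ito _)).
by case/andP : t0.
Qed.

Lemma noise_size_measurable t : measurable_fun setT (ns t).
Proof.
apply: jointly_measurable_section1.
apply: (time_integral_jointly_measurable (D := fun s w => `|np s w|)).
exact: jointly_measurable_norm.
Qed.

(** Jensen's inequality in time moves the power inside the integral; Tonelli's theorem and the
    moment bound at each earlier time then give [t ^ p], and the time integral supplies
    [t ^ (2p)]. *)
Lemma noise_size_even_moment_ereal t p : 0 < t <= h0 -> C * t <= 1 / 2 ->
  (\int[P]_w (ns t w ^+ p.*2)%:E <= (ito_moment_bound C p * t ^+ p * t ^+ p.*2)%:E)%E.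
Proof.
move=> /andP[t0 th] Ct; case: p => [|p].
  under eq_integral do rewrite expr0.
  by rewrite integral_cst//= probability_setT mule1 /ito_moment_bound !expr0 !mulr1.
(* Jensen's inequality is stated for the exponent [n.+1], which here equals [p.+1.*2]. *)
rewrite doubleS; set n := p.*2.+1.
have nE : n.+1 = p.+1.*2 by rewrite /n doubleS.
pose G s w := `|np s w| ^+ n.+1.
have mG : jointly_measurable G by apply: jointly_measurableX; exact: jointly_measurable_norm.
have G0 s w : 0 <= G s w by rewrite /G exprn_ge0.
have le_w w : ns t w ^+ n.+1 <= t ^+ n * \int[leb]_(s in `[0, t]) G s w.
  have nb : bounded_on t (np ^~ w).
    exact: (noise_part_bounded mX rcX mM cM alC gaC t w).
  have := time_integral_expr_le n t0 (bounded_on_norm nb) (fun s => normr_ge0 _).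
  rewrite -/(ns t w) expr_div_n ler_pdivrMr ?exprn_gt0//.
  move=> /le_trans; apply; rewrite le_eqVlt; apply/orP; left; apply/eqP.
  by rewrite /G (exprS t n); field; rewrite gt_eqF.
have Gfin w : (\int[leb]_(s in `[0%R, t]) (G s w)%:E = (\int[leb]_(s in `[0, t]) G s w)%:E)%E.
  have nb : bounded_on t (np ^~ w).
    exact: (noise_part_bounded mX rcX mM cM alC gaC t w).
  rewrite /Rintegral fineK//; apply: integrable_fin_num => //.
  exact: (bounded_on_integrable (bounded_onX n.+1 (bounded_on_norm nb))).
have mGI := measurable_time_integral (measurable_itv `[0, t]) mG G0.
apply: (@le_trans _ _ (\int[P]_w ((t ^+ n)%:E * \int[leb]_(s in `[0%R, t]) (G s w)%:E))%E).
  apply: ge0_le_integral => //.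
  - by move=> w _; rewrite lee_fin exprn_ge0// noise_size_ge0.
  - by apply/measurable_EFinP; apply: measurable_funX; exact: noise_size_measurable.
  - exact: emeasurable_funM.
  - by move=> w _; rewrite Gfin -EFinM lee_fin.
have tn0 : 0 <= t ^+ n by rewrite exprn_ge0// ltW.
rewrite ge0_integralZl//; last by move=> w _; apply: integral_ge0 => s _; rewrite lee_fin.
rewrite (tonelli_time P (measurable_itv `[0, t]) mG G0).
set b := ito_moment_bound C p.+1 * t ^+ p.+1.
have b0 : 0 <= b.
  by rewrite /b mulr_ge0 ?exprn_ge0 ?(ltW t0)// ito_moment_bound_ge0.
have -> : (b * t ^+ n.+1)%:E = ((t ^+ n)%:E * (b * t)%:E)%E.
  by rewrite -EFinM exprSr; congr EFin; ring.
apply: lee_wpmul2l; first by rewrite lee_fin.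
apply: (@le_trans _ _ (\int[leb]_(s in `[0%R, t]) b%:E)%E).
  apply: ge0_le_integral => //.
  - by move=> s _; apply: integral_ge0 => w _; rewrite lee_fin.
  - by apply: measurable_funTS; exact: measurable_mean_time.
  - move=> s /=; rewrite in_itv/= => /andP[s0 st].
    rewrite /G nE; under eq_integral do rewrite -normrX ger0_norm ?exprn_even_ge0 ?odd_double//.
    apply: le_trans (noise_part_even_moment _ _) _; first by rewrite s0 (le_trans st).
    rewrite lee_fin /b ler_wpM2l ?ito_moment_bound_ge0//.
    by rewrite lerXn2r ?nnegrE// ltW.
rewrite integral_cst// /= lebesgue_measure_itv/= lte_fin t0.
by rewrite -EFinD -EFinM subr0.
Qed.

Lemma noise_size_all_moments t : 0 < t <= h0 -> C * t <= 1 / 2 -> all_moments P (ns t).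
Proof.
move=> t0 Ct; apply: all_moments_even; first exact: noise_size_measurable.
by move=> p; apply: le_lt_trans (noise_size_even_moment_ereal p t0 Ct) (ltry _).
Qed.

Lemma noise_size_even_moment t p : 0 < t <= h0 -> C * t <= 1 / 2 ->
  \int[P]_w (ns t w ^+ p.*2) <= ito_moment_bound C p * t ^+ p * t ^+ p.*2.
Proof.
move=> t0 Ct; rewrite -lee_fin -all_moments_integral.
  exact: noise_size_even_moment_ereal.
exact/all_momentsX/noise_size_all_moments.
Qed.

Lemma time_away_all_moments t : 0 <= t -> all_moments P (time_away X i0 t).
Proof.
move=> t0; apply: (@all_moments_bounded _ _ _ _ _ t) => [|w].
  apply: jointly_measurable_section1.
  apply: (time_integral_jointly_measurable (D := fun s w => (X (Num.max s 0) w != i0)%:R)).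
  exact: (chain_comp_jointly_measurable mX rcX (fun x => (x != i0)%:R)).
rewrite -[leRHS]mul1r -(time_integral_cst 1 t0).
apply: normr_time_integral_le; last 2 first.
- exact: bounded_on_cst.
- by move=> s _; rewrite ger0_norm//; case: (_ != _).
exact: (chain_bounded_on mX rcX t w (fun x => (x != i0)%:R)).
Qed.

Lemma time_away_mean t : 0 <= t <= h0 -> \int[P]_w time_away X i0 t w <= kappa * t ^+ 2.
Proof.
move=> /andP[t0 th]; rewrite -lee_fin -all_moments_integral; last exact: time_away_all_moments.
pose G s w : R := (X (Num.max s 0) w != i0)%:R.
have mG : jointly_measurable G.
  exact: (chain_comp_jointly_measurable mX rcX (fun x => (x != i0)%:R)).
have G0 s w : 0 <= G s w by rewrite /G.
have -> : (\int[P]_w (time_away X i0 t w)%:E =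
    \int[P]_w \int[leb]_(s in `[0%R, t]) (G s w)%:E)%E.
  apply: eq_integral => w _; rewrite /time_away /Rintegral fineK//.
  apply: integrable_fin_num => //; apply: bounded_on_integrable.
  exact: (chain_bounded_on mX rcX t w (fun x => (x != i0)%:R)).
rewrite (tonelli_time P (measurable_itv `[0, t]) mG G0).
apply: (@le_trans _ _ (\int[leb]_(s in `[0%R, t]) (kappa * t)%:E)%E).
  apply: ge0_le_integral => //.
  - by move=> s _; apply: integral_ge0 => w _; rewrite lee_fin.
  - by apply: measurable_funTS; exact: measurable_mean_time.
  - move=> s /=; rewrite in_itv/= => /andP[s0 st].
    rewrite /G (max_idPl s0) all_moments_integral; last first.
      exact: (chain_all_moments noise (fun x => (x != i0)%:R)).
    rewrite lee_fin (le_trans (exit_mean noise exitX startX _))//.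
      by rewrite s0 (le_trans st).
    by rewrite ler_wpM2l.
rewrite integral_cst//= lebesgue_measure_itv/= lte_fin.
case: ifPn => _; last by rewrite mule0 lee_fin mulr_ge0// sqr_ge0.
by rewrite -EFinD -EFinM subr0 lee_fin -mulrA -expr2.
Qed.

Lemma start_all_moments : all_moments P (M 0).
Proof. apply: all_moments_ae startM (all_moments_cst P m); exact: mM. Qed.

Lemma compensator_all_moments t : 0 < t <= h0 -> C * t <= 1 / 2 -> all_moments P (comp t).
Proof.
move=> t0 Ct; have tge0 : 0 <= t by case/andP : t0 => /ltW.
pose V w := 2 * (C * (1 + `|M 0 w|) * t + C * ns t w).
have VP : all_moments P V.
  apply: all_momentsZ; apply: all_momentsD; last first.
    exact/all_momentsZ/noise_size_all_moments.
  apply: all_momentsM; last exact: all_moments_cst.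
  apply: all_momentsZ; apply: all_momentsD; first exact: all_moments_cst.
  exact/all_moments_norm/start_all_moments.
apply: le_all_moments VP => [|w].
  apply: jointly_measurable_section1.
  exact: (compensator_jointly_measurable al ga mX rcX mM cM).
apply: le_trans (path_compensator_le mX rcX mM cM alC gaC w tge0 Ct) _.
exact: ler_norm.
Qed.

Lemma path_all_moments t : 0 < t <= h0 -> C * t <= 1 / 2 -> all_moments P (M t).
Proof.
move=> t0 Ct; have tge0 : 0 <= t by case/andP : t0 => /ltW.
have -> : M t = fun w => M 0 w + comp t w + np t w.
  by apply/funext => w; rewrite /noise_part (max_idPl tge0); ring.
apply: all_momentsD.
  by apply: all_momentsD; [exact: start_all_moments|exact: compensator_all_moments].
by apply: noise_part_all_moments; case/andP : t0 => /ltW -> ->.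
Qed.

(** The inequality between arithmetic and geometric means with a free scale [l], to be chosen as the
    expected order of magnitude of [U]. *)
Lemma mean_le_sqr (U : T -> R) (l : R) : 0 < l -> all_moments P U ->
  \int[P]_w U w <= (l + \int[P]_w (U w ^+ 2) / l) / 2.
Proof.
move=> l0 UP; have U2 := all_momentsX 2 UP.
have -> : (l + \int[P]_w (U w ^+ 2) / l) / 2 =
    \int[P]_w (l / 2 + (2 * l)^-1 * U w ^+ 2).
  rewrite meanD; [|exact: all_moments_cst|exact: all_momentsZ].
  by rewrite mean_cst meanZ//; field; rewrite gt_eqF.
apply: le_mean => //.
  by apply: all_momentsD; [exact: all_moments_cst|exact: all_momentsZ].
move=> w; rewrite -subr_ge0.
have -> : l / 2 + (2 * l)^-1 * U w ^+ 2 - U w = (2 * l)^-1 * (l - U w) ^+ 2.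
  by field; rewrite gt_eqF.
by rewrite mulr_ge0 ?sqr_ge0// invr_ge0 mulr_ge0// ltW.
Qed.

Lemma compensator_mean s i : 0 < s -> s ^+ 2 <= h0 -> C * s ^+ 2 <= 1 / 2 -> s <= 1 ->
  `|\int[P]_w ((X (s ^+ 2) w == i)%:R * comp (s ^+ 2) w) -
    (i0 == i)%:R * (s ^+ 2 * (al i0 - ga i0 * m))| <=
  (4 * C * kappa + 2 * C ^+ 2 + C * (1 + ito_moment_bound C 1)) * (1 + `|m|) * s ^+ 3.
Proof.
move=> s0 sh Cs s1; set t := s ^+ 2.
have t0 : 0 < t by rewrite exprn_gt0.
have th : 0 < t <= h0 by rewrite t0.
have th' : 0 <= t <= h0 by rewrite ltW.
have MP := start_all_moments; have AP := compensator_all_moments th Cs.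
have qP := noise_size_all_moments th Cs.
have eP := time_away_all_moments (ltW t0).
have oneP (g : 'I_d.+1 -> R) : all_moments P (fun w => g (X t w)).
  by apply: (chain_all_moments noise); exact: ltW.
have XiP := oneP (fun x => (x == i)%:R); have XneP := oneP (fun x => (x != i0)%:R).
pose Z w := (X t w == i)%:R * comp t w - (i0 == i)%:R * (t * (al i0 - ga i0 * M 0 w)).
have ZcP : all_moments P (fun w => (i0 == i)%:R * (t * (al i0 - ga i0 * M 0 w))).
  do 2 apply: all_momentsZ; apply: all_momentsB; first exact: all_moments_cst.
  exact: all_momentsZ.
have ZP : all_moments P Z by apply: all_momentsB => //; exact: all_momentsM.
have -> : \int[P]_w ((X t w == i)%:R * comp t w) -
    (i0 == i)%:R * (t * (al i0 - ga i0 * m)) = \int[P]_w Z w.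
  rewrite meanB//; last exact: all_momentsM.
  congr (_ - _); rewrite -[LHS](mean_cst P); apply: eq_mean_ae.
  - exact: measurable_cst.
  - exact: all_moments_measurable ZcP.
  - by apply: filterS startM => w ->.
pose V w := 2 * C * (1 + `|m|) * (t * (X t w != i0)%:R + time_away X i0 t w) +
  C * (2 * ns t w + 2 * C * (1 + `|m|) * t ^+ 2).
have V1 : all_moments P (fun w => t * (X t w != i0)%:R + time_away X i0 t w).
  by apply: all_momentsD => //; exact: all_momentsZ.
have V2 : all_moments P (fun w => 2 * ns t w + 2 * C * (1 + `|m|) * t ^+ 2).
  by apply: all_momentsD; [exact: all_momentsZ|exact: all_moments_cst].
have VP : all_moments P V by apply: all_momentsD; exact: all_momentsZ.
apply: (@le_trans _ _ (\int[P]_w `|Z w|)).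
  by apply: normr_mean_le => //; exact: all_moments_norm.
apply: (@le_trans _ _ (\int[P]_w V w)).
  apply: le_mean_ae => //; first exact: all_moments_norm.
  apply: filterS startM => w Mw.
  have := path_drift_approx mX rcX mM cM alC gaC w (ltW t0) Cs i0 i.
  by rewrite /Z /V Mw.
rewrite /V meanD; [|exact: all_momentsZ|exact: all_momentsZ].
rewrite !meanZ// !meanD//; [|exact: all_momentsZ|exact: all_moments_cst|exact: all_momentsZ].
rewrite mean_cst !meanZ//.
have h1 := exit_mean noise exitX startX th'.
have h2 := time_away_mean th'.
(* The scale is [s ^+ 3], since the second moment of [ns t] is of order [t ^+ 3 = s ^+ 6]. *)
have h3 : \int[P]_w ns t w <= (1 + ito_moment_bound C 1) / 2 * s ^+ 3.
  have s3 : 0 < s ^+ 3 by rewrite exprn_gt0.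
  apply: le_trans (mean_le_sqr s3 qP) _.
  have := noise_size_even_moment 1 th Cs.
  rewrite -[1.*2]/2%N expr1 => h.
  have : \int[P]_w (ns t w ^+ 2) / s ^+ 3 <= ito_moment_bound C 1 * s ^+ 3.
    rewrite ler_pdivrMr//; apply: le_trans h _.
    by rewrite le_eqVlt; apply/orP; left; apply/eqP; rewrite /t; ring.
  lra.
have m1 : 1 <= 1 + `|m| by rewrite lerDl.
have s34 : s ^+ 4 <= s ^+ 3 by rewrite (exprS s 3) ler_piMl// exprn_ge0// ltW.
have t4 : t ^+ 2 = s ^+ 4 by rewrite /t -exprM.
have k1 : t * \int[P]_w (X t w != i0)%:R + \int[P]_w time_away X i0 t w <= 2 * kappa * s ^+ 3.
  have : t * \int[P]_w (X t w != i0)%:R <= t * (kappa * t) by rewrite ler_wpM2l// ltW.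
  have -> : t * (kappa * t) = kappa * s ^+ 4 by rewrite -t4; ring.
  have := h2; rewrite t4; have := ler_wpM2l kappa0 s34; lra.
have b0 : 0 <= ito_moment_bound C 1 := ito_moment_bound_ge0 C 1.
have s30 : 0 <= s ^+ 3 by rewrite exprn_ge0// ltW.
have k2 : 2 * \int[P]_w ns t w + 2 * C * (1 + `|m|) * t ^+ 2 <=
   (1 + ito_moment_bound C 1 + 2 * C) * (1 + `|m|) * s ^+ 3.
  have : (1 + ito_moment_bound C 1) * s ^+ 3 <= (1 + ito_moment_bound C 1) * s ^+ 3 * (1 + `|m|).
    by rewrite ler_peMr// mulr_ge0// addr_ge0.
  have : 2 * C * (1 + `|m|) * t ^+ 2 <= 2 * C * (1 + `|m|) * s ^+ 3.
    by rewrite t4 ler_wpM2l// !mulr_ge0// addr_ge0.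
  lra.
have c1 : 0 <= 2 * C * (1 + `|m|) by rewrite !mulr_ge0// addr_ge0.
have := lerD (ler_wpM2l c1 k1) (ler_wpM2l C0 k2).
move/le_trans; apply; rewrite le_eqVlt; apply/orP; left; apply/eqP; ring.
Qed.

End OUMoments.

(** * Second-order expansions in the root of time *)

Section Tame.
Context {R : realType} {E : Type} {dT} {T : measurableType dT}.
Variables (P : E -> probability T R) (rho : E -> R) (s1 : R).
Hypothesis rho1 : forall x, 1 <= rho x.
Hypothesis s10 : 0 < s1 <= 1.

Let rhoX1 x n : 1 <= rho x ^+ n. Proof. exact: exprn_ege1. Qed.
Let rhoX0 x n : 0 <= rho x ^+ n. Proof. exact: le_trans ler01 (rhoX1 x n). Qed.
Let rhoX_le x m n : (m <= n)%N -> rho x ^+ m <= rho x ^+ n.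
Proof. exact: ler_weXn2l. Qed.

Definition poly_bounded (c : E -> R) : Prop :=
  exists C q, 0 <= C /\ forall x, `|c x| <= C * rho x ^+ q.

Lemma poly_bounded_cst (a : R) : poly_bounded (fun=> a).
Proof. by exists `|a|, 0%N; split=> // x; rewrite expr0 mulr1. Qed.

Lemma poly_boundedD a b : poly_bounded a -> poly_bounded b ->
  poly_bounded (fun x => a x + b x).
Proof.
move=> [C [q [C0 aC]]] [D [r [D0 bD]]]; exists (C + D), (q + r)%N.
split=> [|x]; first exact: addr_ge0.
apply: le_trans (ler_normD _ _) _; rewrite mulrDl; apply: lerD.
  by apply: le_trans (aC x) _; rewrite ler_wpM2l// rhoX_le// leq_addr.
by apply: le_trans (bD x) _; rewrite ler_wpM2l// rhoX_le// leq_addl.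
Qed.

Lemma poly_boundedM a b : poly_bounded a -> poly_bounded b ->
  poly_bounded (fun x => a x * b x).
Proof.
move=> [C [q [C0 aC]]] [D [r [D0 bD]]]; exists (C * D), (q + r)%N.
split=> [|x]; first exact: mulr_ge0.
by rewrite normrM exprD mulrACA ler_pM.
Qed.

Lemma poly_bounded_prod (I : Type) (r : seq I) (Q : pred I) (c : I -> E -> R) :
  (forall i, poly_bounded (c i)) -> poly_bounded (fun x => \prod_(i <- r | Q i) c i x).
Proof.
move=> cP; elim: r => [|i r ih].
  by under eq_fun do rewrite big_nil; exact: poly_bounded_cst.
under eq_fun do rewrite big_cons; case: (Q i) => //; exact: poly_boundedM.
Qed.

Lemma poly_boundedX c n : poly_bounded c -> poly_bounded (fun x => c x ^+ n).
Proof.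
move=> cP; elim: n => [|n ih].
  by under eq_fun do rewrite expr0; exact: poly_bounded_cst.
by under eq_fun do rewrite exprS; exact: poly_boundedM.
Qed.

(** Boundedness of all moments, uniformly in the scale [s] and up to a power of the weight of the
    starting point. Tame quantities are closed under sums and products. The weight is kept abstract
    because it is later taken both as [start_weight] and as the constant 1. *)
Definition tame (U : R -> E -> T -> R) : Prop :=
  (forall s x, 0 < s <= s1 -> all_moments (P x) (U s x)) /\
  forall p, exists C q, 0 <= C /\ forall s x, 0 < s <= s1 ->
    \int[P x]_w (U s x w ^+ p.*2) <= C * rho x ^+ q.

Implicit Types (U V : R -> E -> T -> R) (a b c : E -> R) (G H : R -> E -> R).

Lemma le_tame U V :
  (forall s x, 0 < s <= s1 -> measurable_fun setT (U s x)) ->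
  (forall s x w, 0 < s <= s1 -> `|U s x w| <= `|V s x w|) -> tame V -> tame U.
Proof.
move=> mU UV [VP VC].
have UP s x : 0 < s <= s1 -> all_moments (P x) (U s x).
  by move=> hs; apply: le_all_moments (VP s x hs) => [|w]; [exact: mU|exact: UV].
split=> // p; have [C [q [C0 hC]]] := VC p; exists C, q; split=> // s x hs.
apply: le_trans (hC s x hs); apply: le_mean; [exact/all_momentsX/UP|exact/all_momentsX/VP|].
move=> w; rewrite -[leLHS]ger0_norm ?exprn_even_ge0 ?odd_double//.
rewrite -[leRHS]ger0_norm ?exprn_even_ge0 ?odd_double//.
by rewrite !normrX lerXn2r ?nnegrE// UV.
Qed.

Lemma tame_poly_bounded c : poly_bounded c -> tame (fun _ x _ => c x).
Proof.
move=> cP; split=> [s x _|p]; first exact: all_moments_cst.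
have [C [q [C0 hC]]] := poly_boundedX p.*2 cP; exists C, q; split=> // s x _.
rewrite mean_cst; exact: le_trans (ler_norm _) (hC x).
Qed.

Lemma tame_time : tame (fun s _ _ => s).
Proof.
split=> [s x _|p]; first exact: all_moments_cst.
exists 1, 0%N; split=> // s x /andP[s0 ss1]; rewrite mean_cst mulr1.
apply: exprn_ile1; first exact: ltW.
by apply: le_trans ss1 _; case/andP : s10.
Qed.

Lemma tameD U V : tame U -> tame V -> tame (fun s x w => U s x w + V s x w).
Proof.
move=> [UP UC] [VP VC]; split=> [s x hs|p]; first by apply: all_momentsD; auto.
have [C [q [C0 hC]]] := UC p; have [D [r [D0 hD]]] := VC p.
exists (2 ^+ p.*2 * (C + D)), (q + r)%N.
split=> [|s x hs]; first by rewrite mulr_ge0 ?exprn_ge0// addr_ge0.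
have U2 := all_momentsX p.*2 (UP s x hs); have V2 := all_momentsX p.*2 (VP s x hs).
apply: (@le_trans _ _ (\int[P x]_w (2 ^+ p.*2 * (U s x w ^+ p.*2 + V s x w ^+ p.*2)))).
  apply: le_mean.
  - by apply: all_momentsX; apply: all_momentsD; auto.
  - by apply: all_momentsZ; apply: all_momentsD.
  move=> w; have e (a : R) : a ^+ p.*2 = `|a| ^+ p.*2.
    by rewrite -normrX ger0_norm// exprn_even_ge0// odd_double.
  rewrite e (e (U s x w)) (e (V s x w)); exact: normr_exp2D.
rewrite meanZ; last exact: all_momentsD.
rewrite meanD// -mulrA ler_wpM2l ?exprn_ge0// mulrDl; apply: lerD.
  by apply: le_trans (hC s x hs) _; rewrite ler_wpM2l// rhoX_le// leq_addr.
by apply: le_trans (hD s x hs) _; rewrite ler_wpM2l// rhoX_le// leq_addl.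
Qed.

Lemma tameM U V : tame U -> tame V -> tame (fun s x w => U s x w * V s x w).
Proof.
move=> [UP UC] [VP VC]; split=> [s x hs|p]; first by apply: all_momentsM; auto.
have [C [q [C0 hC]]] := UC p.*2; have [D [r [D0 hD]]] := VC p.*2.
exists (C + D), (q + r)%N; split=> [|s x hs]; first exact: addr_ge0.
have U2 := all_momentsX p.*2.*2 (UP s x hs).
have V2 := all_momentsX p.*2.*2 (VP s x hs).
apply: (@le_trans _ _ (\int[P x]_w (U s x w ^+ p.*2.*2 + V s x w ^+ p.*2.*2))).
  apply: le_mean; [by apply: all_momentsX; apply: all_momentsM; auto|exact: all_momentsD|].
  move=> w; have e n (a : R) : a ^+ n.*2 = `|a| ^+ n.*2.
    by rewrite -normrX ger0_norm// exprn_even_ge0// odd_double.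
  by rewrite (e p) (e p.*2 (U s x w)) (e p.*2 (V s x w)); exact: normr_expM_le.
rewrite meanD// mulrDl; apply: lerD.
  by apply: le_trans (hC s x hs) _; rewrite ler_wpM2l// rhoX_le// leq_addr.
by apply: le_trans (hD s x hs) _; rewrite ler_wpM2l// rhoX_le// leq_addl.
Qed.

Lemma tame_sum (I : Type) (r : seq I) (Q : pred I) (U : I -> R -> E -> T -> R) :
  (forall i, tame (U i)) -> tame (fun s x w => \sum_(i <- r | Q i) U i s x w).
Proof.
move=> UP; elim: r => [|i r ih].
  suff -> : (fun s x w => \sum_(i <- [::] | Q i) U i s x w) = (fun _ _ _ => 0).
    exact/tame_poly_bounded/poly_bounded_cst.
  by do 3 apply/funext => ?; rewrite big_nil.
suff -> : (fun s x w => \sum_(i <- i :: r | Q i) U i s x w) =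
    (fun s x w => (if Q i then U i s x w else 0) + \sum_(i <- r | Q i) U i s x w).
  apply: tameD => //; case: (Q i) => //; exact/tame_poly_bounded/poly_bounded_cst.
by do 3 apply/funext => ?; rewrite big_cons; case: (Q i) => //; rewrite add0r.
Qed.

(* G = o(s^2), uniformly up to a power of the weight. *)
Definition subquadratic (G : R -> E -> R) : Prop :=
  exists q, forall e, 0 < e -> exists2 s0, 0 < s0 <= s1 &
    forall s x, 0 < s <= s0 -> `|G s x| <= e * s ^+ 2 * rho x ^+ q.

Lemma eq_subquadratic G H : (forall s x, 0 < s <= s1 -> G s x = H s x) ->
  subquadratic G -> subquadratic H.
Proof.
move=> GH [q hq]; exists q => e /hq[s0 /andP[s00 s01] hs]; exists s0; first exact/andP.
move=> s x /andP[sg sl]; rewrite -GH; first by apply: hs; rewrite sg.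
by rewrite sg (le_trans sl).
Qed.

Lemma subquadratic_cube C q (G : R -> E -> R) :
  (forall s x, 0 < s <= s1 -> `|G s x| <= C * rho x ^+ q * s ^+ 3) -> subquadratic G.
Proof.
move=> h; exists q => e e0; have [s10' s11] := andP s10.
have D0 : 0 < 1 + `|C| by rewrite ltr_pwDl.
exists (Num.min s1 (e / (1 + `|C|))).
  by rewrite lt_min s10' divr_gt0// ge_min lexx.
move=> s x /andP[s0]; rewrite le_min => /andP[ss1 se].
apply: le_trans (h s x _) _; first by rewrite s0.
rewrite (exprS s 2) (_ : C * _ * _ = C * s * (s ^+ 2 * rho x ^+ q)); last by ring.
rewrite -[leRHS]mulrA ler_wpM2r//; first by rewrite mulr_ge0// sqr_ge0.
apply: (@le_trans _ _ ((1 + `|C|) * s)).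
  by rewrite ler_wpM2r ?ltW//; have := ler_norm C; lra.
by rewrite mulrC -ler_pdivlMr.
Qed.

Lemma subquadraticD G H : subquadratic G -> subquadratic H ->
  subquadratic (fun s x => G s x + H s x).
Proof.
move=> [q hG] [r hH]; exists (q + r)%N => e e0.
have e20 : 0 < e / 2 by rewrite divr_gt0.
have [a /andP[a0 a1] ha] := hG _ e20; have [b /andP[b0 b1] hb] := hH _ e20.
exists (Num.min a b); first by rewrite lt_min a0 b0 ge_min a1.
move=> s x /andP[s0]; rewrite le_min => /andP[sa sb].
apply: le_trans (ler_normD _ _) _.
have -> : e * s ^+ 2 * rho x ^+ (q + r) =
  e / 2 * s ^+ 2 * rho x ^+ (q + r) + e / 2 * s ^+ 2 * rho x ^+ (q + r) by field.
have es : 0 <= e / 2 * s ^+ 2 by rewrite mulr_ge0 ?sqr_ge0// ltW.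
apply: lerD.
  apply: le_trans (ha s x _) _; first by rewrite s0.
  by rewrite ler_wpM2l// rhoX_le// leq_addr.
apply: le_trans (hb s x _) _; first by rewrite s0.
by rewrite ler_wpM2l// rhoX_le// leq_addl.
Qed.

Lemma subquadraticM c G : poly_bounded c -> subquadratic G ->
  subquadratic (fun s x => c x * G s x).
Proof.
move=> [C [r [C0 hc]]] [q hG]; exists (r + q)%N => e e0.
have D0 : 0 < 1 + C by rewrite ltr_pwDl.
have [a ha h] := hG _ (divr_gt0 e0 D0); exists a => // s x hs.
rewrite normrM; apply: le_trans (ler_pM _ _ (hc x) (h s x hs)) _ => //.
rewrite exprD; have K : 0 <= s ^+ 2 * (rho x ^+ r * rho x ^+ q).
  by apply: mulr_ge0; [exact: sqr_ge0|exact: mulr_ge0].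
have -> : C * rho x ^+ r * (e / (1 + C) * s ^+ 2 * rho x ^+ q) =
  C / (1 + C) * e * (s ^+ 2 * (rho x ^+ r * rho x ^+ q)) by ring.
rewrite -(mulrA e) ler_wpM2r// -[leRHS]mul1r ler_wpM2r ?(ltW e0)//.
by rewrite ler_pdivrMr// mul1r lerDr.
Qed.

Lemma subquadratic_sum (I : Type) (r : seq I) (Q : pred I) (G : I -> R -> E -> R) :
  (forall i, Q i -> subquadratic (G i)) -> subquadratic (fun s x => \sum_(i <- r | Q i) G i s x).
Proof.
move=> GP; elim: r => [|i r ih].
  apply: (@subquadratic_cube 0 0%N) => s x _; by rewrite big_nil normr0 !mul0r.
have [Qi|nQi] := boolP (Q i).
  apply: eq_subquadratic (subquadraticD (GP i Qi) ih) => s x _.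
  by rewrite big_cons Qi.
by apply: eq_subquadratic ih => s x _; rewrite big_cons (negbTE nQi).
Qed.

(** From [|chi * U| <= 1 + U ^+ 2]: any tame remainder carrying the factor [s ^+ 3] is negligible,
    whatever its form. *)
Lemma subquadratic_tame (U chi : R -> E -> T -> R) : tame U ->
  (forall s x, 0 < s <= s1 -> all_moments (P x) (chi s x)) ->
  (forall s x w, `|chi s x w| <= 1) ->
  subquadratic (fun s x => s ^+ 3 * \int[P x]_w (chi s x w * U s x w)).
Proof.
move=> [UP UC] chiP chi1; have [C [q [C0 hC]]] := UC 1%N.
apply: (@subquadratic_cube (1 + C) q) => s x hs; have s0 : 0 <= s by case/andP: hs => /ltW.
rewrite normrM [X in X * _]ger0_norm ?exprn_ge0// mulrC ler_wpM2r ?exprn_ge0//.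
have U2 := all_momentsX 2 (UP s x hs).
apply: (@le_trans _ _ (\int[P x]_w (1 + U s x w ^+ 2))).
  apply: normr_mean_le; [by apply: all_momentsM; auto|by apply: all_momentsD => //; exact: all_moments_cst|].
  move=> w; rewrite normrM; apply: (@le_trans _ _ `|U s x w|).
    by rewrite ler_piMl.
  rewrite -(real_normK (num_real (U s x w))); set a := `|_|.
  by have := sqr_ge0 (a - 1); nra.
rewrite meanD//; last exact: all_moments_cst.
rewrite mean_cst mulrDl mul1r; apply: lerD; [exact: rhoX1|exact: hC].
Qed.

End Tame.

Section Expansion.
Context {R : realType} {E : Type} {dT} {T : measurableType dT} {J : nat}.
Variables (P : E -> probability T R) (rho : E -> R) (s1 : R).
Hypothesis rho1 : forall x, 1 <= rho x.
Hypothesis s10 : 0 < s1 <= 1.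
Variable y : 'I_J -> R -> E -> T -> R.
Hypothesis y_tame : forall j, tame P rho s1 (y j).
Local Notation poly := (poly_bounded rho).
Local Notation tm := (tame P rho s1).
Local Notation negl := (subquadratic rho s1).
Implicit Types (F G : R -> E -> T -> R) (f g : E -> R) (df dd dg gg : 'I_J -> E -> R).

(* F is a second-order Taylor polynomial in the increments s * y_j; only the
   diagonal part dd of its Hessian is recorded. *)
Definition expands F f df dd : Prop :=
  [/\ poly f, forall j, poly (df j) &
    exists c r, [/\ forall j l, poly (c j l), forall j x, c j j x = dd j x / 2, tm r &
      forall s x w, F s x w = f x + s * (\sum_j df j x * y j s x w)
        + s ^+ 2 * (\sum_j \sum_l c j l x * (y j s x w * y l s x w))
        + s ^+ 3 * r s x w]].

Lemma eq_expands F f df dd G g dg gg : (forall s x w, F s x w = G s x w) ->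
  f =1 g -> (forall j, df j =1 dg j) -> (forall j, dd j =1 gg j) ->
  expands F f df dd -> expands G g dg gg.
Proof.
move=> FG fg dfg ddg [fP dfP [c [r [cP c2 rP FE]]]].
have <- : f = g by apply/funext.
have <- : df = dg by apply/funext => j; apply/funext.
have <- : dd = gg by apply/funext => j; apply/funext.
by split=> //; exists c, r; split=> // s x w; rewrite -FG.
Qed.

Let zero_poly : poly (fun=> 0). Proof. exact: poly_bounded_cst. Qed.
Let zero_tame : tm (fun _ _ _ => 0). Proof. exact: tame_poly_bounded. Qed.

Lemma expands1 : expands (fun _ _ _ => 1) (fun=> 1) (fun _ _ => 0) (fun _ _ => 0).
Proof.
split=> [|j|]; [exact: poly_bounded_cst|exact: zero_poly|].
exists (fun _ _ _ => 0), (fun _ _ _ => 0); split=> // [j x|s x w]; first by rewrite mul0r.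
rewrite big1 => [|j _]; last by rewrite mul0r.
rewrite [X in s ^+ 2 * X]big1 => [|j _]; first by rewrite !mulr0 !addr0.
by rewrite big1// => l _; rewrite mul0r.
Qed.

Lemma expands_var j (m : E -> R) : poly m ->
  expands (fun s x w => m x + s * y j s x w) m (fun l _ => (l == j)%:R) (fun _ _ => 0).
Proof.
move=> mP; split=> [//|l|]; first exact: poly_bounded_cst.
exists (fun _ _ _ => 0), (fun _ _ _ => 0); split=> // [l x|s x w]; first by rewrite mul0r.
rewrite (bigD1 j)//= eqxx mul1r big1 => [|l /negbTE->]; last by rewrite mul0r.
rewrite [X in s ^+ 2 * X]big1 => [|l _]; first by rewrite !mulr0 !addr0.
by rewrite big1// => k _; rewrite mul0r.
Qed.

(** Multiplication of second-order Taylor polynomials: the diagonal of the Hessian follows Leibniz's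
    rule, and all products of total order at least 3 go into the remainder, which is tame because
    its pieces are. *)
Lemma expandsM F f df dd G g dg gg : expands F f df dd -> expands G g dg gg ->
  expands (fun s x w => F s x w * G s x w) (fun x => f x * g x)
    (fun j x => f x * dg j x + g x * df j x)
    (fun j x => f x * gg j x + g x * dd j x + 2 * (df j x * dg j x)).
Proof.
move=> [fP dfP [c [r [cP c2 rP FE]]]] [gP dgP [e [q [eP e2 qP GE]]]].
have dot_tame h : (forall j, poly (h j)) -> tm (fun s x w => \sum_j h j x * y j s x w).
  move=> hP; apply: (@tame_sum _ _ _ _ P rho s1 rho1 _ _ _ (fun j s x w => h j x * y j s x w)) => j.
  by apply: tameM => //; exact: (tame_poly_bounded P s1 (hP j)).
have quad_tame h : (forall j l, poly (h j l)) ->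
    tm (fun s x w => \sum_j \sum_l h j l x * (y j s x w * y l s x w)).
  move=> hP; apply: (@tame_sum _ _ _ _ P rho s1 rho1 _ _ _ (fun j s x w => \sum_l h j l x * (y j s x w * y l s x w))) => j.
  apply: (@tame_sum _ _ _ _ P rho s1 rho1 _ _ _ (fun l s x w => h j l x * (y j s x w * y l s x w))) => l.
  by apply: tameM => //; [exact: (tame_poly_bounded P s1 (hP j l))|exact: tameM].
split=> [|j|]; first exact: poly_boundedM.
  by apply: poly_boundedD => //; exact: poly_boundedM.
pose L1 s x w := \sum_j df j x * y j s x w.
pose L2 s x w := \sum_j dg j x * y j s x w.
pose q1 s x w := \sum_j \sum_l c j l x * (y j s x w * y l s x w).
pose q2 s x w := \sum_j \sum_l e j l x * (y j s x w * y l s x w).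
have L1P : tm L1 := dot_tame _ dfP. have L2P : tm L2 := dot_tame _ dgP.
have q1P : tm q1 := quad_tame _ cP. have q2P : tm q2 := quad_tame _ eP.
exists (fun j l x => f x * e j l x + g x * c j l x + df j x * dg l x).
(* The terms of orders 3 to 6 in [s], with [s ^+ 3] divided out. *)
exists (fun s x w => L1 s x w * q2 s x w + L2 s x w * q1 s x w
  + (f x * q s x w + g x * r s x w)
  + s * (q1 s x w * q2 s x w + L1 s x w * q s x w + L2 s x w * r s x w)
  + s * s * (q1 s x w * q s x w + q2 s x w * r s x w)
  + s * s * s * (r s x w * q s x w)); split=> [j l|j x||s x w].
- apply: poly_boundedD => //; last exact: poly_boundedM.
  by apply: poly_boundedD => //; exact: poly_boundedM.
- by rewrite e2 c2; field.
- have sP : tm (fun s _ _ => s) := tame_time P rho s10.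
  have fT : tm (fun _ x _ => f x) := tame_poly_bounded P s1 fP.
  have gT : tm (fun _ x _ => g x) := tame_poly_bounded P s1 gP.
  have ssP : tm (fun s _ _ => s * s) := tameM rho1 sP sP.
  have sssP : tm (fun s _ _ => s * s * s) := tameM rho1 ssP sP.
  have D U V := @tameD _ _ _ _ P rho s1 rho1 U V.
  have M U V := @tameM _ _ _ _ P rho s1 rho1 U V.
  have t1 := D _ _ (D _ _ (M _ _ L1P q2P) (M _ _ L2P q1P)) (D _ _ (M _ _ fT qP) (M _ _ gT rP)).
  have t2 := M _ _ sP (D _ _ (D _ _ (M _ _ q1P q2P) (M _ _ L1P qP)) (M _ _ L2P rP)).
  have t3 := M _ _ ssP (D _ _ (M _ _ q1P qP) (M _ _ q2P rP)).
  exact: (D _ _ (D _ _ (D _ _ t1 t2) t3) (M _ _ sssP (M _ _ rP qP))).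
- rewrite FE GE -/(L1 s x w) -/(L2 s x w) -/(q1 s x w) -/(q2 s x w).
  have -> : \sum_j (f x * dg j x + g x * df j x) * y j s x w = f x * L2 s x w + g x * L1 s x w.
    by rewrite /L1 /L2 !mulr_sumr -big_split/=; apply: eq_bigr => j _; ring.
  have -> : \sum_j \sum_l (f x * e j l x + g x * c j l x + df j x * dg l x) *
      (y j s x w * y l s x w) = f x * q2 s x w + g x * q1 s x w + L1 s x w * L2 s x w.
    rewrite /q1 /q2 /L1 /L2 mulr_suml !mulr_sumr -!big_split/=; apply: eq_bigr => j _.
    by rewrite !mulr_sumr -!big_split/=; apply: eq_bigr => l _; ring.
  by ring.
Qed.

(** Where the truncated exponents [n - 1] and [n - 2] differ from the true ones, the coefficients
    [n] and [n * (n - 1)] are 0. *)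
Lemma expands_varX j (m : E -> R) n : poly m ->
  expands (fun s x w => (m x + s * y j s x w) ^+ n) (fun x => m x ^+ n)
    (fun l x => (l == j)%:R * (n%:R * m x ^+ (n - 1)))
    (fun l x => (l == j)%:R * ((n * (n - 1))%:R * m x ^+ (n - 2))).
Proof.
move=> mP; elim: n => [|n ih].
  apply: eq_expands expands1 => [s x w|x|l x|l x]; rewrite ?expr0//.
  - by rewrite mul0r mulr0.
  - by rewrite mul0n mul0r mulr0.
apply: eq_expands (expandsM (expands_var j mP) ih) => [s x w|x|l x|l x].
- by rewrite exprS.
- by rewrite exprS.
- case: (l == j); rewrite ?mul0r ?mulr0 ?addr0// ?mul1r ?mulr1 subSS subn0.
  case: n {ih} => [|n]; first by rewrite mul0r mulr0 add0r mul1r.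
  by rewrite subSS subn0 (exprS _ n) -[in RHS]natr1; ring.
- case: (l == j); rewrite ?mul0r ?mulr0 ?addr0// ?mul1r subSS subn0.
  case: n {ih} => [|n]; first by rewrite !(mul0n, muln0) !(mul0r, mulr0) addr0.
  rewrite !subSS !subn0; case: n => [|n].
    by rewrite muln0 muln1 mul0r mulr0 add0r !expr0; ring.
  rewrite subSS subn0 !natrM (exprS _ n).
  by rewrite -(natr1 n.+2) -(natr1 n.+1); ring.
Qed.

(** Each factor depends on its own increment and each index occurs once, so the mixed term
    [2 * df * dg] of the product rule vanishes on the diagonal. *)
Lemma expands_prod (F : 'I_J -> R -> E -> T -> R) (f a b : 'I_J -> E -> R) (r : seq 'I_J) :
  uniq r ->
  (forall j, expands (F j) (f j) (fun l x => (l == j)%:R * a j x)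
               (fun l x => (l == j)%:R * b j x)) ->
  expands (fun s x w => \prod_(j <- r) F j s x w) (fun x => \prod_(j <- r) f j x)
    (fun l x => (l \in r)%:R * (a l x * \prod_(j <- r | j != l) f j x))
    (fun l x => (l \in r)%:R * (b l x * \prod_(j <- r | j != l) f j x)).
Proof.
move=> + FP; elim: r => [_|i r ih /= /andP[ir ur]].
  by apply: eq_expands expands1 => [s x w|x|l x|l x]; rewrite ?big_nil ?in_nil ?mul0r.
(* Since [i] is not in [r], excluding it from the product changes nothing. *)
have drop_i x : \prod_(j <- r | j != i) f j x = \prod_(j <- r) f j x.
  rewrite -big_filter; congr (\big[_/_]_(_ <- _) _).
  by apply/all_filterP/allP => j jr; apply: contraNneq ir => <-.
apply: eq_expands (expandsM (FP i) (ih ur)) => [s x w|x|l x|l x].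
- by rewrite big_cons.
- by rewrite big_cons.
- rewrite inE big_cons (eq_sym i); have [->|li] := eqVneq l i.
    by rewrite drop_i (negbTE ir) /=; ring.
  by rewrite /=; ring.
- rewrite inE big_cons (eq_sym i); have [->|li] := eqVneq l i.
    by rewrite drop_i (negbTE ir) /=; ring.
  by rewrite /=; ring.
Qed.

Variables (chi : R -> E -> T -> R) (delta h : E -> R) (b v : 'I_J -> E -> R).
Hypothesis chiP : forall s x, 0 < s <= s1 -> all_moments (P x) (chi s x).
Hypothesis chi1 : forall s x w, `|chi s x w| <= 1.
Hypothesis mean_chi :
  negl (fun s x => \int[P x]_w chi s x w - delta x - s ^+ 2 * h x).
Hypothesis mean_linear : forall j, negl (fun s x =>
  s * \int[P x]_w (chi s x w * y j s x w) - delta x * (s ^+ 2 * b j x)).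
Hypothesis mean_square : forall j, negl (fun s x =>
  s ^+ 2 * \int[P x]_w (chi s x w * y j s x w ^+ 2) - delta x * (s ^+ 2 * v j x)).
Hypothesis mean_cross : forall j l, j != l -> negl (fun s x =>
  s ^+ 2 * \int[P x]_w (chi s x w * (y j s x w * y l s x w))).

(** The mean is taken term by term: [delta] and [h] describe the indicator, [b] the drift and [v]
    the variance of the increments. The off-diagonal coefficients meet only negligible means, so the
    unrecorded part of the Hessian does not matter. *)
Lemma expands_mean F f df dd : expands F f df dd -> (forall j, poly (dd j)) ->
  negl (fun s x => \int[P x]_w (chi s x w * F s x w) - delta x * f x
    - s ^+ 2 * (h x * f x + delta x * (\sum_j (b j x * df j x + v j x * dd j x / 2)))).
Proof.
move=> [fP dfP [c [r [cP cdd rP FE]]]] ddP.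
pose quad_err j l s x := s ^+ 2 * \int[P x]_w (chi s x w * (y j s x w * y l s x w))
  - (j == l)%:R * (delta x * (s ^+ 2 * v j x)).
have quadP j l : negl (quad_err j l).
  have [<-|jl] := eqVneq j l.
    by apply: eq_subquadratic (mean_square j) => s x _; rewrite /quad_err eqxx mul1r expr2.
  apply: eq_subquadratic (mean_cross jl) => s x _.
  by rewrite /quad_err (negbTE jl) mul0r subr0.
have N0 := subquadraticM rho1 fP mean_chi.
have N1 : negl (fun s x => \sum_j df j x * (s * \int[P x]_w (chi s x w * y j s x w)
    - delta x * (s ^+ 2 * b j x))).
  apply: (@subquadratic_sum _ _ rho s1 rho1 s10 _ _ _
    (fun j s x => df j x * (s * \int[P x]_w (chi s x w * y j s x w)
      - delta x * (s ^+ 2 * b j x)))) => j _.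
  exact: (subquadraticM rho1 (dfP j) (mean_linear j)).
have N2 : negl (fun s x => \sum_j \sum_l c j l x * quad_err j l s x).
  apply: (@subquadratic_sum _ _ rho s1 rho1 s10 _ _ _
    (fun j s x => \sum_l c j l x * quad_err j l s x)) => j _.
  apply: (@subquadratic_sum _ _ rho s1 rho1 s10 _ _ _
    (fun l s x => c j l x * quad_err j l s x)) => l _.
  exact: (subquadraticM rho1 (cP j l) (quadP j l)).
have N3 := subquadratic_tame rho1 s10 rP chiP chi1.
apply: eq_subquadratic (subquadraticD rho1 (subquadraticD rho1 N0 N1) (subquadraticD rho1 N2 N3)).
move=> s x hs; have cx := chiP x hs.
have yP j : all_moments (P x) (y j s x) by have [h' _] := y_tame j; exact: h'.
have rx : all_moments (P x) (r s x) by have [h' _] := rP; exact: h'.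
have cyP j : all_moments (P x) (fun w => chi s x w * y j s x w) by exact: all_momentsM.
have cyyP j l : all_moments (P x) (fun w => chi s x w * (y j s x w * y l s x w)).
  by apply: all_momentsM => //; exact: all_momentsM.
have crP : all_moments (P x) (fun w => chi s x w * r s x w) by exact: all_momentsM.
have S1 : all_moments (P x) (fun w => \sum_j df j x * (chi s x w * y j s x w)).
  by apply: (@all_moments_sum _ _ _ (P x) _ _ _ (fun j w => df j x * (chi s x w * y j s x w))) => j; exact: all_momentsZ.
have S2' j : all_moments (P x) (fun w => \sum_l c j l x * (chi s x w * (y j s x w * y l s x w))).
  by apply: (@all_moments_sum _ _ _ (P x) _ _ _ (fun l w => c j l x * (chi s x w * (y j s x w * y l s x w)))) => l; exact: all_momentsZ.
have S2 : all_moments (P x) (fun w => \sum_j \sum_l c j l x * (chi s x w * (y j s x w * y l s x w))).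
  exact: (@all_moments_sum _ _ _ (P x) _ _ _ (fun j w => \sum_l c j l x * (chi s x w * (y j s x w * y l s x w)))).
have -> : \int[P x]_w (chi s x w * F s x w) = f x * \int[P x]_w chi s x w
    + s * (\sum_j df j x * \int[P x]_w (chi s x w * y j s x w))
    + (s ^+ 2 * (\sum_j \sum_l c j l x * \int[P x]_w (chi s x w * (y j s x w * y l s x w)))
    + s ^+ 3 * \int[P x]_w (chi s x w * r s x w)).
  have -> : \int[P x]_w (chi s x w * F s x w) = \int[P x]_w (
      (f x * chi s x w + s * (\sum_j df j x * (chi s x w * y j s x w)))
      + (s ^+ 2 * (\sum_j \sum_l c j l x * (chi s x w * (y j s x w * y l s x w)))
      + s ^+ 3 * (chi s x w * r s x w))).
    apply: eq_Rintegral => w _; rewrite FE.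
    have -> : \sum_j df j x * (chi s x w * y j s x w) = chi s x w * \sum_j df j x * y j s x w.
      by rewrite mulr_sumr; apply: eq_bigr => j _; ring.
    have -> : \sum_j \sum_l c j l x * (chi s x w * (y j s x w * y l s x w)) =
        chi s x w * \sum_j \sum_l c j l x * (y j s x w * y l s x w).
      rewrite mulr_sumr; apply: eq_bigr => j _; rewrite mulr_sumr.
      by apply: eq_bigr => l _; ring.
    by ring.
  rewrite meanD; [|by apply: all_momentsD; exact: all_momentsZ..].
  rewrite meanD; [|exact: all_momentsZ..].
  rewrite meanD; [|exact: all_momentsZ..].
  rewrite !meanZ// !mean_sum => [|j//|j]; last exact: all_momentsZ.
  congr (_ + s * _ + (s ^+ 2 * _ + _)).
    by apply: eq_bigr => j _; rewrite meanZ.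
  apply: eq_bigr => j _; rewrite mean_sum => [|l]; last exact: all_momentsZ.
  by apply: eq_bigr => l _; rewrite meanZ.
have -> : \sum_j df j x * (s * \int[P x]_w (chi s x w * y j s x w) - delta x * (s ^+ 2 * b j x))
   = s * (\sum_j df j x * \int[P x]_w (chi s x w * y j s x w))
     - s ^+ 2 * delta x * (\sum_j b j x * df j x).
  by rewrite !mulr_sumr -sumrB; apply: eq_bigr => j _; ring.
have -> : \sum_j \sum_l c j l x * quad_err j l s x =
   s ^+ 2 * (\sum_j \sum_l c j l x * \int[P x]_w (chi s x w * (y j s x w * y l s x w)))
   - s ^+ 2 * delta x * (\sum_j v j x * dd j x / 2).
  rewrite !mulr_sumr -sumrB; apply: eq_bigr => j _.
  rewrite mulr_sumr (bigD1 j)//= [in RHS](bigD1 j)//= {1}/quad_err eqxx mul1r cdd.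
  under eq_bigr => l lj do rewrite /quad_err eq_sym (negbTE lj) mul0r subr0.
  rewrite (_ : \sum_(l | l != j) c j l x * _ = \sum_(l | l != j) s ^+ 2 *
    (c j l x * \int[P x]_w (chi s x w * (y j s x w * y l s x w)))).
    by ring.
  by apply: eq_bigr => l _; ring.
by rewrite big_split/=; ring.
Qed.

End Expansion.

(** * Laws and exit probabilities of the chain *)

Section ChainLaw.
Context {R : realType} {d : nat} {dT} {T : measurableType dT}.
Variables (P : probability T R) (Q : 'M[R]_d.+1) (X : R -> T -> 'I_d.+1).
Variable p : R -> 'M[R]_d.+1.
Hypothesis hX : markov_chain P Q X.
Hypothesis hp : transition_semigroup Q p.

(** The semigroup supplied by the Markov property is exchanged for the fixed [p] by uniqueness, so
    bounds on [p] hold for every starting law. *)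
Lemma markov_chain_semigroup s t i j : 0 <= s <= t ->
  (P ([set w | X s w = i] `&` [set w | X t w = j]) =
   P [set w | X s w = i] * (p (t - s) i j)%:E)%E.
Proof.
move=> st; have [_ _ [q hq /(_ s t st i j setT)]] := hX.
rewrite (transition_semigroup_unique hp hq) ?subr_ge0; last by case/andP : st.
by rewrite setTI; apply; exact: sigma_familyT.
Qed.

Lemma mean_chain_eq s i : 0 <= s ->
  \int[P]_w ((X s w == i)%:R : R) = fine (P [set w | X s w = i]).
Proof.
move=> s0; rewrite -mean_indic; last first.
  have [mX _ _] := hX; rewrite -[X in measurable X]setTI.
  exact: (mX s s0 measurableT [set i]).
apply: eq_Rintegral => w _; rewrite indicE; congr (_%:R).
by congr nat_of_bool; apply/eqP/idP; rewrite inE.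
Qed.

Lemma mean_chain_pair s t i j : 0 <= s <= t ->
  \int[P]_w ((X s w == i)%:R * (X t w == j)%:R : R) =
  \int[P]_w ((X s w == i)%:R : R) * p (t - s) i j.
Proof.
move=> /andP[s0 st]; have [mX _ _] := hX.
have mXi u k : 0 <= u -> measurable [set w | X u w = k].
  by move=> u0; rewrite -[X in measurable X]setTI; exact: (mX u u0 measurableT [set k]).
have t0 := le_trans s0 st.
rewrite mean_chain_eq// -[p _ _ _]/(fine (p (t - s) i j)%:E) -fineM ?fin_num_measure//; last exact: mXi.
rewrite -markov_chain_semigroup ?s0// -mean_indic; last by apply: measurableI; exact: mXi.
apply: eq_Rintegral => w _; rewrite indicE -natrM mulnb; congr (_%:R).
by congr nat_of_bool; apply/andP/idP => [[/eqP h1 /eqP h2]|]; rewrite inE //= => -[-> ->].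
Qed.

(** The probability of being in the same state at both times is the average, over the law at time
    [s], of the diagonal entries of [p (t - s)]; each is at least [1 - kappa * (t - s)], whatever
    that law is. *)
Lemma chain_exit_le kappa h0 :
  (forall h, 0 <= h <= h0 -> forall i j, `|(p h - 1%:M) i j| <= kappa * h) ->
  forall s t, 0 <= s <= t -> t - s <= h0 ->
  (P [set w | X s w != X t w] <= (kappa * (t - s))%:E)%E.
Proof.
move=> hk s t /andP[s0 st] th; have t0 := le_trans s0 st; have [mX _ _] := hX.
have XP u i : 0 <= u -> all_moments P (fun w => (X u w == i)%:R).
  move=> u0; apply: (@all_moments_bounded _ _ _ _ _ 1) => [|w].
    by apply: (@measurable_ord_comp _ _ _ _ (X u) (fun k => (k == i)%:R)); exact: mX.
  by rewrite ger0_norm//; case: (_ == _).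
have mD : measurable [set w | X s w != X t w] := measurable_ord_neq (mX s s0) (mX t t0).
rewrite -[leLHS]fineK ?fin_num_measure// lee_fin -mean_indic//.
have -> : \int[P]_w (\1_[set w | X s w != X t w] w : R) =
    \int[P]_w (1 - \sum_i (X s w == i)%:R * (X t w == i)%:R).
  apply: eq_Rintegral => w _; rewrite indicE.
  rewrite (bigD1 (X s w))//= eqxx mul1r big1 ?addr0 => [|i /negbTE h].
    rewrite (_ : (w \in _) = (X s w != X t w)); last by apply/idP/idP; rewrite inE.
    by rewrite eq_sym; case: eqVneq => _; rewrite ?subrr ?subr0.
  by rewrite eq_sym h mul0r.
have SP i : all_moments P (fun w => (X s w == i)%:R * (X t w == i)%:R).
  by apply: all_momentsM; exact: XP.
rewrite meanB; [|exact: all_moments_cst|exact: all_moments_sum].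
rewrite mean_cst mean_sum// lerBlDr -lerBlDl.
have one : \sum_i \int[P]_w ((X s w == i)%:R : R) = 1.
  rewrite -mean_sum => [|i]; last exact: XP.
  rewrite -[RHS](mean_cst P); apply: eq_Rintegral => w _.
  by rewrite (bigD1 (X s w))//= eqxx big1 ?addr0// => i /negbTE h; rewrite eq_sym h.
have -> : 1 - kappa * (t - s) =
    \sum_i \int[P]_w ((X s w == i)%:R : R) * (1 - kappa * (t - s)).
  by rewrite -mulr_suml one mul1r.
apply: ler_sum => i _.
rewrite mean_chain_pair ?s0//.
apply: ler_wpM2l; first exact: mean_ge0.
have := hk (t - s) _ i i; rewrite subr_ge0 st th => /(_ isT).
rewrite !mxE eqxx mulr1n ler_norml => /andP[+ _].
by rewrite lerNl opprB lerBlDr -lerBlDl => /le_trans; apply; rewrite lexx.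
Qed.

Lemma chain_start_law i0 i t : {ae P, forall w, X 0 w = i0} -> 0 <= t ->
  \int[P]_w ((X t w == i)%:R : R) = p t i0 i.
Proof.
move=> startX t0; have [mX _ _] := hX.
have mi u k : 0 <= u -> measurable_fun setT (fun w => (X u w == k)%:R : R).
  by move=> u0; apply: (@measurable_ord_comp _ _ _ _ (X u) (fun l => (l == k)%:R)); exact: mX.
have := @mean_chain_pair 0 t i0 i; rewrite lexx t0 subr0 => /(_ isT).
have -> : \int[P]_w ((X 0 w == i0)%:R : R) = 1.
  rewrite -[RHS](mean_cst P); apply: eq_mean_ae; [exact: mi|exact: measurable_cst|].
  by apply: filterS startX => w ->; rewrite eqxx.
rewrite mul1r => <-; apply: eq_mean_ae; [exact: mi|by apply: measurable_funM; exact: mi|].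
by apply: filterS startX => w ->; rewrite eqxx mul1r.
Qed.

End ChainLaw.

(** Convexity of powers by induction: the gap in one step is [c * (1 - c)] times
    [(a - b) * (a ^+ n - b ^+ n)], a product of factors of the same sign. *)
Lemma convex_exprn {R : realFieldType} (c a b : R) n : 0 <= c <= 1 -> 0 <= a -> 0 <= b ->
  (c * a + (1 - c) * b) ^+ n <= c * a ^+ n + (1 - c) * b ^+ n.
Proof.
move=> /andP[c0 c1] a0 b0; have e0 : 0 <= 1 - c by rewrite subr_ge0.
elim: n => [|n ih]; first by rewrite !expr0 !mulr1 addrC subrK.
have s0 : 0 <= c * a + (1 - c) * b by rewrite addr_ge0// mulr_ge0.
rewrite exprS; apply: le_trans (ler_wpM2l s0 ih) _.
have ab : 0 <= (a - b) * (a ^+ n - b ^+ n).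
  have [h|/ltW h] := lerP a b.
    by rewrite -mulrNN mulr_ge0 // oppr_ge0 subr_le0// lerXn2r.
  by rewrite mulr_ge0// subr_ge0// lerXn2r.
have := mulr_ge0 (mulr_ge0 c0 e0) ab; rewrite !exprS; lra.
Qed.

(** * Stationary laws *)

Section Stationary.
Context {R : realType} {dE dT} {E : measurableType dE} {T : measurableType dT}.
Variables (P : E -> probability T R) (Y : {mfun T >-> E}) (mu : probability E R).
Hypothesis mP : forall U, measurable U -> measurable_fun setT (fun x => P x (Y @^-1` U)).
Hypothesis muE : forall U, measurable U -> mu U = (\int[mu]_x P x (Y @^-1` U))%E.

Lemma stationary_integral (f : E -> \bar R) : (forall x, (0 <= f x)%E) ->
  measurable_fun setT f -> (\int[mu]_x f x = \int[mu]_x \int[P x]_w f (Y w))%E.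
Proof.
move=> f0 mf.
rewrite (@integral_mixture _ _ _ _ _ mu (fun x => distribution (P x) Y) mu)//.
by apply: eq_integral => x _; rewrite ge0_integral_distribution.
Qed.

Lemma measurable_stationary_integral (f : E -> \bar R) : (forall x, (0 <= f x)%E) ->
  measurable_fun setT f -> measurable_fun setT (fun x => \int[P x]_w f (Y w))%E.
Proof.
move=> f0 mf.
rewrite (_ : (fun x => _) = (fun x => \int[distribution (P x) Y]_y f y)%E).
  exact: (measurable_fun_integral_kernel (l := fun x => distribution (P x) Y)).
by apply/funext => x; rewrite ge0_integral_distribution.
Qed.

(* Truncation avoids assuming that the integral of phi is finite. *)
Lemma lyapunov_integral_le (phi : E -> R) (c D : R) : measurable_fun setT phi ->
  (forall x, 0 <= phi x) -> 0 <= c < 1 -> 0 <= D ->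
  (forall x, \int[P x]_w (phi (Y w))%:E <= (c * phi x + D)%:E)%E ->
  (\int[mu]_x (phi x)%:E <= (D / (1 - c))%:E)%E.
Proof.
move=> mphi phi0 /andP[c0 c1] D0 drift; have e0 : 0 < 1 - c by rewrite subr_gt0.
pose lo N x := Num.min (phi x) N%:R.
pose hi N x := Num.min (c * phi x + D) N%:R.
(* [cut] vanishes where [phi] exceeds [N], so that [(1 - c) * cut + hi <= D + lo] pointwise.
   Stationarity gives that the mean of [lo] is at most that of [hi]; both are finite and cancel,
   which bounds the mean of [cut] uniformly in [N]. *)
pose cut N x := if phi x <= N%:R then phi x else 0.
have mlo N : measurable_fun setT (lo N).
  by apply: measurable_minr => //; exact: measurable_cst.
have mhi N : measurable_fun setT (hi N).
  apply: measurable_minr; last exact: measurable_cst.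
  by apply: measurable_funD => //; exact: measurable_funM.
have mcut N : measurable_fun setT (cut N).
  apply: measurable_fun_ifT => //.
  by apply: measurable_fun_ler => //.
have bound0 (a : R) N : 0 <= a -> `|Num.min a N%:R| <= N%:R.
  by move=> a0; rewrite ger0_norm ?le_min ?a0//= ge_min lexx orbT.
have cphi0 x : 0 <= c * phi x + D by rewrite addr_ge0// mulr_ge0.
have loP N : all_moments mu (lo N).
  by apply: (@all_moments_bounded _ _ _ _ _ N%:R) => // x; exact: bound0.
have hiP N : all_moments mu (hi N).
  by apply: (@all_moments_bounded _ _ _ _ _ N%:R) => // x; exact: bound0.
have cutP N : all_moments mu (cut N).
  apply: (@all_moments_bounded _ _ _ _ _ N%:R) => // x; rewrite /cut.
  by case: ifPn => h; rewrite ?normr0// ger0_norm.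
have lo_hi N : \int[mu]_x lo N x <= \int[mu]_x hi N x.
  rewrite -lee_fin -!all_moments_integral// stationary_integral; last 2 first.
  - by move=> x; rewrite lee_fin le_min phi0/=.
  - exact/measurable_EFinP.
  apply: ge0_le_integral => //.
  - by move=> x _; apply: integral_ge0 => w _; rewrite lee_fin le_min phi0/=.
  - apply: (measurable_stationary_integral (f := fun y => (lo N y)%:E)) => [x|]; first by rewrite lee_fin le_min phi0/=.
    exact/measurable_EFinP.
  - exact/measurable_EFinP.
  have mloY x : measurable_fun setT (fun w => (lo N (Y w))%:E).
    by apply/measurable_EFinP; apply: measurableT_comp.
  move=> x _; rewrite /hi EFin_min le_min; apply/andP; split.
    apply: le_trans (drift x); apply: ge0_le_integral => //.
    - by move=> w _; rewrite lee_fin le_min phi0/=.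
    - exact: mloY.
    - by apply/measurable_EFinP; exact: (measurableT_comp mphi (measurable_funPT Y)).
    - by move=> w _; rewrite lee_fin ge_min lexx.
  rewrite -[leRHS]mule1 -(probability_setT (P x)) -integral_cst//.
  apply: ge0_le_integral => //.
  - by move=> w _; rewrite lee_fin le_min phi0/=.
  - exact: mloY.
  - by move=> w _; rewrite lee_fin ge_min lexx orbT.
have cut_le N : \int[mu]_x cut N x <= D / (1 - c).
  rewrite ler_pdivlMr// mulrC -(lerD2r (\int[mu]_x hi N x)) -meanZ// -meanD//; last exact: all_momentsZ.
  apply: (@le_trans _ _ (\int[mu]_x (D + lo N x))).
    apply: le_mean.
    - by apply: all_momentsD => //; exact: all_momentsZ.
    - by apply: all_momentsD => //; exact: all_moments_cst.
    move=> x; rewrite /cut /lo /hi; case: ifPn => [h|]; last rewrite -ltNge => /ltW h.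
      rewrite (min_idPl h); have : Num.min (c * phi x + D) N%:R <= c * phi x + D by rewrite ge_min lexx.
      lra.
    by rewrite (min_idPr h) mulr0 add0r ler_wpDl// ge_min lexx orbT.
  by rewrite meanD//; [rewrite mean_cst lerD2l|exact: all_moments_cst].
have -> : (\int[mu]_x (phi x)%:E = limn (fun N => \int[mu]_x (cut N x)%:E))%E.
  rewrite -monotone_convergence//.
  - apply: eq_integral => x _; apply/esym/cvg_lim => //; apply: cvg_near_cst.
    near=> N; congr EFin; rewrite /cut ifT//.
    by near: N; exact: nbhs_infty_ger.
  - by move=> N; exact/measurable_EFinP.
  - by move=> N x _; rewrite lee_fin /cut; case: ifP.
  - move=> x _ N N' NN'; rewrite lee_fin /cut; case: ifPn => [h|_]; last by case: ifP.
    by rewrite ifT// (le_trans h)// ler_nat.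
apply: lime_le.
  apply: ereal_nondecreasing_is_cvgn => N N' NN'; apply: ge0_le_integral => //.
  - by move=> x _; rewrite lee_fin /cut; case: ifP.
  - exact/measurable_EFinP.
  - exact/measurable_EFinP.
  - move=> x _; rewrite lee_fin /cut; case: ifPn => [h|_]; last by case: ifP.
    by rewrite ifT// (le_trans h)// ler_nat.
by apply: nearW => N; rewrite all_moments_integral// lee_fin.
Unshelve. all: by end_near. Qed.

(** The mixture formula concerns nonnegative functions, so it is applied to the positive and
    negative parts; integrability of the inner mean is obtained along the way. *)
Lemma stationary_mean (f : E -> R) : measurable_fun setT f ->
  mu.-integrable setT (EFin \o f) -> (forall x, (P x).-integrable setT (EFin \o (f \o Y))) ->
  mu.-integrable setT (EFin \o (fun x => \int[P x]_w f (Y w))) /\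
  \int[mu]_x (\int[P x]_w f (Y w)) = \int[mu]_x f x.
Proof.
move=> mf muf Pf.
have mF : measurable_fun setT (EFin \o f) by exact/measurable_EFinP.
pose g1 := (EFin \o f)^\+%E; pose g2 := (EFin \o f)^\-%E.
have mg1 : measurable_fun setT g1 := measurable_funepos mF.
have mg2 : measurable_fun setT g2 := measurable_funeneg mF.
pose A x := (\int[P x]_w g1 (Y w))%E; pose A' x := (\int[P x]_w g2 (Y w))%E.
have A0 x : (0 <= A x)%E by apply: integral_ge0 => w _; exact: funepos_ge0.
have A'0 x : (0 <= A' x)%E by apply: integral_ge0 => w _; exact: funeneg_ge0.
have mA : measurable_fun setT A by apply: measurable_stationary_integral => // y; exact: funepos_ge0.
have mA' : measurable_fun setT A' by apply: measurable_stationary_integral => // y; exact: funeneg_ge0.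
have EA : (\int[mu]_x A x = \int[mu]_x g1 x)%E.
  by rewrite [RHS]stationary_integral// => x; exact: funepos_ge0.
have EA' : (\int[mu]_x A' x = \int[mu]_x g2 x)%E.
  by rewrite [RHS]stationary_integral// => x; exact: funeneg_ge0.
have ig1 := integrable_funepos measurableT muf; have ig2 := integrable_funeneg measurableT muf.
have iA : mu.-integrable setT A.
  apply/integrableP; split=> //; under eq_integral do rewrite gee0_abs//.
  by rewrite EA; have /integrableP[_] := ig1; under eq_integral do rewrite gee0_abs//.
have iA' : mu.-integrable setT A'.
  apply/integrableP; split=> //; under eq_integral do rewrite gee0_abs//.
  by rewrite EA'; have /integrableP[_] := ig2; under eq_integral do rewrite gee0_abs//.
have hE x : ((\int[P x]_w f (Y w))%:E = A x - A' x)%E.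
  rewrite /Rintegral fineK; last exact: integrable_fin_num (Pf x).
  rewrite [LHS]integralE; congr (_ - _)%E; apply: eq_integral => w _.
    by rewrite /g1 !funeposE.
  by rewrite /g2 !funenegE.
have H : (EFin \o (fun x => \int[P x]_w f (Y w))) = (fun x => A x - A' x)%E.
  by apply/funext => x; exact: hE.
split; first by rewrite H; exact: integrableB.
rewrite {1}/Rintegral (_ : (fun x => _) = (fun x => A x - A' x)%E)//.
rewrite integralB// EA EA' /Rintegral; congr fine.
by rewrite [in RHS]integralE.
Qed.

End Stationary.

(** * The semigroup on monomials *)

Section StartWeight.
Context {R : realType} {d J : nat}.
Local Notation E := (J.-tuple R * 'I_d.+1)%type.

Definition start_moment (k : {ffun 'I_J -> nat}) (x : E) : R := \prod_j tnth x.1 j ^+ k j.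

Definition start_weight (x : E) : R := 1 + \sum_j `|tnth x.1 j|.

Lemma start_weight_ge1 x : 1 <= start_weight x.
Proof. by rewrite lerDl sumr_ge0. Qed.

Lemma tnth_le_weight (x : E) j : 1 + `|tnth x.1 j| <= start_weight x.
Proof. by rewrite lerD2l (bigD1 j)//= lerDl sumr_ge0. Qed.

Lemma poly_bounded_tnth j : poly_bounded start_weight (fun x : E => tnth x.1 j).
Proof.
exists 1, 1%N; split=> // x; rewrite expr1 mul1r.
by apply: le_trans (tnth_le_weight x j); rewrite lerDr.
Qed.

End StartWeight.

Lemma contraction_rate {R : realFieldType} (a b : R) :
  a <= 1 / 2 -> 0 <= b -> b < a -> 0 <= 1 - a + b < 1.
Proof. by move=> *; apply/andP; split; lra. Qed.

Section OUFamily.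
Context {R : realType} {d J : nat} {dT} {T : measurableType dT}.
Local Notation E := (J.-tuple R * 'I_d.+1)%type.
Variables (Q : 'M[R]_d.+1) (alpha gamma sigma : 'I_J -> 'rV[R]_d.+1).
Variables (P : E -> probability T R).
Variables (X : R -> T -> 'I_d.+1) (B M : 'I_J -> R -> T -> R).
Hypothesis hM : forall x, modulated_OU Q alpha gamma sigma (P x) x X B M.
Local Notation rho := (@start_weight R d J).

Let noise x : driving_noise (P x) X B.
Proof.
have [[mX _ _] hB iB iX _ _ _ _] := hM x; exact: DrivingNoise.
Qed.

Let rcX : forall w t, 0 <= t -> \forall s \near t^'+, X s w = X t w.
Proof. by move=> w t t0; have [_ /(_ w)[h _] _] := mou_chain (hM point); exact: h. Qed.

Let startX x : {ae P x, forall w, X 0 w = x.2}.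
Proof. by apply: filterS (mou_start (hM x)) => w <-. Qed.

Let startM x j : {ae P x, forall w, M j 0 w = tnth x.1 j}.
Proof. by apply: filterS (mou_start (hM x)) => w <-; rewrite tnth_mktuple. Qed.

Let mM j t : 0 <= t -> measurable_fun setT (M j t).
Proof. exact: mou_measurable (hM point) j t. Qed.

Let cM j w : {within `[0, +oo[, continuous (M j ^~ w)}.
Proof. exact: mou_continuous (hM point) j w. Qed.

(** The semigroup is extracted from one arbitrary starting point and used for all of them. *)
Lemma family_semigroup : exists p, transition_semigroup Q p.
Proof. by have [_ _ [p hp _]] := mou_chain (hM point); exists p. Qed.

Variable p : R -> 'M[R]_d.+1.
Hypothesis hp : transition_semigroup Q p.
Variables (kappa h0 : R).
Hypothesis kappa0 : 0 <= kappa.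
Hypothesis exitP : forall h, 0 <= h <= h0 -> forall i j, `|(p h - 1%:M) i j| <= kappa * h.

Let exitX x : forall s t, 0 <= s <= t -> t - s <= h0 ->
  (P x [set w | X s w != X t w] <= (kappa * (t - s))%:E)%E.
Proof. exact: (chain_exit_le (mou_chain (hM x)) hp exitP). Qed.

Variable C : R.
Hypothesis alC : forall j i, `|alpha j 0 i| <= C.
Hypothesis gaC : forall j i, `|gamma j 0 i| <= C.
Hypothesis sgC : forall j i, `|sigma j 0 i| <= C.
Variable s1 : R.
Hypothesis s10 : 0 < s1 <= 1.
Hypothesis s1h : s1 ^+ 2 <= h0.
Hypothesis s1C : C * s1 ^+ 2 <= 1 / 2.

Local Notation tm := (tame P rho s1).
Local Notation negl := (subquadratic rho s1).
Local Notation al j := (fun i => alpha j 0 i).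
Local Notation ga j := (fun i => gamma j 0 i).
Local Notation sg j := (fun i => sigma j 0 i).
Local Notation comp j := (compensator X (M j) (al j) (ga j)).
Local Notation np j := (noise_part X (M j) (al j) (ga j)).
Local Notation ns j := (noise_size X (M j) (al j) (ga j)).

Let rho1 : forall x, 1 <= rho x. Proof. exact: start_weight_ge1. Qed.

Let sde x j : exists2 Y : R -> T -> R,
  forall t, 0 <= t ->
    ito_integral (P x) (history X B) (B j) (fun s w => sg j (X s w)) t (Y t) &
  {ae P x, forall w, forall t, 0 <= t ->
    M j t w = M j 0 w + \int[lebesgue_measure]_(s in `[0, t])
      (al j (X s w) - ga j (X s w) * M j s w) + Y t w}.
Proof. exact: (mou_sde (hM x) j). Qed.

Let C0 (j : 'I_J) : 0 <= C. Proof. exact: le_trans (normr_ge0 _) (alC j ord0). Qed.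

Let small s : 0 < s <= s1 -> [/\ 0 < s ^+ 2 <= h0, forall j : 'I_J, C * s ^+ 2 <= 1 / 2 & s <= 1].
Proof.
move=> /andP[s0 ss]; have [s10' s11] := andP s10.
have s2 : s ^+ 2 <= s1 ^+ 2 by rewrite lerXn2r// nnegrE ltW.
split; [by rewrite exprn_gt0//= (le_trans s2)|move=> j|exact: le_trans s11].
by apply: le_trans s1C; rewrite ler_wpM2l// (C0 j).
Qed.

(** The powers of [s] are the orders of magnitude at time [s ^+ 2], so that every rescaled quantity
    is tame. The argument [x] is carried for the law under which moments are taken; the random
    variable itself is the same for all starting points. *)
Definition scaled_noise j s (x : E) w := s^-1 * np j (s ^+ 2) w.
Definition scaled_compensator j s (x : E) w := s ^- 2 * comp j (s ^+ 2) w.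
Definition scaled_size j s (x : E) w := s ^- 3 * ns j (s ^+ 2) w.
Definition scaled_increment j s (x : E) w :=
  scaled_noise j s x w + s * scaled_compensator j s x w.

Lemma scaled_noise_tame (r : E -> R) j : tame P r s1 (scaled_noise j).
Proof.
split=> [s x hs|n].
  have [/andP[t0 th] _ _] := small hs; have [Y itoY sdeM] := sde x j.
  rewrite /scaled_noise; apply: all_momentsZ.
  apply: (noise_part_all_moments (noise x) rcX kappa0 (exitX x) (sgC j) (@mM j) (@cM j) itoY sdeM).
  by rewrite ltW.
exists (ito_moment_bound C n), 0%N; split=> [|s x hs]; first exact: ito_moment_bound_ge0.
have [/andP[t0 th] _ _] := small hs; have [Y itoY sdeM] := sde x j.
have s0 : 0 < s by case/andP: hs.
have th' : 0 <= s ^+ 2 <= h0 by rewrite ltW.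
have NP := noise_part_all_moments (noise x) rcX kappa0 (exitX x) (sgC j) (@mM j) (@cM j) itoY sdeM th'.
have := noise_part_even_moment (noise x) rcX kappa0 (exitX x) (sgC j) (@mM j) (@cM j) itoY sdeM n th'.
rewrite all_moments_integral ?lee_fin; last exact: all_momentsX.
have -> : \int[P x]_w (scaled_noise j s x w ^+ n.*2) =
    s ^- n.*2 * \int[P x]_w (np j (s ^+ 2) w ^+ n.*2).
  rewrite -meanZ; last exact: all_momentsX.
  by apply: eq_Rintegral => w _; rewrite /scaled_noise exprMn exprVn.
rewrite expr0 mulr1 ler_pdivrMl ?exprn_gt0// => /le_trans; apply.
by rewrite -exprM mul2n mulrC.
Qed.

Lemma scaled_size_tame (r : E -> R) j : tame P r s1 (scaled_size j).
Proof.
split=> [s x hs|n].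
  have [t0 Ct _] := small hs; have [Y itoY sdeM] := sde x j.
  rewrite /scaled_size; apply: all_momentsZ.
  exact: (noise_size_all_moments (noise x) rcX kappa0 (exitX x) (alC j) (gaC j) (sgC j)
    (@mM j) (@cM j) itoY sdeM t0 (Ct j)).
exists (ito_moment_bound C n), 0%N; split=> [|s x hs]; first exact: ito_moment_bound_ge0.
have [t0 Ct _] := small hs; have [Y itoY sdeM] := sde x j.
have s0 : 0 < s by case/andP: hs.
have NP := noise_size_all_moments (noise x) rcX kappa0 (exitX x) (alC j) (gaC j) (sgC j)
    (@mM j) (@cM j) itoY sdeM t0 (Ct j).
have := noise_size_even_moment (noise x) rcX kappa0 (exitX x) (alC j) (gaC j) (sgC j)
    (@mM j) (@cM j) itoY sdeM n t0 (Ct j).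
have -> : \int[P x]_w (scaled_size j s x w ^+ n.*2) =
    (s ^+ 3) ^- n.*2 * \int[P x]_w (ns j (s ^+ 2) w ^+ n.*2).
  rewrite -meanZ; last exact: all_momentsX.
  by apply: eq_Rintegral => w _; rewrite /scaled_size exprMn exprVn.
rewrite expr0 mulr1 ler_pdivrMl ?exprn_gt0// => /le_trans; apply.
rewrite [leRHS]mulrC -mulrA -exprD -!exprM le_eqVlt; apply/orP; left; apply/eqP.
by congr (_ * s ^+ _); rewrite -!muln2 !mulnDr !mulnA; ring.
Qed.

Lemma start_tame j : tm (fun _ _ w => M j 0 w).
Proof.
split=> [s x _|n]; first exact: (start_all_moments (@mM j) (startM x j)).
have [D [q [D0 hD]]] := poly_boundedX n.*2 (@poly_bounded_tnth R d J j).
exists D, q; split=> // s x _; apply: le_trans (hD x); apply: le_trans (ler_norm _).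
rewrite le_eqVlt; apply/orP; left; apply/eqP.
rewrite -[RHS](mean_cst (P x)); apply: eq_mean_ae.
- by apply: measurable_funX; exact: mM.
- exact: measurable_cst.
- by apply: filterS (startM x j) => w ->.
Qed.

(** The pathwise bound on the compensator, divided by [s ^+ 2], is the tame quantity [V]; domination
    transfers tameness. *)
Lemma scaled_compensator_tame j : tm (scaled_compensator j).
Proof.
pose V s (x : E) w := 2 * (C * (1 + `|M j 0 w|) + C * (s * scaled_size j s x w)).
have cT a : tm (fun _ _ _ => a) := tame_poly_bounded P s1 (poly_bounded_cst rho a).
have normT U : tm U -> tm (fun s x w => `|U s x w|).
  move=> UT; apply: le_tame (UT) => [s x hs|s x w _]; last by rewrite normr_id.
  by apply: measurableT_comp => //; have [h _] := UT; have [] := h s x hs.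
have VT : tm V.
  apply: tameM => //; apply: tameD => //; apply: tameM => //.
    by apply: tameD => //; apply: normT; exact: start_tame.
  by apply: tameM => //; [exact: tame_time|exact: scaled_size_tame].
apply: le_tame VT => [s x hs|s x w hs].
  apply: measurable_funM => //; apply: jointly_measurable_section1.
  exact: (compensator_jointly_measurable _ _ (noise_chain (noise x)) rcX (@mM j) (@cM j)).
have [/andP[t0 th] Ct _] := small hs; have s0 : 0 < s by case/andP: hs.
have h := path_compensator_le (noise_chain (noise x)) rcX (@mM j) (@cM j) (alC j) (gaC j) w (ltW t0) (Ct j).
rewrite /scaled_compensator normrM [X in X * _]gtr0_norm ?invr_gt0 ?exprn_gt0// ler_pdivrMl//.
apply: le_trans h _; apply: le_trans (_ : s ^+ 2 * V s x w <= _); last first.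
  by rewrite ler_wpM2l ?(ltW t0)// ler_norm.
rewrite le_eqVlt; apply/orP; left; apply/eqP; rewrite /V /scaled_size.
by field; rewrite gt_eqF.
Qed.

Lemma scaled_increment_tame j : tm (scaled_increment j).
Proof.
apply: tameD => //; first exact: scaled_noise_tame.
by apply: tameM => //; [exact: tame_time|exact: scaled_compensator_tame].
Qed.

Lemma scaled_incrementE j s x w : s != 0 ->
  M j (s ^+ 2) w = M j 0 w + s * scaled_increment j s x w.
Proof.
move=> s0; rewrite /scaled_increment /scaled_noise /scaled_compensator /noise_part.
by rewrite (max_idPl (sqr_ge0 s)); field.
Qed.

Variable i : 'I_d.+1.
Let chi (s : R) (_ : E) (w : T) : R := (X (s ^+ 2) w == i)%:R.
Let delta (x : E) : R := (x.2 == i)%:R.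

Let chiP s x : 0 < s <= s1 -> all_moments (P x) (chi s x).
Proof. by move=> _; apply: (chain_all_moments (noise x) (fun k => (k == i)%:R)); exact: sqr_ge0. Qed.

Let chi1 s x w : `|chi s x w| <= 1.
Proof. by rewrite ger0_norm// /chi; case: (_ == _). Qed.

Lemma indicator_expansion :
  negl (fun s x => \int[P x]_w chi s x w - delta x - s ^+ 2 * Q x.2 i).
Proof.
exists 0%N => e e0; have [s10' s11] := andP s10.
have /nbhs_right0P/nbhs_ballP[r /= r0 hr] := semigroup_near hp e0.
exists (Num.min s1 (r / 2)); first by rewrite lt_min s10' divr_gt0// ge_min lexx.
move=> s x /andP[s0]; rewrite le_min => /andP[ss1 sr].
have t0 : 0 < s ^+ 2 by rewrite exprn_gt0.
have tr : s ^+ 2 < r.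
  apply: (@le_lt_trans _ _ s); first by rewrite expr2 ler_piMl ?(ltW s0)// (le_trans ss1).
  by apply: le_lt_trans sr _; rewrite ltr_pdivrMr// ltr_pMr// ltr1n.
rewrite (chain_start_law (mou_chain (hM x)) hp i (startX x) (ltW t0)).
have := hr (s ^+ 2); rewrite /ball/= sub0r normrN gtr0_norm// => /(_ tr t0 x.2 i).
by rewrite add0r !mxE expr0 mulr1.
Qed.

Let noise_ito x j s : 0 < s <= s1 -> ito_integral (P x) (history X B) (B j)
  (fun r w => sg j (X r w)) (s ^+ 2) (np j (s ^+ 2)).
Proof.
move=> hs; have [Y itoY sdeM] := sde x j.
exact: (noise_part_ito (noise x) rcX (@mM j) (@cM j) itoY sdeM (sqr_ge0 s)).
Qed.

Let np_moments x j s : 0 < s <= s1 -> all_moments (P x) (np j (s ^+ 2)).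
Proof.
move=> hs; have [/andP[t0 th] _ _] := small hs.
have th' : 0 <= s ^+ 2 <= h0 by rewrite ltW.
exact: (ito_all_moments (noise x) rcX kappa0 (exitX x) (sgC j) th' (noise_ito x j hs)).
Qed.

(** The indicator of the final state is known to the past of [B j] at time 0, so the noise
    contributes exactly 0 and only the compensator remains. *)
Lemma increment_expansion j : negl (fun s x =>
  s * \int[P x]_w (chi s x w * scaled_increment j s x w) -
  delta x * (s ^+ 2 * (alpha j 0 x.2 - gamma j 0 x.2 * tnth x.1 j))).
Proof.
set K := 4 * C * kappa + 2 * C ^+ 2 + C * (1 + ito_moment_bound C 1).
have K0 : 0 <= K.
  have b0 := ito_moment_bound_ge0 C 1; have c0 := C0 j.
  by rewrite /K !addr_ge0// ?mulr_ge0// ?addr_ge0// ?sqr_ge0.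
apply: (@subquadratic_cube _ _ rho s1 rho1 s10 K 1%N) => s x hs.
have [Y itoY sdeM] := sde x j; have [t0 Ct sle1] := small hs.
have [/andP[t0' th] _ _] := small hs.
have s0 : 0 < s by case/andP: hs.
have NP := np_moments x j hs.
have AP := compensator_all_moments (noise x) rcX kappa0 (exitX x) (alC j) (gaC j) (sgC j)
  (@mM j) (@cM j) (startM x j) itoY sdeM t0 (Ct j).
have cP := chiP x hs.
have -> : s * \int[P x]_w (chi s x w * scaled_increment j s x w) =
    \int[P x]_w (chi s x w * np j (s ^+ 2) w) + \int[P x]_w (chi s x w * comp j (s ^+ 2) w).
  have h : all_moments (P x) (scaled_increment j s x).
    by have [h _] := scaled_increment_tame j; exact: h.
  rewrite -meanD; [|exact: all_momentsM..]; rewrite -meanZ; last exact: all_momentsM.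
  apply: eq_Rintegral => w _; rewrite /scaled_increment /scaled_noise /scaled_compensator.
  by field; rewrite gt_eqF.
rewrite (ito_mean_mul0 (noise x) rcX kappa0 (exitX x) (sgC j) _ (noise_ito x j hs)) ?(ltW t0')//; last first.
  exact: (@adapted_chain _ _ _ _ _ X B j 0 (s ^+ 2) (fun k => (k == i)%:R) (sqr_ge0 s)).
rewrite add0r expr1; apply: le_trans (compensator_mean (noise x) rcX kappa0 (exitX x)
  (startX x) (alC j) (gaC j) (sgC j) (@mM j) (@cM j) (startM x j) itoY sdeM i s0 th (Ct j) sle1) _.
rewrite -/K ler_wpM2r ?exprn_ge0 ?(ltW s0)// ler_wpM2l//; exact: tnth_le_weight.
Qed.

Let scaled_moments x j s : 0 < s <= s1 -> [/\ all_moments (P x) (scaled_noise j s x),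
  all_moments (P x) (scaled_compensator j s x) & all_moments (P x) (scaled_increment j s x)].
Proof.
move=> hs; have [h1 _] := scaled_noise_tame rho j; have [h2 _] := scaled_compensator_tame j.
by have [h3 _] := scaled_increment_tame j; split; [exact: h1|exact: h2|exact: h3].
Qed.

(** The square of the noise gives the variance; every product involving the compensator has an
    additional factor [s] and falls into the tame remainder [r]. *)
Lemma increment_sqr_expansion j : negl (fun s x =>
  s ^+ 2 * \int[P x]_w (chi s x w * scaled_increment j s x w ^+ 2) -
  delta x * (s ^+ 2 * sigma j 0 x.2 ^+ 2)).
Proof.
pose r s x w := 2 * (scaled_noise j s x w * scaled_compensator j s x w) +
  s * (scaled_compensator j s x w * scaled_compensator j s x w).
have nT := scaled_noise_tame rho j; have aT := scaled_compensator_tame j.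
have rT : tm r.
  apply: tameD => //; apply: tameM => //; try exact: tameM.
    exact: (tame_poly_bounded P s1 (poly_bounded_cst rho 2)).
  exact: tame_time.
have N1 := subquadratic_tame rho1 s10 rT chiP chi1.
have N2 : negl (fun s x => \int[P x]_w (chi s x w * np j (s ^+ 2) w ^+ 2) -
    delta x * (s ^+ 2 * sigma j 0 x.2 ^+ 2)).
  apply: (@subquadratic_cube _ _ rho s1 rho1 s10 (2 * C ^+ 2 * kappa) 0%N) => s x hs.
  have [/andP[t0 th] _ sle1] := small hs; have s0 : 0 < s by case/andP: hs.
  have th' : 0 <= s ^+ 2 <= h0 by rewrite ltW.
  have := ito_mean_sqr_le (noise x) rcX kappa0 (exitX x) (startX x) (sgC j) th' (noise_ito x j hs) i.
  rewrite expr0 mulr1 -mulrA (mulrC (_ ^+ 2) (s ^+ 2)) => /le_trans; apply.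
  apply: ler_wpM2l; first by apply: mulr_ge0 => //; apply: mulr_ge0 => //; exact: sqr_ge0.
  by rewrite -exprM (exprS s 3) ler_piMl// exprn_ge0// ltW.
apply: eq_subquadratic (subquadraticD rho1 N2 N1) => s x hs.
have s0 : s != 0 by case/andP: hs => /gt_eqF ->.
have [h1 h2 h3] := scaled_moments x j hs; have cP := chiP x hs; have NP := np_moments x j hs.
have rP : all_moments (P x) (r s x) by have [h _] := rT; exact: h.
have -> : s ^+ 2 * \int[P x]_w (chi s x w * scaled_increment j s x w ^+ 2) =
   \int[P x]_w (chi s x w * np j (s ^+ 2) w ^+ 2) + s ^+ 3 * \int[P x]_w (chi s x w * r s x w).
  rewrite -meanZ; last by apply: all_momentsM => //; exact: all_momentsX.
  rewrite -meanZ; last exact: all_momentsM.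
  rewrite -meanD; [|by apply: all_momentsM => //; exact: all_momentsX|
    by apply: all_momentsZ; exact: all_momentsM].
  apply: eq_Rintegral => w _; rewrite /r /scaled_increment /scaled_noise /scaled_compensator.
  by field.
by ring.
Qed.

Lemma increment_cross_expansion j l : j != l -> negl (fun s x =>
  s ^+ 2 * \int[P x]_w (chi s x w * (scaled_increment j s x w * scaled_increment l s x w))).
Proof.
move=> jl.
pose r s x w := scaled_noise j s x w * scaled_compensator l s x w +
  scaled_noise l s x w * scaled_compensator j s x w +
  s * (scaled_compensator j s x w * scaled_compensator l s x w).
have nT k := scaled_noise_tame rho k; have aT k := scaled_compensator_tame k.
have rT : tm r.
  apply: tameD => //; first by apply: tameD => //; exact: tameM.
  by apply: tameM => //; [exact: tame_time|exact: tameM].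
apply: eq_subquadratic (subquadratic_tame rho1 s10 rT chiP chi1) => s x hs.
have s0 : s != 0 by case/andP: hs => /gt_eqF ->.
have [t0 th] : 0 < s ^+ 2 /\ s ^+ 2 <= h0 by have [/andP[]] := small hs.
have th' : 0 <= s ^+ 2 <= h0 by rewrite ltW.
have [h1 h2 h3] := scaled_moments x j hs; have [h1' h2' h3'] := scaled_moments x l hs.
have cP := chiP x hs; have NP k := np_moments x k hs.
have rP : all_moments (P x) (r s x) by have [h _] := rT; exact: h.
have cross := ito_mean_cross (noise x) rcX kappa0 (exitX x) (sgC j) (sgC l) th' jl
  (noise_ito x j hs) (noise_ito x l hs) (fun k => (k == i)%:R).
have -> : s ^+ 2 * \int[P x]_w (chi s x w * (scaled_increment j s x w * scaled_increment l s x w))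
    = \int[P x]_w (chi s x w * np j (s ^+ 2) w * np l (s ^+ 2) w) +
      s ^+ 3 * \int[P x]_w (chi s x w * r s x w).
  rewrite -meanZ; last by apply: all_momentsM => //; exact: all_momentsM.
  rewrite -meanZ; last exact: all_momentsM.
  rewrite -meanD; [|by do 2 (apply: all_momentsM => //)|
    by apply: all_momentsZ; exact: all_momentsM].
  apply: eq_Rintegral => w _; rewrite /r /scaled_increment /scaled_noise /scaled_compensator.
  by field.
by rewrite cross add0r.
Qed.

Lemma path_family_all_moments j s x : 0 < s <= s1 -> all_moments (P x) (M j (s ^+ 2)).
Proof.
move=> hs; have [t0 Ct _] := small hs; have [Y itoY sdeM] := sde x j.
exact: (path_all_moments (noise x) rcX kappa0 (exitX x) (alC j) (gaC j) (sgC j)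
  (@mM j) (@cM j) (startM x j) itoY sdeM t0 (Ct j)).
Qed.

Lemma monomial_all_moments (k : {ffun 'I_J -> nat}) s x : 0 < s <= s1 ->
  all_moments (P x) (fun w => (X (s ^+ 2) w == i)%:R * \prod_j M j (s ^+ 2) w ^+ k j).
Proof.
move=> hs; apply: all_momentsM; first exact: chiP hs.
apply: (@all_moments_prod _ _ _ (P x) _ _ _ (fun j w => M j (s ^+ 2) w ^+ k j)) => j.
exact/all_momentsX/path_family_all_moments.
Qed.

(** The generator of the joint process applied to the unsigned monomial of exponent [k] on the state
    [i], evaluated at [x]. The jump part reduces to the single entry [Q x.2 i], because the function
    vanishes on the other states; the sum holds the drift and diffusion parts. *)
Definition generator_moment (k : {ffun 'I_J -> nat}) (x : E) : R :=
  Q x.2 i * start_moment k x + (x.2 == i)%:R *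
  \sum_j ((alpha j 0 x.2 - gamma j 0 x.2 * tnth x.1 j) * ((k j)%:R * start_moment (index_sub k j 1) x)
    + sigma j 0 x.2 ^+ 2 * ((k j * (k j - 1))%:R * start_moment (index_sub k j 2) x) / 2).

Lemma generator_expansion (k : {ffun 'I_J -> nat}) : negl (fun s x =>
  \int[P x]_w ((X (s ^+ 2) w == i)%:R * \prod_j M j (s ^+ 2) w ^+ k j)
  - (x.2 == i)%:R * start_moment k x - s ^+ 2 * generator_moment k x).
Proof.
have mP j := @poly_bounded_tnth R d J j.
have pw j := expands_varX rho1 s10 scaled_increment_tame j (k j) (mP j).
have := expands_prod rho1 s10 scaled_increment_tame (index_enum_uniq _) pw.
move=> /(expands_mean rho1 s10 scaled_increment_tame chiP chi1 indicator_expansion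
  increment_expansion increment_sqr_expansion increment_cross_expansion) /=.
have prodP (l : 'I_J) : poly_bounded rho (fun x => \prod_(j | j != l) tnth x.1 j ^+ k j).
  apply: (@poly_bounded_prod _ _ rho _ _ _ (fun j (x : E) => tnth x.1 j ^+ k j)) => j.
  exact: poly_boundedX.
move=> /(_ _) h; apply: eq_subquadratic (h _) => [s x hs|l]; last first.
  apply: poly_boundedM; first exact: poly_bounded_cst.
  apply: poly_boundedM; last exact: prodP.
  by apply: poly_boundedM; [exact: poly_bounded_cst|exact: poly_boundedX].
have s0 : s != 0 by case/andP: hs => /gt_eqF ->.
have dropE l n : start_moment (index_sub k l n) x =
    tnth x.1 l ^+ (k l - n) * \prod_(j | j != l) tnth x.1 j ^+ k j.
  rewrite /start_moment (bigD1 l)//= ffunE eqxx; congr (_ * _).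
  by apply: eq_bigr => j /negbTE jl; rewrite ffunE jl subn0.
have [t0 th] : 0 < s ^+ 2 /\ s ^+ 2 <= h0 by have [/andP[]] := small hs.
congr (_ - _ - _ * _).
  apply: eq_mean_ae.
  - apply: measurable_funM; first exact: all_moments_measurable (chiP x hs).
    apply: measurable_prod => j _; apply: measurable_funX; apply: measurable_funD => //.
    apply: measurable_funM => //.
    by have [_ _ /all_moments_measurable] := scaled_moments x j hs.
  - apply: measurable_funM; first exact: all_moments_measurable (chiP x hs).
    by apply: measurable_prod => j _; apply: measurable_funX; apply: mM; exact: ltW.
  have : {ae P x, forall w, forall j, M j 0 w = tnth x.1 j} by apply: filterS (mou_start (hM x)) => w <- j; rewrite tnth_mktuple.
  apply: filterS => w Mw; rewrite /chi; congr (_ * _); apply: eq_bigr => j _.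
  by rewrite (scaled_incrementE j x w s0) Mw.
rewrite /generator_moment; congr (_ + _ * _); apply: eq_bigr => l _.
by rewrite !dropE mem_index_enum !mul1r; congr (_ + _); rewrite !mulrA.
Qed.

(** Convexity applied to [c * |m| + (1 - c) * (zeta / (1 - c))] keeps the coefficient of the
    starting moment equal to [c < 1]; a general splitting of the power would lose it to a factor
    [2 ^+ n.*2]. *)
Lemma path_moment_contraction j n : (forall l, 0 < gamma j 0 l) ->
  exists s c D, [/\ 0 < s <= s1, 0 <= c < 1, 0 <= D & forall x,
    (\int[P x]_w (M j (s ^+ 2) w ^+ n.*2)%:E <= (c * tnth x.1 j ^+ n.*2 + D)%:E)%E].
Proof.
move=> ga0; have [s10' s11] := andP s10; have C00 := C0 j.
have [g [g0 gg]] : exists g, 0 < g /\ forall l, g <= gamma j 0 l.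
  have [l _ hl] := @arg_minP _ _ _ ord0 predT (fun l => gamma j 0 l) isT.
  by exists (gamma j 0 l); split=> // l'; exact: hl.
(* Then [t = s ^+ 2 <= s] gives [2 * C ^+ 2 * t < g], so the correction of order [t ^+ 2] stays
   below the contraction [g * t]. *)
pose s := Num.min s1 (g / (2 * C ^+ 2 + 1)).
have c1 : 0 < 2 * C ^+ 2 + 1 by rewrite ltr_wpDl// mulr_ge0// sqr_ge0.
have hs : 0 < s <= s1 by rewrite lt_min s10' divr_gt0// ge_min lexx.
have [/andP[t0 th] Ct sle1] := small hs; have s0 : 0 < s by case/andP: hs.
set t := s ^+ 2 in t0 th Ct *.
pose c := 1 - g * t + 2 * C ^+ 2 * t ^+ 2.
have gC : g <= C by apply: le_trans (gg ord0) (le_trans (ler_norm _) (gaC j ord0)).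
have gt : g * t <= 1 / 2 by apply: le_trans (Ct j); rewrite ler_wpM2r// ltW.
have tg : 2 * C ^+ 2 * t < g.
  have tle : t <= g / (2 * C ^+ 2 + 1).
    apply: le_trans (_ : s <= _); first by rewrite /t expr2 ler_piMl// ltW.
    by rewrite ge_min lexx orbT.
  apply: (@lt_le_trans _ _ ((2 * C ^+ 2 + 1) * t)); first by rewrite ltr_pM2r// ltrDl.
  by rewrite mulrC -ler_pdivlMr.
have c01 : 0 <= c < 1.
  have -> : c = 1 - g * t + 2 * C ^+ 2 * t * t by rewrite /c expr2 !mulrA.
  have h1 : 0 <= 2 * C ^+ 2 * t * t.
    apply: mulr_ge0; last exact: ltW.
    apply: mulr_ge0; last exact: ltW.
    by apply: mulr_ge0 => //; exact: sqr_ge0.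
  have h2 : 2 * C ^+ 2 * t * t < g * t by rewrite ltr_pM2r.
  exact: contraction_rate.
(* With the constant weight 1, tameness of [zeta] means moments bounded independently of the
   starting point. *)
have one1 (x : E) : 1 <= (fun=> 1 : R) x by [].
pose zeta s (x : E) w : R := C * (s * s) + 2 * C ^+ 2 * (s * s * (s * s)) +
  (2 * C * (s * s * s * scaled_size j s x w) + `|s * scaled_noise j s x w|).
have zT : tame P (fun=> 1) s1 zeta.
  have D U V := @tameD _ _ _ _ P (fun=> 1) s1 one1 U V.
  have M' U V := @tameM _ _ _ _ P (fun=> 1) s1 one1 U V.
  have cT a : tame P (fun=> 1) s1 (fun _ _ _ => a) := tame_poly_bounded P s1 (poly_bounded_cst (fun=> 1) a).
  have sT : tame P (fun=> 1) s1 (fun s _ _ => s) := tame_time P (fun=> 1) s10.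
  have ssT := M' _ _ sT sT.
  have nT : tame P (fun=> 1) s1 (fun s x w => `|s * scaled_noise j s x w|).
    have h := M' _ _ sT (scaled_noise_tame (fun=> 1) j).
    apply: le_tame h => [r x hr|r x w _]; last by rewrite normr_id.
    apply: measurableT_comp => //; apply: measurable_funM => //.
    by have [/all_moments_measurable] := scaled_moments x j hr.
  exact: D _ _ (D _ _ (M' _ _ (cT C) ssT) (M' _ _ (cT _) (M' _ _ ssT ssT)))
    (D _ _ (M' _ _ (cT _) (M' _ _ (M' _ _ ssT sT) (scaled_size_tame _ j))) nT).
have [zP /(_ n)[D [q [D0 hD]]]] := zT.
have {hD}hD x : \int[P x]_w (zeta s x w ^+ n.*2) <= D.
  by apply: le_trans (hD s x hs) _; rewrite expr1n mulr1.
have /andP[c00 clt1] := c01; have e0 : 0 < 1 - c by rewrite subr_gt0.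
have Ke : 0 <= (1 - c) * (1 - c) ^- n.*2 by rewrite mulr_ge0 ?invr_ge0 ?exprn_ge0 ?ltW.
exists s, c, ((1 - c) * (1 - c) ^- n.*2 * D); split=> // [|x]; first exact: mulr_ge0.
have even (a : R) : `|a| ^+ n.*2 = a ^+ n.*2.
  by rewrite -normrX ger0_norm// exprn_even_ge0// odd_double.
have path_le w : M j t w ^+ n.*2 <= c * M j 0 w ^+ n.*2 +
    (1 - c) * (1 - c) ^- n.*2 * zeta s x w ^+ n.*2.
  have h := path_contraction (noise_chain (noise x)) rcX (@mM j) (@cM j) (alC j) (gaC j) w (ltW t0) (Ct j) gg (ltW g0).
  have hz : `|M j t w| <= c * `|M j 0 w| + (1 - c) * ((1 - c)^-1 * zeta s x w).
    rewrite mulVKf ?gt_eqF//; apply: le_trans h _; rewrite lerD2l /zeta.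
    have -> : scaled_size j s x w = s ^- 3 * ns j t w by [].
    have -> : s * scaled_noise j s x w = np j t w.
      by rewrite /scaled_noise mulVKf ?gt_eqF.
    rewrite le_eqVlt; apply/orP; left; apply/eqP; rewrite /t.
    by field; rewrite gt_eqF.
  have z0 : 0 <= zeta s x w.
    have q0 : 0 <= ns j t w by exact: noise_size_ge0.
    by rewrite /zeta /scaled_size; repeat (apply: addr_ge0 || apply: mulr_ge0 || apply: sqr_ge0 || apply: normr_ge0) => //; rewrite ?invr_ge0 ?exprn_ge0 ?ltW.
  rewrite -even; apply: le_trans (_ : (c * `|M j 0 w| + (1 - c) * ((1 - c)^-1 * zeta s x w)) ^+ n.*2 <= _).
    rewrite lerXn2r// nnegrE; apply: addr_ge0; apply: mulr_ge0 => //; first exact: ltW.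
    by apply: mulr_ge0 => //; rewrite invr_ge0 ltW.
  apply: le_trans (convex_exprn _ _ _ _) _ => //.
  - by rewrite c00 ltW.
  - by apply: mulr_ge0 => //; rewrite invr_ge0 ltW.
  by rewrite even [X in _ + (1 - c) * X]exprMn exprVn mulrA.
have MtP : all_moments (P x) (M j t) := path_family_all_moments j x hs.
have M0P := start_all_moments (@mM j) (startM x j).
have M0X := all_momentsX n.*2 M0P; have zX := all_momentsX n.*2 (zP s x hs).
have MtX := all_momentsX n.*2 MtP.
rewrite all_moments_integral// lee_fin.
apply: le_trans (le_mean MtX _ path_le) _.
  by apply: all_momentsD; exact: all_momentsZ.
rewrite meanD; [|exact: all_momentsZ..]; rewrite !meanZ//; apply: lerD; last first.
  by rewrite ler_wpM2l.
rewrite le_eqVlt; apply/orP; left; apply/eqP; congr (c * _).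
rewrite -[RHS](mean_cst (P x)); apply: eq_mean_ae.
- exact: all_moments_measurable M0X.
- exact: measurable_cst.
- by apply: filterS (startM x j) => w ->.
Qed.

End OUFamily.

Lemma sum_index_sub {J : nat} (k : {ffun 'I_J -> nat}) j n : (n <= k j)%N ->
  (\sum_l k l = \sum_l index_sub k j n l + n)%N.
Proof.
move=> nk; rewrite (bigD1 j)//= [in RHS](bigD1 j)//= ffunE eqxx addnAC subnK//.
by congr addn; apply: eq_bigr => l /negbTE lj; rewrite ffunE lj subn0.
Qed.

(** Lowering the exponent and multiplying back restores the monomial; when [k j = 0], where the
    subtraction is truncated, the coefficient is 0. *)
Lemma start_moment_mul_tnth {R : realType} {d J : nat} (k : {ffun 'I_J -> nat}) j
    (x : J.-tuple R * 'I_d.+1) :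
  (k j)%:R * (tnth x.1 j * start_moment (index_sub k j 1) x) = (k j)%:R * start_moment k x.
Proof.
have [->|kj] := posnP (k j); first by rewrite !mul0r.
congr (_ * _); rewrite /start_moment (bigD1 j)//= [in RHS](bigD1 j)//= ffunE eqxx.
rewrite mulrA -exprS -subSn// subn1; congr (_ * _).
by apply: eq_bigr => l /negbTE lj; rewrite ffunE lj subn0.
Qed.

(** * Moments of the stationary law *)

Section StationaryMoments.
Context {R : realType} {d J : nat} {dT} {T : measurableType dT}.
Local Notation E := (J.-tuple R * 'I_d.+1)%type.
Variables (Q : 'M[R]_d.+1) (alpha gamma sigma : 'I_J -> 'rV[R]_d.+1).
Variables (P : E -> probability T R) (X : R -> T -> 'I_d.+1) (M : 'I_J -> R -> T -> R).
Variable mu : probability E R.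
Local Notation rho := (@start_weight R d J).
Local Notation gen := (generator_moment Q alpha gamma sigma).
Hypothesis mX : forall t, 0 <= t -> measurable_fun setT (X t).
Hypothesis mM : forall j t, 0 <= t -> measurable_fun setT (M j t).
Hypothesis mP : forall U, measurable U -> measurable_fun setT (fun x => P x U).
Hypothesis muE : forall t, 0 <= t -> forall U, measurable U ->
  (\int[mu]_x P x (joint_process M X t @^-1` U))%E = mu U.
Variable s1 : R.
Hypothesis s10 : 0 < s1 <= 1.
Hypothesis contraction : forall j n, exists s c D, [/\ 0 < s <= s1, 0 <= c < 1, 0 <= D & forall x,
  (\int[P x]_w (M j (s ^+ 2) w ^+ n.*2)%:E <= (c * tnth x.1 j ^+ n.*2 + D)%:E)%E].
Hypothesis monomial : forall i (k : {ffun 'I_J -> nat}) s x, 0 < s <= s1 ->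
  all_moments (P x) (fun w => (X (s ^+ 2) w == i)%:R * \prod_j M j (s ^+ 2) w ^+ k j).
Hypothesis expansion : forall i (k : {ffun 'I_J -> nat}), subquadratic rho s1 (fun s x =>
  \int[P x]_w ((X (s ^+ 2) w == i)%:R * \prod_j M j (s ^+ 2) w ^+ k j)
  - (x.2 == i)%:R * start_moment k x - s ^+ 2 * gen i k x).

Lemma joint_process_measurable t : 0 <= t -> measurable_fun setT (joint_process M X t).
Proof.
move=> t0; apply: measurable_fun_pair; last exact: mX.
apply/measurable_fun_tnthP => j.
rewrite (_ : _ \o _ = M j t); first exact: mM.
by apply/funext => w /=; rewrite tnth_mktuple.
Qed.

Let mtnth j : measurable_fun setT (fun x : E => tnth x.1 j).
Proof. exact: measurableT_comp (measurable_tnth j) measurable_fst. Qed.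

Let preimage_kernel t U : 0 <= t -> measurable U ->
  measurable_fun setT (fun x => P x (joint_process M X t @^-1` U)).
Proof.
move=> t0 mU; apply: mP; rewrite -[X in measurable X]setTI.
exact: joint_process_measurable.
Qed.

Lemma stationary_tnth_all_moments j : all_moments mu (fun x => tnth x.1 j).
Proof.
apply: all_moments_even; first exact: mtnth.
move=> n; have [s [c [D [hs c01 D0 h]]]] := contraction j n.
have t0 : 0 <= s ^+ 2 := sqr_ge0 s.
pose Y : {mfun T >-> E} := HB.pack (joint_process M X (s ^+ 2))
  (isMeasurableFun.Build _ _ _ _ _ (joint_process_measurable t0)).
apply: (@le_lt_trans _ _ (D / (1 - c))%:E); last exact: ltry.
apply: (@lyapunov_integral_le _ _ _ _ _ P Y mu _ _ (fun x => tnth x.1 j ^+ n.*2)) => //.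
- by move=> U mU; exact: preimage_kernel.
- by move=> U mU; rewrite -(muE t0 mU).
- by apply: measurable_funX; exact: mtnth.
- by move=> x; rewrite exprn_even_ge0// odd_double.
move=> x; apply: le_trans (h x); rewrite le_eqVlt; apply/orP; left; apply/eqP.
by apply: eq_integral => w _; rewrite /Y /= tnth_mktuple.
Qed.

Lemma state_all_moments (g : 'I_d.+1 -> R) : all_moments mu (fun x => g x.2).
Proof.
apply: (@all_moments_bounded _ _ _ _ _ (\sum_i `|g i|)) => [|x].
  exact: (measurable_ord_comp g measurable_snd).
by rewrite (bigD1 x.2)//= lerDl sumr_ge0.
Qed.

Lemma start_moment_all_moments k : all_moments mu (start_moment k).
Proof.
apply: (@all_moments_prod _ _ _ mu _ _ _ (fun j x => tnth x.1 j ^+ k j)) => j.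
exact/all_momentsX/stationary_tnth_all_moments.
Qed.

Lemma start_weight_all_moments : all_moments mu rho.
Proof.
apply: all_momentsD; first exact: all_moments_cst.
apply: (@all_moments_sum _ _ _ mu _ _ _ (fun j x => `|tnth x.1 j|)) => j.
apply: le_all_moments (stationary_tnth_all_moments j) => [|x]; last by rewrite normr_id.
exact: measurableT_comp.
Qed.

Lemma generator_moment_all_moments i k : all_moments mu (gen i k).
Proof.
have mono l := start_moment_all_moments l.
have st (g : 'I_d.+1 -> R) := state_all_moments g.
apply: all_momentsD; first by apply: all_momentsM => //; exact: (st (fun l => Q l i)).
apply: all_momentsM; first exact: (st (fun l => (l == i)%:R)).
apply: (@all_moments_sum _ _ _ mu _ _ _ (fun j x =>
  (alpha j 0 x.2 - gamma j 0 x.2 * tnth x.1 j) * ((k j)%:R * start_moment (index_sub k j 1) x)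
    + sigma j 0 x.2 ^+ 2 * ((k j * (k j - 1))%:R * start_moment (index_sub k j 2) x) / 2)) => j.
apply: all_momentsD.
  apply: all_momentsM; last exact: all_momentsZ.
  apply: all_momentsB; first exact: (st (fun l => alpha j 0 l)).
  by apply: all_momentsM; [exact: (st (fun l => gamma j 0 l))|exact: stationary_tnth_all_moments].
apply: all_momentsM; last exact: all_moments_cst.
apply: all_momentsM; last exact: all_momentsZ.
exact: (st (fun l => sigma j 0 l ^+ 2)).
Qed.

(** No limit under the integral is taken: for each [e] one value of [s] suffices, and after division
    by [s ^+ 2] the remainder contributes at most [e] times the mean [K] of a power of the
    weight. *)
Lemma generator_mean_eq0 i k : \int[mu]_x gen i k x = 0.
Proof.
have [q hq] := expansion i k; have rhoP := all_momentsX q start_weight_all_moments.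
set K := \int[mu]_x (rho x ^+ q).
have K0 : 0 <= K by apply: mean_ge0 => x; rewrite exprn_ge0// (le_trans ler01)// start_weight_ge1.
pose f (x : E) := (x.2 == i)%:R * start_moment k x.
have fP : all_moments mu f.
  by apply: all_momentsM; [exact: (state_all_moments (fun l => (l == i)%:R))|exact: start_moment_all_moments].
have LP := generator_moment_all_moments i k.
have key e : 0 < e -> `|\int[mu]_x gen i k x| <= e * K.
  move=> e0; have [s /andP[s0 ss1] hs] := hq e e0.
  have t0 : 0 <= s ^+ 2 := sqr_ge0 s; have tp : 0 < s ^+ 2 by rewrite exprn_gt0.
  pose Y : {mfun T >-> E} := HB.pack (joint_process M X (s ^+ 2))
    (isMeasurableFun.Build _ _ _ _ _ (joint_process_measurable t0)).
  have fY : f \o Y = (fun w => (X (s ^+ 2) w == i)%:R * \prod_j M j (s ^+ 2) w ^+ k j).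
    apply/funext => w; rewrite /f /Y/= /start_moment; congr (_ * _).
    by apply: eq_bigr => j _; rewrite tnth_mktuple.
  have [iH EH] : mu.-integrable setT (EFin \o (fun x => \int[P x]_w f (Y w))) /\
      \int[mu]_x (\int[P x]_w f (Y w)) = \int[mu]_x f x.
    apply: stationary_mean.
    - by move=> U mU; exact: preimage_kernel.
    - by move=> U mU; rewrite -(muE t0 mU).
    - exact: all_moments_measurable fP.
    - exact: all_moments_integrable fP.
    - move=> x; rewrite fY; apply: all_moments_integrable; apply: monomial.
      by rewrite s0.
  pose H x := \int[P x]_w f (Y w) - f x - s ^+ 2 * gen i k x.
  have Hle x : `|H x| <= e * s ^+ 2 * rho x ^+ q.
    rewrite /H (_ : \int[P x]_w f (Y w) =
      \int[P x]_w ((X (s ^+ 2) w == i)%:R * \prod_j M j (s ^+ 2) w ^+ k j)); last by rewrite -fY.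
    by apply: hs; rewrite s0 lexx.
  have if1 := all_moments_integrable fP.
  have iL : mu.-integrable setT (EFin \o (fun x => s ^+ 2 * gen i k x)).
    by apply: all_moments_integrable; exact: all_momentsZ.
  have i1 : mu.-integrable setT (EFin \o (fun x => \int[P x]_w f (Y w) - f x)).
    exact: (integrableB measurableT iH if1).
  have iHH : mu.-integrable setT (EFin \o H) by exact: (integrableB measurableT i1 iL).
  have HE : \int[mu]_x H x = - (s ^+ 2 * \int[mu]_x gen i k x).
    by rewrite RintegralB// RintegralB// EH subrr add0r meanZ.
  have : `|\int[mu]_x H x| <= e * s ^+ 2 * K.
    rewrite -meanZ//; apply: le_trans (le_normr_Rintegral measurableT iHH) _.
    apply: le_Rintegral => //.
    - exact: integrable_norm iHH.
    - by apply: all_moments_integrable; exact: all_momentsZ.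
  by rewrite HE normrN normrM (gtr0_norm tp) [leRHS]mulrAC [leLHS]mulrC ler_pM2r.
apply/eqP; rewrite -normr_le0; apply/ler_addgt0Pl => e e0.
have K1 : 0 < K + 1 by rewrite ltr_wpDl.
apply: le_trans (key (e / (K + 1)) _) _; first by rewrite divr_gt0.
by rewrite addr0 mulrAC ler_pdivrMr// ler_wpM2l ?(ltW e0)// lerDl.
Qed.

(** The mean of the generator vanishes; multiplying that identity by the sign of [k] expresses it
    through signed moments. The mean-reversion term involves the monomial of exponent [k] again,
    which moves it to the left-hand side. *)
Lemma signed_moment_recursion (k : {ffun 'I_J -> nat}) i :
  let h (l : {ffun 'I_J -> nat}) m := (-1) ^+ (\sum_j l j)%N * \int[mu]_x ((x.2 == m)%:R * start_moment l x) in
  \sum_l Q l i * h k l - \sum_j (k j)%:R * (gamma j 0 i * h k i) =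
  \sum_j (k j)%:R * (alpha j 0 i * h (index_sub k j 1) i) -
  2^-1 * \sum_j (k j * (k j - 1))%:R * (sigma j 0 i ^+ 2 * h (index_sub k j 2) i).
Proof.
move=> h; pose m l i' := \int[mu]_x ((x.2 == i')%:R * start_moment l x).
have momP l i' : all_moments mu (fun x => (x.2 == i')%:R * start_moment l x).
  apply: all_momentsM; last exact: start_moment_all_moments.
  exact: (state_all_moments (fun l => (l == i')%:R)).
have genE x : gen i k x = \sum_l Q l i * ((x.2 == l)%:R * start_moment k x) +
    \sum_j (alpha j 0 i * (k j)%:R * ((x.2 == i)%:R * start_moment (index_sub k j 1) x)
      - gamma j 0 i * (k j)%:R * ((x.2 == i)%:R * start_moment k x)
      + sigma j 0 i ^+ 2 / 2 * (k j * (k j - 1))%:R *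
        ((x.2 == i)%:R * start_moment (index_sub k j 2) x)).
  rewrite /generator_moment; congr (_ + _).
    rewrite (bigD1 x.2)//= eqxx mul1r big1 ?addr0// => l /negbTE h'.
    by rewrite eq_sym h' mul0r mulr0.
  have [->|_] := eqVneq x.2 i; last first.
    by rewrite mul0r big1// => j _; rewrite !mul0r !mulr0 subrr addr0.
  rewrite mul1r; apply: eq_bigr => j _; rewrite !mul1r -(mulrA (gamma j 0 i)).
  by rewrite -start_moment_mul_tnth; field.
have := generator_mean_eq0 i k; rewrite (eq_Rintegral _ (fun x _ => genE x)).
have S1 : all_moments mu (fun x => \sum_l Q l i * ((x.2 == l)%:R * start_moment k x)).
  apply: (@all_moments_sum _ _ _ mu _ _ _ (fun l x => Q l i * ((x.2 == l)%:R * start_moment k x))) => l.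
  exact: all_momentsZ.
pose U j (x : E) := alpha j 0 i * (k j)%:R * ((x.2 == i)%:R * start_moment (index_sub k j 1) x)
      - gamma j 0 i * (k j)%:R * ((x.2 == i)%:R * start_moment k x)
      + sigma j 0 i ^+ 2 / 2 * (k j * (k j - 1))%:R *
        ((x.2 == i)%:R * start_moment (index_sub k j 2) x).
have UP j : all_moments mu (U j).
  apply: all_momentsD; last exact: all_momentsZ.
  by apply: all_momentsB; exact: all_momentsZ.
have S2 : all_moments mu (fun x => \sum_j U j x) by exact: all_moments_sum.
rewrite meanD// !mean_sum//; last by move=> l; exact: all_momentsZ.
have EU j : \int[mu]_x U j x = alpha j 0 i * (k j)%:R * m (index_sub k j 1) i
   - gamma j 0 i * (k j)%:R * m k i
   + sigma j 0 i ^+ 2 / 2 * (k j * (k j - 1))%:R * m (index_sub k j 2) i.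
  rewrite meanD; [|by apply: all_momentsB; exact: all_momentsZ|exact: all_momentsZ].
  by rewrite meanB; [rewrite !meanZ|exact: all_momentsZ..].
rewrite (eq_bigr _ (fun j _ => EU j)).
rewrite (eq_bigr (fun l => Q l i * m k l)); last by move=> l _; rewrite meanZ.
move=> gen0; set sgn : R := (-1) ^+ (\sum_j k j)%N.
(* Lowering one exponent by 1 reverses the sign and lowering it by 2 preserves it; when the exponent
   is too small, both sides are 0. *)
have sgn1 j : (k j)%:R * (alpha j 0 i * h (index_sub k j 1) i) =
    - sgn * (alpha j 0 i * (k j)%:R * m (index_sub k j 1) i).
  have [kj|kj] := posnP (k j); first by rewrite kj !(mul0r, mulr0).
  by rewrite /sgn (sum_index_sub kj) exprD expr1 /h -/(m _ _); ring.
have sgn2 j : (k j * (k j - 1))%:R * (sigma j 0 i ^+ 2 * h (index_sub k j 2) i) =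
    2 * sgn * (sigma j 0 i ^+ 2 / 2 * (k j * (k j - 1))%:R * m (index_sub k j 2) i).
  have [kj|kj] := leqP (k j) 1.
    have -> : (k j * (k j - 1) = 0)%N by case: (k j) kj => [|[|]].
    by rewrite !(mul0r, mulr0).
  by rewrite /sgn (sum_index_sub kj) exprD sqrrN expr1n /h -/(m _ _); field.
have := congr1 (fun z => sgn * z) gen0; rewrite mulr0 mulrDr => gen1.
rewrite (eq_bigr _ (fun j _ => sgn1 j)) (eq_bigr _ (fun j _ => sgn2 j)).
apply/eqP; rewrite -subr_eq0; apply/eqP; rewrite -[RHS]gen1.
have -> : \sum_l Q l i * h k l = sgn * \sum_l Q l i * m k l.
  by rewrite mulr_sumr; apply: eq_bigr => l _; rewrite /h -/(m k l) /sgn; ring.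
rewrite -!addrA; congr (_ + _).
rewrite !mulr_sumr !opprD !opprK -!sumrN -!big_split/=; apply: eq_bigr => j _.
by rewrite /h -/(m k i) -/sgn; field.
Qed.

End StationaryMoments.

(** * Passage to the kernel and to the random variable of the statement *)

Section MeasureLaw.
Context {R : realType} {dT} {T : measurableType dT}.

(** A name for [m] that carries the proof of total mass 1, on which a probability structure can be
    declared. The measure is unchanged, so the assumptions of the model transfer to it. *)
Definition law_of (m : {measure set T -> \bar R}) of (m setT = 1)%E : set T -> \bar R := m.

Section Instances.
Variables (m : {measure set T -> \bar R}) (m1 : (m setT = 1)%E).
HB.instance Definition _ := Measure.on (law_of m1).
HB.instance Definition _ := Measure_isProbability.Build _ _ _ (law_of m1) m1.
End Instances.

Lemma law_ofE (m : {measure set T -> \bar R}) (m1 : (m setT = 1)%E) :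
  ((law_of m1 : probability T R) : {measure set T -> \bar R}) = m.
Proof. by case: m m1. Qed.

End MeasureLaw.

Section DistributionMoments.
Context {R : realType} {dS dE} {S : measurableType dS} {E : measurableType dE}.
Variables (PS : probability S R) (Z : {RV PS >-> E}).

Lemma all_moments_distribution (U : E -> R) :
  all_moments (distribution PS Z) U -> all_moments PS (U \o Z).
Proof.
move=> UP; have mU := all_moments_measurable UP.
apply: all_moments_even; first exact: measurableT_comp.
move=> n; have U2 := all_momentsX n.*2 UP.
rewrite -[X in (X < _)%E]/(\int[PS]_w ((fun y => (U y ^+ n.*2)%:E) \o Z) w)%E.
rewrite -ge0_integral_distribution.
- by rewrite all_moments_integral// ltry.
- by apply/measurable_EFinP; exact: all_moments_measurable U2.
- by move=> y; rewrite lee_fin exprn_even_ge0// odd_double.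
Qed.

Lemma mean_distribution (U : E -> R) : all_moments (distribution PS Z) U ->
  \int[PS]_w U (Z w) = \int[distribution PS Z]_x U x.
Proof.
move=> UP; rewrite /Rintegral -[in LHS]/(\int[PS]_w ((EFin \o U) \o Z) w)%E integral_distribution//.
- by apply/measurable_EFinP; exact: all_moments_measurable UP.
- exact: all_moments_integrable (all_moments_distribution UP).
Qed.

End DistributionMoments.

Theorem mainTheorem10 (R : realType) (d J : nat) (hJ : (0 < J)%N)
    (Q : 'M[R]_d.+1) (pi : 'cV[R]_d.+1)
    (alpha gamma sigma : 'I_J -> 'rV[R]_d.+1)
    (dT : measure_display) (T : measurableType dT)
    (P : R.-pker (J.-tuple R * 'I_d.+1)%type ~> T)
    (X : R -> T -> 'I_d.+1) (B M : 'I_J -> R -> T -> R)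
    (dS : measure_display) (S : measurableType dS) (PS : probability S R)
    (Z : {RV PS >-> (J.-tuple R * 'I_d.+1)%type})
    (hQ : is_generator Q)
    (hpi : unique_invariant_distribution Q pi)
    (hgamma : forall j i, 0 < gamma j 0 i)
    (hM : forall x, modulated_OU Q alpha gamma sigma (P x) x X B M)
    (hZ : stationary_distribution P (joint_process M X) (distribution PS Z)) :
  let h := moment_vector PS Z in
  [/\ forall k i, PS.-integrable [set: S] (EFin \o moment_rv Z k i),
      h [ffun=> 0%N] = pi
    & forall k : {ffun 'I_J -> nat}, k != [ffun=> 0%N] ->
        let A := Q^T - \sum_j (k j)%:R *: diag_mx (gamma j) in
        A \in unitmx /\
        h k = invmx A *m
          (\sum_j (k j)%:R *: (diag_mx (alpha j) *m h (index_sub k j 1))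
           - 2^-1 *: \sum_j (k j * (k j - 1))%N%:R *:
               (diag_mx (map_mx (fun a => a ^+ 2) (sigma j))
                  *m h (index_sub k j 2)))].
Proof.
pose law x : probability T R := law_of (prob_kernel (s := P) x).
have hL x : modulated_OU Q alpha gamma sigma (law x) x X B M.
  by rewrite /law law_ofE.
pose a j i := `|alpha j 0 i| + `|gamma j 0 i| + `|sigma j 0 i|.
have a0 j i : 0 <= a j i by rewrite !addr_ge0.
(* One constant bounds all coefficients of all components in all states; as a sum of nonnegative
   terms it dominates each of them. *)
pose C := \sum_j \sum_i a j i.
have coef_le j i : a j i <= C.
  apply: le_trans (_ : \sum_l a j l <= _); first by rewrite (bigD1 i)//= lerDl sumr_ge0.
  by rewrite /C (bigD1 j)//= lerDl sumr_ge0// => l _; rewrite sumr_ge0.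
have alC j i : `|alpha j 0 i| <= C.
  by apply: le_trans (coef_le j i); rewrite /a -addrA lerDl addr_ge0.
have gaC j i : `|gamma j 0 i| <= C.
  by apply: le_trans (coef_le j i); rewrite /a addrAC lerDr addr_ge0.
have sgC j i : `|sigma j 0 i| <= C.
  by apply: le_trans (coef_le j i); rewrite lerDr addr_ge0.
have C0 : 0 <= C by rewrite /C; apply: sumr_ge0 => j _; exact: sumr_ge0.
have [p hp] := family_semigroup hL.
have [kappa [h0 [kappa0 h00 exitP]]] := semigroup_exit_bound hp.
(* The last argument ensures [C * s1 ^+ 2 <= C * s1 <= C / (2 * C + 1)], which is at most
   [1 / 2]. *)
pose s1 := Num.min 1 (Num.min h0 (2 * C + 1)^-1).
have C1 : 0 < 2 * C + 1 by rewrite ltr_wpDl// mulr_ge0.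
have s10 : 0 < s1 <= 1 by rewrite !lt_min ltr01 h00 invr_gt0 C1 ge_min lexx.
have /andP[s1p s1l] := s10.
have s1s : s1 ^+ 2 <= s1 by rewrite expr2 ler_piMl// ltW.
have s1h : s1 ^+ 2 <= h0 by apply: le_trans s1s _; rewrite /s1 !ge_min lexx orbT.
have s1C : C * s1 ^+ 2 <= 1 / 2.
  have : s1 <= (2 * C + 1)^-1 by rewrite /s1 !ge_min lexx !orbT.
  rewrite -[leRHS]mul1r ler_pdivlMr// => h1.
  have := ler_wpM2l C0 s1s; lra.
pose mu : probability (J.-tuple R * 'I_d.+1)%type R := distribution PS Z.
have muE t : 0 <= t -> forall U, measurable U ->
    (\int[mu]_x law x (joint_process M X t @^-1` U))%E = mu U := @hZ t.
have mX t : 0 <= t -> measurable_fun setT (X t).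
  by move=> t0; have [+ _ _] := mou_chain (hL point); exact.
have mM j t : 0 <= t -> measurable_fun setT (M j t) by exact: (mou_measurable (hL point)).
have mP U : measurable U -> measurable_fun setT (fun x => law x U).
  exact: measurable_kernel.
have contraction j n := path_moment_contraction hL hp kappa0 exitP alC gaC sgC s10 s1h s1C n (hgamma j).
have monomial i (k : {ffun 'I_J -> nat}) s x : 0 < s <= s1 ->
    all_moments (law x) (fun w => (X (s ^+ 2) w == i)%:R * \prod_j M j (s ^+ 2) w ^+ k j).
  exact: (monomial_all_moments hL hp kappa0 exitP alC gaC sgC s10 s1h s1C).
have expansion i k := generator_expansion hL hp kappa0 exitP alC gaC sgC s10 s1h s1C i k.
have momentP (k : {ffun 'I_J -> nat}) i : all_moments mu
    (fun x => (-1) ^+ (\sum_j k j)%N * ((x.2 == i)%:R * start_moment k x)).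
  apply: all_momentsZ; apply: all_momentsM; first exact: (@state_all_moments _ _ _ mu (fun l => (l == i)%:R)).
  exact: (start_moment_all_moments mX mM mP muE contraction).
have momentE k i : moment_rv Z k i =
    (fun x => (-1) ^+ (\sum_j k j)%N * ((x.2 == i)%:R * start_moment k x)) \o Z.
  by apply/funext => w; rewrite /moment_rv /= -mulrA (mulrC (\prod_j _)).
move=> h.
have hE (k : {ffun 'I_J -> nat}) i : h k i 0 = (-1) ^+ (\sum_j k j)%N * \int[mu]_x ((x.2 == i)%:R * start_moment k x).
  rewrite mxE unlock -[LHS]/(\int[PS]_w moment_rv Z k i w) momentE.
  rewrite (mean_distribution (momentP k i)) meanZ//; apply: all_momentsM.
    exact: (@state_all_moments _ _ _ mu (fun l => (l == i)%:R)).
  exact: (start_moment_all_moments mX mM mP muE contraction).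
have recursion (k : {ffun 'I_J -> nat}) : (Q^T - \sum_j (k j)%:R *: diag_mx (gamma j)) *m h k =
    \sum_j (k j)%:R *: (diag_mx (alpha j) *m h (index_sub k j 1))
    - 2^-1 *: \sum_j (k j * (k j - 1))%N%:R *:
        (diag_mx (map_mx (fun a => a ^+ 2) (sigma j)) *m h (index_sub k j 2)).
  apply/matrixP => i z; rewrite (ord1 z) {z} mulmxBl mulmx_suml !mxE !summxE.
  have -> : \sum_l Q^T i l * h k l 0 = \sum_l Q l i * h k l 0.
    by apply: eq_bigr => l _; rewrite mxE.
  have -> : \sum_j ((k j)%:R *: diag_mx (gamma j) *m h k) i 0 =
      \sum_j (k j)%:R * (gamma j 0 i * h k i 0).
    by apply: eq_bigr => j _; rewrite -scalemxAl mxE mul_diag_mx mxE.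
  have -> : \sum_j ((k j)%:R *: (diag_mx (alpha j) *m h (index_sub k j 1))) i 0 =
      \sum_j (k j)%:R * (alpha j 0 i * h (index_sub k j 1) i 0).
    by apply: eq_bigr => j _; rewrite mxE mul_diag_mx mxE.
  have -> : \sum_j ((k j * (k j - 1))%N%:R *: (diag_mx (map_mx (fun a => a ^+ 2) (sigma j))
        *m h (index_sub k j 2))) i 0 =
      \sum_j (k j * (k j - 1))%:R * (sigma j 0 i ^+ 2 * h (index_sub k j 2) i 0).
    by apply: eq_bigr => j _; rewrite mxE mul_diag_mx !mxE.
  under [X in X - _ = _]eq_bigr => l _ do rewrite hE.
  under [X in _ - X = _]eq_bigr => j _ do rewrite hE.
  under [X in _ = X - _]eq_bigr => j _ do rewrite hE.
  under [X in _ = _ - _ * X]eq_bigr => j _ do rewrite hE.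
  have rec := signed_moment_recursion mX mM mP muE contraction monomial expansion k i.
  exact: rec.
split=> [k i||k k0 A].
- by rewrite momentE; exact/all_moments_integrable/all_moments_distribution/momentP.
- have h0E i : h [ffun=> 0%N] i 0 = \int[mu]_x ((x.2 == i)%:R : R).
    rewrite hE big1 ?expr0 ?mul1r => [|j _]; last by rewrite ffunE.
    apply: eq_Rintegral => x _; rewrite /start_moment big1 ?mulr1// => j _.
    by rewrite ffunE expr0.
  (* The zeroth moments form the law of the state under the stationary distribution. They solve the
     recursion at exponent 0, which reads [Q^T *m h = 0], and uniqueness identifies them with
     [pi]. *)
  have [_] := hpi; apply; split=> [i||].
  + by rewrite h0E mean_ge0.
  + under eq_bigr do rewrite h0E.
    rewrite -mean_sum => [|i]; last exact: (@state_all_moments _ _ _ mu (fun l => (l == i)%:R)).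
    rewrite -[RHS](mean_cst mu); apply: eq_Rintegral => x _.
    by rewrite (bigD1 x.2)//= eqxx big1 ?addr0// => i /negbTE xi; rewrite eq_sym xi.
  + have := recursion [ffun=> 0%N].
    rewrite !big1 => [|j _|j _|j _]; rewrite ?ffunE ?mul0n ?scale0r//.
    by rewrite scaler0 !subr0.
(* The subtracted matrices add up to one diagonal matrix; some [k j] is positive, so all its entries
   are. *)
have unitA : A \in unitmx.
  have -> : A = Q^T - diag_mx (\sum_j (k j)%:R *: gamma j).
    by congr (_ - _); rewrite linear_sum; apply: eq_bigr => j _; rewrite linearZ.
  apply: generator_sub_diag_unitmx => // i; rewrite summxE.
  have [j kj] : exists j, (0 < k j)%N.
    apply/existsP; apply: contraNT k0; rewrite negb_exists => /forallP kz.
    by apply/eqP/ffunP => j; rewrite ffunE; apply/eqP; rewrite -leqn0 leqNgt; exact: kz.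
  rewrite (bigD1 j)//= mxE ltr_pwDl ?mulr_gt0 ?ltr0n//.
  by apply: sumr_ge0 => l _; rewrite mxE mulr_ge0// ltW.
by split=> //; rewrite -recursion mulKmx.
Qed.
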